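(* Let $\alpha>0$, $\beta>0$ and let $T>0$ be fixed. Let $u_0,g_0,g_1,f$ satisfy the standing assumptions in the context, and suppose in addition that $g_0$, $g_1$ and $f$ are weakly $T$-periodic in the following sense: $$\int_0^\infty|g_k(\tau+T)-g_k(\tau)|\,d\tau<+\infty\ (k=0,1),\qquad\int_0^\infty|f(0,\tau+T)-f(0,\tau)|\,d\tau<+\infty,$$ $$\int_0^\infty|f_x(0,\tau+T)-f_x(0,\tau)|\,d\tau<+\infty,\qquad\int_0^\infty\!\!\int_0^\infty|f(x,\tau+T)-f(x,\tau)|\,d\tau\,dx<+\infty,$$ $$\int_0^\infty\!\!\int_0^\infty|f_{xx}(x,\tau+T)-f_{xx}(x,\tau)|\,d\tau\,dx<+\infty.$$ Let $U(x,t)$ be the solution, given by the integral formula in the context, of $$\partial_tU=\alpha\partial_x^2U-\beta\partial_x^4U+f\ \text{ in }Q,\qquad U(x,0)=u_0(x)\ (x>0),\qquad U(0,t)=g_0(t),\ \ U_x(0,t)=g_1(t)\ (t>0).$$ Then $U$ is eventually $T$-periodic, i.e. for every fixed $x_0>0$, $$\lim_{t\to\infty}[U(x_0,t+T)-U(x_0,t)]=0.$$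
   Context: $Q=\mathbb R^+\times\mathbb R^+$, $\mathbb R^+=(0,\infty)$, $\overline Q=[0,\infty)\times[0,\infty)$. $\mathcal S([0,\infty))$ is the space of $C^\infty$ functions on $[0,\infty)$ which, together with all derivatives, are rapidly decreasing as $x\to\infty$. Standing assumptions on the data: $u_0\in\mathcal S([0,\infty))$, $g_0,g_1\in C^\infty([0,\infty))$, and $f\in C^\infty(\overline Q)$ with $f(\cdot,t)\in\mathcal S([0,\infty))$ uniformly for $t$ in compact subsets of $[0,\infty)$, i.e. for all integers $\ell,n\ge0$ and all $t_0>0$, $\sup\{x^\ell|\partial_x^nf(x,t)|:x\ge0,\ 0\le t\le t_0\}<\infty$. Notation: $\omega(\lambda)=\alpha\lambda^2+\beta\lambda^4$; $\hat u_0(\lambda)=\int_0^\infty e^{-i\lambda y}u_0(y)\,dy$ and $\hat f(\lambda,t)=\int_0^\infty e^{-i\lambda y}f(y,t)\,dy$ for $\operatorname{Im}\lambda\le0$; $\widetilde g_j(\omega(\lambda),t)=\int_0^te^{\omega(\lambda)\tau}g_j(\tau)\,d\tau$; $\widetilde{\hat f}(\mu,\omega(\lambda),t)=\int_0^te^{\omega(\lambda)\tau}\hat f(\mu,\tau)\,d\tau$ for $\operatorname{Im}\mu\le0$. $\Omega=\{\lambda:\operatorname{Im}\lambda\ge0,\ \operatorname{Re}(\alpha\lambda^2+\beta\lambda^4)\le0\}$. Its boundary $\partial\Omega$ consists of two curves, one through $0$ (lower) and one through $i\sqrt{\alpha/\beta}$ (upper); it is positively oriented, i.e. the lower curve is traversed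 from left to right and the upper curve from right to left. $\rho(\lambda)=-\sqrt{\lambda^2+\alpha/\beta}$ (principal square root) is the holomorphic branch of the square root of $\lambda^2+\alpha/\beta$ on $\mathbb C-\{i\eta:\eta\in\mathbb R,\ |\eta|\ge\sqrt{\alpha/\beta}\}$ that is negative on $\mathbb R$; $\rho(i\sqrt{\alpha/\beta})=0$ by continuity. It satisfies $\operatorname{Im}[i\rho(\lambda)]\le0$ on $\partial\Omega$. The function $U$ is defined for $x>0$, $t>0$ by $$\begin{aligned}U(x,t)=&\frac1{2\pi}\int_{-\infty}^\infty e^{i\lambda x-\omega(\lambda)t}\hat u_0(\lambda)\,d\lambda+\frac1{2\pi}\int_{\partial\Omega}e^{i\lambda x-\omega(\lambda)t}\left[\frac{i\lambda+\rho(\lambda)}{i\lambda-\rho(\lambda)}\hat u_0(-\lambda)-\frac{2i\lambda}{i\lambda-\rho(\lambda)}\hat u_0(i\rho(\lambda))\right]d\lambda\\&-\frac{\beta i}\pi\int_{\partial\Omega}e^{i\lambda x-\omega(\lambda)t}\lambda[i\lambda+\rho(\lambda)]\big[\rho(\lambda)\widetilde g_0(\omega(\lambda),t)-\widetilde g_1(\omega(\lambda),t)\big]d\lambda+\frac1{2\pi}\int_{-\infty}^\infty e^{i\lambda x-\omega(\lambda)t}\widetilde{\hat f}(\lambda,\omega(\lambda),t)\,d\lambda\\&+\frac1{2\pi}\int_{\partial\Omega}e^{i\lambda x-\omega(\lambda)t}\left[\frac{i\lambda+\rho(\lambda)}{i\lambda-\rho(\lambda)}\widetilde{\hat f}(-\lambda,\omega(\lambda),t)-\frac{2i\lambda}{i\lambda-\rho(\lambda)}\widetilde{\hat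 f}(i\rho(\lambda),\omega(\lambda),t)\right]d\lambda.\end{aligned}$$ *)

(* Defs.v *)
From HB Require Import structures.
From mathcomp Require Import all_boot all_order all_algebra.
From mathcomp Require Import complex ring lra.
From mathcomp Require Import all_classical all_reals all_analysis.

Set Implicit Arguments.
Unset Strict Implicit.
Unset Printing Implicit Defensive.

Import Order.TTheory GRing.Theory Num.Theory.
Import numFieldNormedType.Exports.

Local Open Scope classical_set_scope.
Local Open Scope ring_scope.
Local Open Scope complex_scope.

(** The topology of the complex numbers is the one of [R[i]^o], and
    [Normc.normc z : R] is the modulus. *)

Section ComplexFunctions.
Context {R : realType}.

Definition cexp (z : R[i]) : R[i] :=
  (expR (complex.Re z))%:C * (cos (complex.Im z) +i* sin (complex.Im z)).

(* [\int] is here the real-valued Lebesgue integral [Rintegral]. *)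
Definition cintegral (D : set R) (F : R -> R[i]) : R[i] :=
  (\int[@lebesgue_measure R]_(s in D) complex.Re (F s))
    +i* (\int[@lebesgue_measure R]_(s in D) complex.Im (F s)).

End ComplexFunctions.

(** Smoothness up to the boundary.  Derivatives are taken relative to the
    closed half-line [0, oo): two-sided at x > 0 and one-sided at x = 0.  The
    values of a function at negative arguments are never used. *)

Section HalfLine.
Context {R : realType}.

Definition half_quotient (u : R -> R[i]) (x y : R) : R[i]^o :=
  (u y - u x) / (y - x)%:C.

Definition half_derivable (u : R -> R[i]) (x : R) : Prop :=
  cvg (half_quotient u x y @[y --> within `[0, +oo[ x^']).

Definition half_derive (u : R -> R[i]) (x : R) : R[i] :=
  lim (half_quotient u x y @[y --> within `[0, +oo[ x^']).

Definition half_smooth (u : R -> R[i]) : Prop :=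
  forall (n : nat) (x : R), 0 <= x -> half_derivable (iter n half_derive u) x.

Definition half_schwartz (u : R -> R[i]) : Prop :=
  half_smooth u /\
  forall l n : nat,
    has_ubound [set x ^+ l * Normc.normc (iter n half_derive u x)
               | x in `[0, +oo[].

End HalfLine.

Section Quadrant.
Context {R : realType}.
Implicit Types f : R -> R -> R[i].

Definition partial_x f : R -> R -> R[i] :=
  fun x t => half_derive (fun y => f y t) x.

Definition partial_t f : R -> R -> R[i] :=
  fun x t => half_derive (f x) t.

(* A word [w] encodes a mixed derivative: [true] for t, [false] for x. *)
Definition mixed_partial (w : seq bool) f : R -> R -> R[i] :=
  foldr (fun b : bool => if b then partial_t else partial_x) f w.

Definition quadrant_smooth f : Prop :=
  forall w : seq bool,
    (forall x t : R, 0 <= x -> 0 <= t ->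
       half_derivable (fun y => mixed_partial w f y t) x /\
       half_derivable (mixed_partial w f x) t) /\
    {within (`[0, +oo[ `*` `[0, +oo[ : set (R * R)),
       continuous (fun p => mixed_partial w f p.1 p.2 : R[i]^o)}.

Definition loc_unif_schwartz f : Prop :=
  forall (l n : nat) (t0 : R), 0 < t0 ->
    has_ubound [set p.1 ^+ l * Normc.normc (iter n partial_x f p.1 p.2)
               | p in (`[0, +oo[ `*` `[0, t0] : set (R * R))].

End Quadrant.

Section Transforms.
Context {R : realType}.

Definition half_fourier (u : R -> R[i]) (l : R[i]) : R[i] :=
  cintegral `[0, +oo[ (fun y => cexp (- 'i%C * l * y%:C) * u y).

Definition time_transform (g : R -> R[i]) (w : R[i]) (t : R) : R[i] :=
  cintegral `[0, t] (fun tau => cexp (w * tau%:C) * g tau).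

Definition half_fourier_time (f : R -> R -> R[i]) (mu w : R[i]) (t : R) :
    R[i] :=
  time_transform (fun tau => half_fourier (fun y => f y tau) mu) w t.

End Transforms.

Section Solution.
Context {R : realType} (alpha beta : R).

Definition omega (l : R[i]) : R[i] := alpha%:C * l ^+ 2 + beta%:C * l ^+ 4.

Definition Omega : set (R[i]) :=
  [set l | 0 <= complex.Im l /\ complex.Re (omega l) <= 0].

(* For l = a + i b, the equation Re (omega l) = 0 reads
   beta b^4 - (alpha + 6 beta a^2) b^2 + a^2 (alpha + beta a^2) = 0,
   a quadratic equation in b^2 with two nonnegative roots. *)
Definition Omega_disc (a : R) : R :=
  Num.sqrt (alpha ^+ 2 + 8 * alpha * beta * a ^+ 2
            + 32 * beta ^+ 2 * a ^+ 4).

Definition lower_height (a : R) : R :=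
  Num.sqrt ((alpha + 6 * beta * a ^+ 2 - Omega_disc a) / (2 * beta)).

Definition upper_height (a : R) : R :=
  Num.sqrt ((alpha + 6 * beta * a ^+ 2 + Omega_disc a) / (2 * beta)).

(* Omega is the region between the two graphs, so that its boundary consists
   of the curves a |-> a + i lower_height a and a |-> a + i upper_height a. *)
Lemma OmegaP (a b : R) : 0 < alpha -> 0 < beta ->
  Omega (a +i* b) <-> lower_height a <= b <= upper_height a.
Proof.
move=> alpha0 beta0; have alpha_ge0 := ltW alpha0; have beta_ge0 := ltW beta0.
have a2 : 0 <= a ^+ 2 by exact: sqr_ge0.
have disc0 : 0 <= alpha ^+ 2 + 8 * alpha * beta * a ^+ 2
    + 32 * beta ^+ 2 * a ^+ 4.
  have a4 : 0 <= a ^+ 4 by exact: exprn_even_ge0.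
  have := mulr_ge0 (mulr_ge0 alpha_ge0 beta_ge0) a2.
  have := mulr_ge0 (sqr_ge0 beta) a4.
  have := sqr_ge0 alpha.
  by lra.
have D2 : Omega_disc a ^+ 2 = _ := sqr_sqrtr disc0.
have D0 : 0 <= Omega_disc a by exact: sqrtr_ge0.
have ReE : complex.Re (omega (a +i* b)) =
    alpha * (a ^+ 2 - b ^+ 2)
    + beta * (a ^+ 4 - 6 * a ^+ 2 * b ^+ 2 + b ^+ 4).
  by rewrite /omega !exprS expr0 /=; ring.
set D := Omega_disc a in D0 D2 *.
set P := alpha + 6 * beta * a ^+ 2.
have P0 : 0 < P by have := mulr_ge0 beta_ge0 a2; rewrite /P; lra.
have PD : 4 * beta * complex.Re (omega (a +i* b)) =
    (2 * beta * b ^+ 2 - P) ^+ 2 - D ^+ 2.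
  by rewrite ReE D2 /P; ring.
have ReP : (complex.Re (omega (a +i* b)) <= 0) =
    (P - D <= 2 * beta * b ^+ 2 <= P + D).
  have b4 : 0 < 4 * beta by rewrite mulr_gt0.
  rewrite -(pmulr_rle0 _ b4) PD subr_le0 -[leLHS]real_normK ?num_real //.
  by rewrite ler_sqr ?nnegrE // ler_distl.
have beta2 : 0 < 2 * beta by rewrite mulr_gt0.
have Y0 : 0 <= (P + D) / (2 * beta).
  exact: divr_ge0 (addr_ge0 (ltW P0) D0) (ltW beta2).
have lowP : 0 <= b ->
    (lower_height a <= b) = (P - D <= 2 * beta * b ^+ 2).
  move=> b0; rewrite -[X in _ <= X](ger0_norm b0) -sqrtr_sqr.
  by rewrite ler_sqrt ?sqr_ge0 // ler_pdivrMr // [b ^+ 2 * _]mulrC.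
have upP : 0 <= b ->
    (b <= upper_height a) = (2 * beta * b ^+ 2 <= P + D).
  move=> b0; rewrite -[X in X <= _](ger0_norm b0) -sqrtr_sqr.
  by rewrite ler_sqrt // ler_pdivlMr // [b ^+ 2 * _]mulrC.
rewrite /Omega /= ReP; split=> [[b0]|lub]; first by rewrite lowP // upP.
have b0 : 0 <= b by case/andP: lub => [lb _]; exact: le_trans (sqrtr_ge0 _) lb.
by split=> //; rewrite -lowP // -upP.
Qed.

Lemma lower_height0 : 0 < alpha -> lower_height 0 = 0.
Proof.
move=> alpha0; rewrite /lower_height /Omega_disc !expr0n /= !mulr0 !addr0.
by rewrite sqrtr_sqr gtr0_norm // subrr mul0r sqrtr0.
Qed.

Lemma upper_height0 : 0 < alpha -> 0 < beta ->
  upper_height 0 = Num.sqrt (alpha / beta).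
Proof.
move=> alpha0 beta0; rewrite /upper_height /Omega_disc !expr0n /=.
rewrite !mulr0 !addr0 sqrtr_sqr gtr0_norm //; congr Num.sqrt.
by field; rewrite gt_eqF.
Qed.

(* The graph of [h] traversed from left to right. *)
Definition graph_integral (h : R -> R) (F : R[i] -> R[i]) : R[i] :=
  cintegral setT (fun a => F (a +i* h a) * (1 +i* derive1 h a)).

(* Positive orientation: the upper curve is traversed from right to left. *)
Definition boundary_integral (F : R[i] -> R[i]) : R[i] :=
  graph_integral lower_height F - graph_integral upper_height F.

Definition line_integral (F : R[i] -> R[i]) : R[i] :=
  cintegral setT (fun a => F a%:C).

(* [sqrtc] is the principal square root, unlike [sqrtC], whose imaginary part
   is nonnegative. *)
Definition rho (l : R[i]) : R[i] := - sqrtc (l ^+ 2 + (alpha / beta)%:C).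

Definition evolution_kernel (x t : R) (l : R[i]) : R[i] :=
  cexp ('i%C * l * x%:C - omega l * t%:C).

(* The combination of transforms which occurs in both boundary integrals, for
   [V] the transform of the initial datum or of the forcing term. *)
Definition reflected (V : R[i] -> R[i]) (l : R[i]) : R[i] :=
  ('i%C * l + rho l) / ('i%C * l - rho l) * V (- l)
  - 2 * 'i%C * l / ('i%C * l - rho l) * V ('i%C * rho l).

Definition solution (u0 g0 g1 : R -> R[i]) (f : R -> R -> R[i]) (x t : R) :
    R[i] :=
  ((2 * pi)^-1)%:C *
    line_integral (fun l => evolution_kernel x t l * half_fourier u0 l)
  + ((2 * pi)^-1)%:C *
    boundary_integral (fun l =>
      evolution_kernel x t l * reflected (half_fourier u0) l)
  - beta%:C * 'i%C / pi%:C *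
    boundary_integral (fun l =>
      evolution_kernel x t l * l * ('i%C * l + rho l) *
      (rho l * time_transform g0 (omega l) t
       - time_transform g1 (omega l) t))
  + ((2 * pi)^-1)%:C *
    line_integral (fun l =>
      evolution_kernel x t l * half_fourier_time f l (omega l) t)
  + ((2 * pi)^-1)%:C *
    boundary_integral (fun l =>
      evolution_kernel x t l *
      reflected (fun mu => half_fourier_time f mu (omega l) t) l).

End Solution.

Section Periodicity.
Context {R : realType}.

Definition weakly_periodic (T : R) (g : R -> R[i]) : Prop :=
  (\int[@lebesgue_measure R]_(tau in `[0%R, +oo[)
     (Normc.normc (g (tau + T)%R - g tau))%:E < +oo)%E.

Definition weakly_periodic2 (T : R) (f : R -> R -> R[i]) : Prop :=
  (\int[@lebesgue_measure R]_(x in `[0%R, +oo[)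
     \int[@lebesgue_measure R]_(tau in `[0%R, +oo[)
       (Normc.normc (f x (tau + T)%R - f x tau))%:E < +oo)%E.

End Periodicity.

(* Main.v *)
Require Import Defs.
From HB Require Import structures.
From mathcomp Require Import all_boot all_order all_algebra.
From mathcomp Require Import complex ring lra.
From mathcomp Require Import all_classical all_reals all_analysis.
From mathcomp Require Import measurable_realfun.
Import Order.TTheory GRing.Theory Num.Theory.
Import numFieldNormedType.Exports.
Local Open Scope classical_set_scope.
Local Open Scope ring_scope.
Local Open Scope complex_scope.

(** The solution is a sum of five integrals in the spectral parameter l, over
    the real line or over the boundary curve.  The two integrals of the initial
    datum tend to 0 as t tends to infinity: on the real line because
    exp (- omega t) decays ([line_decay]), on the curve, where omega is purely
    imaginary, by the Riemann-Lebesgue lemma ([riemann_lebesgue]), the phase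
    Im omega having a nonzero derivative along each branch away from the
    imaginary axis ([is_derive_phase], [dphase_neq0]).

    The three other integrals contain the data through a transform in time.
    Exchanging the integrations in l and in time ([duhamel_fubini]) turns each
    of them into a Duhamel integral
      J t = int_0^t Phi (t - tau) tau dtau,
      Phi s tau = int exp (- omega s) V (l, tau) dl,
    in which V is linear in the data at time tau.  Translating by the period,
      J (t + T) - J t = int_0^T Phi (t + T - tau) tau dtau
        + int_0^t (Phi (t - tau) (tau + T) - Phi (t - tau) tau) dtau.
    As above, Phi s tau tends to 0 as s tends to infinity.  Weak periodicity
    makes the last integrand smaller than an integrable function N of tau
    alone, so that both integrals tend to 0 by dominated convergence
    ([duhamel_increment_vanishing]).  What remains is the bound
      |Phi s (tau + T) - Phi s tau| <= N tau, uniformly in s > 0.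

    On the curve the imaginary part of l is at least |Re l| / 3, so that for
    x > 0 the factor exp (i l x) decays exponentially and absorbs the
    coefficients, which grow polynomially since their denominator stays away
    from 0 ([denominator_ge], [wave_poly_le]); the bound is then immediate
    ([duhamel_L1_vanishing]).

    On the real line the wave has modulus 1, and the transform F of f (., tau)
    is bounded but need not be integrable in l.  Integrating by parts twice
    ([half_fourier_by_parts]),
      F = (F - F2 - f_x (0, tau) - i l f (0, tau)) / (1 + l ^ 2),
    where F2 is the transform of f_xx.  This expansion is where the weak
    periodicity of f (0, .), f_x (0, .) and f_xx enters.  Over one period, the
    first three terms change by at most 1 / (1 + l ^ 2) times an integrable
    function of tau.  The last term is not integrable in l, but its kernel
    int exp (i l x - omega s) l / (1 + l ^ 2) dl is bounded uniformly in
    s > 0 when x > 0 ([trace_kernel_le]). *)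

Set Implicit Arguments.
Unset Strict Implicit.
Unset Printing Implicit Defensive.

(** * Complex numbers *)

Notation Re := complex.Re.
Notation Im := complex.Im.
Import Normc.

Section ComplexBasics.
Context {R : realType}.
Implicit Types (x y : R[i]) (a b : R).

Lemma ReD x y : Re (x + y) = Re x + Re y. Proof. by case: x; case: y. Qed.
Lemma ImD x y : Im (x + y) = Im x + Im y. Proof. by case: x; case: y. Qed.
Lemma ReN x : Re (- x) = - Re x. Proof. by case: x. Qed.
Lemma ImN x : Im (- x) = - Im x. Proof. by case: x. Qed.
Lemma ReB x y : Re (x - y) = Re x - Re y. Proof. by rewrite ReD ReN. Qed.
Lemma ImB x y : Im (x - y) = Im x - Im y. Proof. by rewrite ImD ImN. Qed.
Lemma ReM x y : Re (x * y) = Re x * Re y - Im x * Im y.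
Proof. by case: x; case: y. Qed.
Lemma ImM x y : Im (x * y) = Re x * Im y + Im x * Re y.
Proof. by case: x => a b; case: y => c d /=; rewrite [b * c]mulrC. Qed.

Lemma complexP x y : Re x = Re y -> Im x = Im y -> x = y.
Proof. by case: x => a b; case: y => c d /= -> ->. Qed.

Lemma normc_ge0 x : 0 <= normc x.
Proof. by case: x => a b; exact: sqrtr_ge0. Qed.

Lemma Re_le_normc x : `|Re x| <= normc x.
Proof.
case: x => a b /=; rewrite -sqrtr_sqr ler_wsqrtr // lerDl.
exact: sqr_ge0.
Qed.

Lemma Im_le_normc x : `|Im x| <= normc x.
Proof.
case: x => a b /=; rewrite -sqrtr_sqr ler_wsqrtr // lerDr.
exact: sqr_ge0.
Qed.

Lemma normcD x y : normc (x + y) <= normc x + normc y.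
Proof. exact: le_normcD. Qed.

Lemma normcN x : normc (- x) = normc x.
Proof. exact: normcN. Qed.

Lemma normcB x y : normc (x - y) <= normc x + normc y.
Proof. by rewrite -[normc y]normcN; exact: normcD. Qed.

Lemma normcR a : normc a%:C = `|a|.
Proof. by rewrite /= expr0n addr0 sqrtr_sqr. Qed.

Lemma normcX x n : normc (x ^+ n) = normc x ^+ n.
Proof.
elim: n => [|n ih]; first by rewrite !expr0 normc1.
by rewrite !exprS normcM ih.
Qed.

Lemma normc_imag : normc ('i%C : R[i]) = 1.
Proof. by rewrite /= expr0n add0r expr1n sqrtr1. Qed.

Lemma normc_sqr x : normc x ^+ 2 = Re x ^+ 2 + Im x ^+ 2.
Proof. by case: x => a b /=; rewrite sqr_sqrtr // addr_ge0 ?sqr_ge0. Qed.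

Lemma normc_le_ReIm x : normc x <= `|Re x| + `|Im x|.
Proof.
rewrite -(ler_pXn2r (n := 2)) ?nnegrE ?normc_ge0 ?addr_ge0 //.
rewrite normc_sqr sqrrD !real_normK ?num_real // addrAC lerDl.
by rewrite mulrn_wge0 // mulr_ge0.
Qed.

Lemma cexpD x y : cexp (x + y) = cexp x * cexp y.
Proof.
rewrite /cexp ReD ImD expRD cosD sinD.
by apply: complexP => /=; ring.
Qed.

Lemma normc_cexp x : normc (cexp x) = expR (Re x).
Proof.
rewrite /cexp normcM normcR ger0_norm ?expR_ge0 //=.
by rewrite cos2Dsin2 sqrtr1 mulr1.
Qed.

Lemma Re_cexp x : Re (cexp x) = expR (Re x) * cos (Im x).
Proof. by rewrite /cexp /= mul0r subr0. Qed.

Lemma Im_cexp x : Im (cexp x) = expR (Re x) * sin (Im x).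
Proof. by rewrite /cexp /= mul0r addr0. Qed.

Lemma normc_cexp_le1 x : Re x <= 0 -> normc (cexp x) <= 1.
Proof. by move=> x0; rewrite normc_cexp expR_le1. Qed.

End ComplexBasics.

(** * Measurable complex-valued functions *)

Section ComplexMeasurable.
Context {R : realType} d (X : measurableType d).
Implicit Types (D : set X) (F G : X -> R[i]).

Definition cmeasurable D F :=
  measurable_fun D (fun x => Re (F x)) /\ measurable_fun D (fun x => Im (F x)).

Lemma cmeasurable_cst D (c : R[i]) : cmeasurable D (fun=> c).
Proof. by split; exact: measurable_cst. Qed.

Lemma cmeasurableD D F G :
  cmeasurable D F -> cmeasurable D G -> cmeasurable D (fun x => F x + G x).
Proof.
move=> [Fr Fi] [Gr Gi]; split.
  by under eq_fun do rewrite ReD; exact: measurable_funD.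
by under eq_fun do rewrite ImD; exact: measurable_funD.
Qed.

Lemma cmeasurableN D F : cmeasurable D F -> cmeasurable D (fun x => - F x).
Proof.
move=> [Fr Fi]; split.
  by under eq_fun do rewrite ReN; exact: measurable_funN.
by under eq_fun do rewrite ImN; exact: measurable_funN.
Qed.

Lemma cmeasurableB D F G :
  cmeasurable D F -> cmeasurable D G -> cmeasurable D (fun x => F x - G x).
Proof. by move=> mF mG; apply: cmeasurableD => //; exact: cmeasurableN. Qed.

Lemma cmeasurableM D F G :
  cmeasurable D F -> cmeasurable D G -> cmeasurable D (fun x => F x * G x).
Proof.
move=> [Fr Fi] [Gr Gi]; split.
  under eq_fun do rewrite ReM.
  by apply: measurable_funB; exact: measurable_funM.
under eq_fun do rewrite ImM.
by apply: measurable_funD; exact: measurable_funM.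
Qed.

Lemma cmeasurableX D F n : cmeasurable D F -> cmeasurable D (fun x => F x ^+ n).
Proof.
move=> mF; elim: n => [|n ih]; first exact: cmeasurable_cst.
by under eq_fun do rewrite exprS; exact: cmeasurableM.
Qed.

Lemma cmeasurable_real D (f : X -> R) :
  measurable_fun D f -> cmeasurable D (fun x => (f x)%:C).
Proof. by move=> mf; split => //=; exact: measurable_cst. Qed.

Lemma cmeasurable_complex D (f g : X -> R) :
  measurable_fun D f -> measurable_fun D g ->
  cmeasurable D (fun x => f x +i* g x).
Proof. by move=> mf mg; split. Qed.

Lemma measurable_sqrtr D (f : X -> R) :
  measurable_fun D f -> measurable_fun D (fun x => Num.sqrt (f x)).
Proof.
move=> mf; apply: measurableT_comp mf.
by apply: continuous_measurable_fun; exact: sqrt_continuous.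
Qed.

Lemma measurable_invr D (f : X -> R) :
  measurable_fun D f -> measurable_fun D (fun x => (f x)^-1).
Proof.
move=> mf; rewrite [X in measurable_fun _ X](_ : _ =
    (fun x => f x * (f x ^+ 2) `^ (-1))); last first.
  apply/funext => x; rewrite powR_inv1 ?sqr_ge0 //.
  have [->|fx0] := eqVneq (f x) 0; first by rewrite invr0 mul0r.
  by rewrite expr2; field.
apply: measurable_funM => //.
apply: (measurableT_comp (measurable_powR _)).
exact: measurable_funX.
Qed.

Lemma cmeasurableV D F : cmeasurable D F -> cmeasurable D (fun x => (F x)^-1).
Proof.
move=> [Fr Fi].
have mn : measurable_fun D (fun x => (Re (F x) ^+ 2 + Im (F x) ^+ 2)^-1).
  by apply: measurable_invr; apply: measurable_funD; exact: measurable_funX.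
split.
  rewrite [X in measurable_fun _ X](_ : _ =
    (fun x => Re (F x) * (Re (F x) ^+ 2 + Im (F x) ^+ 2)^-1)).
    exact: measurable_funM.
  by apply/funext => x; case: (F x).
rewrite [X in measurable_fun _ X](_ : _ =
    (fun x => - (Im (F x) * (Re (F x) ^+ 2 + Im (F x) ^+ 2)^-1))).
  by apply: measurable_funN; exact: measurable_funM.
by apply/funext => x; case: (F x).
Qed.

Lemma cmeasurable_cexp D F :
  cmeasurable D F -> cmeasurable D (fun x => cexp (F x)).
Proof.
move=> [Fr Fi].
have me : measurable_fun D (fun x => expR (Re (F x))).
  by apply: measurableT_comp => //; exact: measurable_expR.
have mc : measurable_fun D (fun x => cos (Im (F x))).
  apply: measurableT_comp => //.
  by apply: continuous_measurable_fun; exact: continuous_cos.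
have ms : measurable_fun D (fun x => sin (Im (F x))).
  apply: measurableT_comp => //.
  by apply: continuous_measurable_fun; exact: continuous_sin.
split.
  by under eq_fun do rewrite Re_cexp; exact: measurable_funM.
by under eq_fun do rewrite Im_cexp; exact: measurable_funM.
Qed.

Lemma cmeasurable_sqrtc D F : measurable D ->
  cmeasurable D F -> cmeasurable D (fun x => sqrtc (F x)).
Proof.
move=> mD [Fr Fi].
have mr : measurable_fun D
    (fun x => Num.sqrt (Re (F x) ^+ 2 + Im (F x) ^+ 2)).
  apply: measurable_sqrtr.
  by apply: measurable_funD; exact: measurable_funX.
split.
  rewrite [X in measurable_fun _ X](_ : _ = (fun x => Num.sqrt
      ((Num.sqrt (Re (F x) ^+ 2 + Im (F x) ^+ 2) + Re (F x)) * 2^-1))).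
    apply: measurable_sqrtr; apply: measurable_funM => //.
    exact: measurable_funD.
  by apply/funext => x; case: (F x).
rewrite [X in measurable_fun _ X](_ : _ = (fun x =>
    (if Im (F x) < 0 then -1 else 1) * Num.sqrt
      ((Num.sqrt (Re (F x) ^+ 2 + Im (F x) ^+ 2) - Re (F x)) * 2^-1))).
  apply: measurable_funM.
    apply: measurable_fun_if => //.
    - exact: measurable_fun_ltr.
  apply: measurable_sqrtr; apply: measurable_funM => //.
  exact: measurable_funB.
apply/funext => x; case: (F x) => a b /=; congr (_ * _).
by case: (ltrgt0P b) => // b0; [rewrite gtr0_sg|rewrite ltr0_sg].
Qed.

Lemma measurable_normc D F :
  cmeasurable D F -> measurable_fun D (fun x => normc (F x)).
Proof.
move=> [Fr Fi]; rewrite [X in measurable_fun _ X](_ : _ =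
    (fun x => Num.sqrt (Re (F x) ^+ 2 + Im (F x) ^+ 2))).
  apply: measurable_sqrtr.
  by apply: measurable_funD; exact: measurable_funX.
by apply/funext => x; case: (F x).
Qed.

Lemma cmeasurableS D E F :
  measurable E -> D `<=` E -> cmeasurable E F -> cmeasurable D F.
Proof. by move=> mE DE [Fr Fi]; split; exact: measurable_funS mE DE _. Qed.

Lemma cmeasurableT D F : cmeasurable setT F -> cmeasurable D F.
Proof. exact: cmeasurableS. Qed.

End ComplexMeasurable.

Lemma cmeasurable_comp {R : realType} d1 d2 (X : measurableType d1)
    (Y : measurableType d2) (F : Y -> R[i]) (g : X -> Y) (D : set X) :
  cmeasurable setT F -> measurable_fun D g -> cmeasurable D (fun x => F (g x)).
Proof.
by move=> [Fr Fi] mg; split;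
  [exact: (measurableT_comp Fr mg)|exact: (measurableT_comp Fi mg)].
Qed.

(** * Integrals of complex-valued functions *)

Section ComplexIntegral.
Context {R : realType}.
Notation mu := (@lebesgue_measure R).
Implicit Types (D : set R) (F G : R -> R[i]) (B : R -> R).

Definition cintegrable D F :=
  mu.-integrable D (fun x => (Re (F x))%:E) /\
  mu.-integrable D (fun x => (Im (F x))%:E).

Lemma le_integrable_real D (f B : R -> R) : measurable D ->
  measurable_fun D f -> mu.-integrable D (fun x => (B x)%:E) ->
  (forall x, D x -> `|f x| <= B x) -> mu.-integrable D (fun x => (f x)%:E).
Proof.
move=> mD mf iB fB; apply: le_integrable iB => //.
  exact/measurable_EFinP.
move=> x Dx; rewrite /= lee_fin; apply: le_trans (fB x Dx) _; exact: ler_norm.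
Qed.

Lemma integrableZ_real D a (f : R -> R) : measurable D ->
  mu.-integrable D (fun x => (f x)%:E) ->
  mu.-integrable D (fun x => (a * f x)%:E).
Proof. by move=> mD fi; under eq_fun do rewrite EFinM; exact: integrableZl. Qed.

Lemma integrableD_real D (f g : R -> R) : measurable D ->
  mu.-integrable D (fun x => (f x)%:E) -> mu.-integrable D (fun x => (g x)%:E) ->
  mu.-integrable D (fun x => (f x + g x)%:E).
Proof. by move=> mD fi gi; under eq_fun do rewrite EFinD; exact: integrableD. Qed.

Lemma integrableB_real D (f g : R -> R) : measurable D ->
  mu.-integrable D (fun x => (f x)%:E) -> mu.-integrable D (fun x => (g x)%:E) ->
  mu.-integrable D (fun x => (f x - g x)%:E).
Proof. by move=> mD fi gi; under eq_fun do rewrite EFinB; exact: integrableB. Qed.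

Lemma cintegrable_le D F B : measurable D -> cmeasurable D F ->
  mu.-integrable D (fun x => (B x)%:E) ->
  (forall x, D x -> normc (F x) <= B x) -> cintegrable D F.
Proof.
move=> mD [Fr Fi] iB FB; split; apply: (le_integrable_real mD _ iB) => // x Dx.
  by apply: le_trans (Re_le_normc _) _; exact: FB.
by apply: le_trans (Im_le_normc _) _; exact: FB.
Qed.

Lemma cintegrable_measurable D F : cintegrable D F -> cmeasurable D F.
Proof.
by move=> [/measurable_int/measurable_EFinP ? /measurable_int/measurable_EFinP].
Qed.

Lemma cintegrable_normc D F : measurable D -> cintegrable D F ->
  mu.-integrable D (fun x => (normc (F x))%:E).
Proof.
move=> mD iF; have [iFr iFi] := iF.
have i2 : mu.-integrable D (fun x => (`|Re (F x)| + `|Im (F x)|)%:E).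
  under eq_fun do rewrite EFinD.
  by apply: integrableD => //; exact: integrable_norm.
apply: (le_integrable_real mD _ i2).
  exact/measurable_normc/cintegrable_measurable.
by move=> x _; rewrite ger0_norm ?normc_ge0 //; exact: normc_le_ReIm.
Qed.

Lemma cintegrableS D E F : measurable D -> measurable E -> D `<=` E ->
  cintegrable E F -> cintegrable D F.
Proof. by move=> mD mE DE [? ?]; split; exact: (@integrableS _ _ _ mu E). Qed.

(** The factor 2 comes from bounding the modulus by |Re| + |Im|. *)
Lemma normc_cintegral_le D F B : measurable D -> cmeasurable D F ->
  mu.-integrable D (fun x => (B x)%:E) ->
  (forall x, D x -> normc (F x) <= B x) ->
  normc (cintegral D F) <= 2 * \int[mu]_(x in D) B x.
Proof.
move=> mD mF iB FB; have [iFr iFi] := cintegrable_le mD mF iB FB.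
apply: le_trans (normc_le_ReIm _) _ => /=.
rewrite mulr_natl mulr2n; apply: lerD.
  apply: le_trans
    (@le_normr_Rintegral _ _ _ mu D (fun x => Re (F x)) mD iFr) _.
  apply: le_Rintegral => //; first exact: integrable_norm.
  by move=> x Dx; apply: le_trans (Re_le_normc _) _; exact: FB.
apply: le_trans
  (@le_normr_Rintegral _ _ _ mu D (fun x => Im (F x)) mD iFi) _.
apply: le_Rintegral => //; first exact: integrable_norm.
by move=> x Dx; apply: le_trans (Im_le_normc _) _; exact: FB.
Qed.

Lemma cintegrableD D F G : measurable D ->
  cintegrable D F -> cintegrable D G -> cintegrable D (fun x => F x + G x).
Proof.
move=> mD [Fr Fi] [Gr Gi]; split.
  by under eq_fun do rewrite ReD EFinD; exact: integrableD.
by under eq_fun do rewrite ImD EFinD; exact: integrableD.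
Qed.

Lemma cintegrableN D F : measurable D -> cintegrable D F -> cintegrable D (fun x => - F x).
Proof.
move=> mD [Fr Fi]; split.
  by under eq_fun do rewrite ReN EFinN; exact: integrableN.
by under eq_fun do rewrite ImN EFinN; exact: integrableN.
Qed.

Lemma cintegrableB D F G : measurable D ->
  cintegrable D F -> cintegrable D G -> cintegrable D (fun x => F x - G x).
Proof. by move=> mD iF iG; apply: cintegrableD => //; exact: cintegrableN. Qed.

Lemma cintegrableZ D F (c : R[i]) : measurable D -> cintegrable D F ->
  cintegrable D (fun x => c * F x).
Proof.
move=> mD [Fr Fi].
split.
  under eq_fun do rewrite ReM EFinB.
  by apply: integrableB => //; exact: integrableZ_real.
under eq_fun do rewrite ImM EFinD.
by apply: integrableD => //; exact: integrableZ_real.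
Qed.

Lemma eq_cintegral D F G : (forall x, D x -> F x = G x) ->
  cintegral D F = cintegral D G.
Proof.
move=> FG; apply: complexP => /=; apply: eq_Rintegral => x /set_mem Dx /=;
  by rewrite FG.
Qed.

Lemma cintegralD D F G : measurable D ->
  cintegrable D F -> cintegrable D G ->
  cintegral D (fun x => F x + G x) = cintegral D F + cintegral D G.
Proof.
move=> mD [Fr Fi] [Gr Gi]; apply: complexP.
  by rewrite ReD /= -RintegralD //; apply: eq_Rintegral => x _; rewrite ReD.
by rewrite ImD /= -RintegralD //; apply: eq_Rintegral => x _; rewrite ImD.
Qed.

Lemma cintegralZ D F (c : R[i]) : measurable D -> cintegrable D F ->
  cintegral D (fun x => c * F x) = c * cintegral D F.
Proof.
move=> mD [Fr Fi].
apply: complexP.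
  rewrite ReM /= -!RintegralZl // -RintegralB //; try exact: integrableZ_real.
  by apply: eq_Rintegral => x _; rewrite ReM.
rewrite ImM /= -!RintegralZl // -RintegralD //; try exact: integrableZ_real.
by apply: eq_Rintegral => x _; rewrite ImM.
Qed.

Lemma cintegralN D F : measurable D -> cintegrable D F ->
  cintegral D (fun x => - F x) = - cintegral D F.
Proof.
move=> mD iF; rewrite -[RHS]mulN1r -cintegralZ //.
by apply: eq_cintegral => x _; rewrite mulN1r.
Qed.

Lemma cintegralB D F G : measurable D ->
  cintegrable D F -> cintegrable D G ->
  cintegral D (fun x => F x - G x) = cintegral D F - cintegral D G.
Proof.
move=> mD iF iG; rewrite cintegralD //; last exact: cintegrableN.
by rewrite cintegralN.
Qed.

Lemma cintegral_setU (A E : set R) F : measurable A -> measurable E ->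
  cintegrable (A `|` E) F -> [disjoint A & E] ->
  cintegral (A `|` E) F = cintegral A F + cintegral E F.
Proof.
by move=> mA mE [Fr Fi] AB; apply: complexP; rewrite ?ReD ?ImD /= Rintegral_setU.
Qed.

Lemma RintegralT_indic D (f : R -> R) :
  \int[mu]_(x in D) f x = \int[mu]_x (\1_D x * f x).
Proof.
rewrite Rintegral_mkcond; apply: eq_Rintegral => x _.
rewrite /patch indicE; case: ifP => _; first by rewrite mul1r.
by rewrite mul0r.
Qed.

Lemma cintegralT_indic D F :
  cintegral D F = cintegral setT (fun x => (\1_D x)%:C * F x).
Proof.
apply: complexP => /=; rewrite RintegralT_indic; apply: eq_Rintegral => x _.
  by rewrite ReM /= mul0r subr0.
by rewrite ImM /= mul0r addr0.
Qed.

Lemma cintegral_indic_sub D E F : D `<=` E ->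
  cintegral E (fun x => (\1_D x)%:C * F x) = cintegral D F.
Proof.
move=> DE; rewrite cintegralT_indic [RHS]cintegralT_indic.
apply: eq_cintegral => x _; rewrite !indicE.
have [xD|xD] := boolP (x \in D); last by rewrite mul0r mulr0.
by rewrite mem_set ?mul1r //; apply: DE; rewrite -inE.
Qed.

Lemma integrableT_indic D (f : R -> R) : measurable D ->
  mu.-integrable D (fun x => (f x)%:E) <->
  mu.-integrable setT (fun x => (\1_D x * f x)%:E).
Proof.
move=> mD; have := @integrable_mkcond _ _ _ mu D (fun x => (f x)%:E) mD.
suff -> : (fun x => (f x)%:E) \_ D = (fun x => (\1_D x * f x)%:E) by [].
apply/funext => x; rewrite /patch indicE; case: ifP => _; first by rewrite mul1r.
by rewrite mul0r.
Qed.

Lemma cintegrableT_indic D F : measurable D -> cintegrable D F <->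
  cintegrable setT (fun x => (\1_D x)%:C * F x).
Proof.
move=> mD; rewrite /cintegrable !(integrableT_indic _ mD).
have -> : (fun x => (Re ((\1_D x)%:C * F x))%:E) =
    (fun x => (\1_D x * Re (F x))%:E).
  by apply/funext => x; rewrite ReM /= mul0r subr0.
have -> : (fun x => (Im ((\1_D x)%:C * F x))%:E) =
    (fun x => (\1_D x * Im (F x))%:E).
  by apply/funext => x; rewrite ImM /= mul0r addr0.
by [].
Qed.

End ComplexIntegral.

(** * Functions of time that vanish at infinity *)

Section Vanishing.
Context {R : realType}.
Notation mu := (@lebesgue_measure R).
Implicit Types (F G : R -> R[i]).

Definition vanishing F := normc (F t) @[t --> +oo] --> (0 : R).

Lemma vanishing_le F (g : R -> R) :
  (\forall t \near +oo, normc (F t) <= g t) ->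
  g t @[t --> +oo] --> (0 : R) -> vanishing F.
Proof.
move=> Fg g0; apply: (squeeze_cvgr _ (cvg_cst 0) g0).
by near=> t; rewrite normc_ge0 /=; near: t.
Unshelve. all: by end_near. Qed.

Lemma near_eq_vanishing F G :
  (\forall t \near +oo, F t = G t) -> vanishing G -> vanishing F.
Proof.
move=> FG; apply: vanishing_le.
by near=> t; rewrite (near FG t).
Unshelve. all: by end_near. Qed.

Lemma vanishingD F G :
  vanishing F -> vanishing G -> vanishing (fun t => F t + G t).
Proof.
move=> F0 G0;
have FG : normc (F t) + normc (G t) @[t --> +oo] --> (0 : R).
  by rewrite -[X in _ --> X]addr0; exact: cvgD.
by apply: (vanishing_le _ FG); near=> t; exact: normcD.
Unshelve. all: by end_near. Qed.

Lemma vanishingZ F (c : R[i]) : vanishing F -> vanishing (fun t => c * F t).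
Proof.
move=> F0;
have cF : normc c * normc (F t) @[t --> +oo] --> (0 : R).
  by rewrite -[X in _ --> X](mulr0 (normc c)); apply: cvgM => //; exact: cvg_cst.
by apply: (vanishing_le _ cF); near=> t; rewrite normcM.
Unshelve. all: by end_near. Qed.

Lemma vanishingB F G :
  vanishing F -> vanishing G -> vanishing (fun t => F t - G t).
Proof.
move=> F0 /(vanishingZ (-1)) G0.
apply: (near_eq_vanishing _ (vanishingD F0 G0)).
by near=> t; rewrite mulN1r.
Unshelve. all: by end_near. Qed.

Lemma vanishing_ReIm F :
  Re (F t) @[t --> +oo] --> (0 : R) -> Im (F t) @[t --> +oo] --> (0 : R) ->
  vanishing F.
Proof.
move=> F1 F2.
have F12 : `|Re (F t)| + `|Im (F t)| @[t --> +oo] --> (0 : R).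
  by rewrite -[X in _ --> X]addr0; apply: cvgD; rewrite -[X in _ --> X](@normr0 R R); exact: cvg_norm.
by apply: (vanishing_le _ F12); near=> t; exact: normc_le_ReIm.
Unshelve. all: by end_near. Qed.

(** Convergence at infinity is tested along sequences, to which the dominated
    convergence theorem applies. *)
Lemma dominated_vanishing (D : set R) (F : R -> R -> R[i]) (B : R -> R) (t0 : R) :
  measurable D -> (forall t, t0 <= t -> cmeasurable D (F t)) ->
  mu.-integrable D (fun x => (B x)%:E) ->
  (forall t x, t0 <= t -> D x -> normc (F t x) <= B x) ->
  {ae mu, forall x, D x -> vanishing (F ^~ x)} ->
  vanishing (fun t => cintegral D (F t)).
Proof.
move=> mD mF iB FB F0.
pose I t := \int[mu]_(x in D) normc (F t x).
apply: (@vanishing_le _ (fun t => 2 * I t)).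
  near=> t; have tt0 : t0 <= t by near: t; by apply: nbhs_pinfty_ge; exact: num_real.
  apply: normc_cintegral_le => //; first exact: mF.
  apply: (le_integrable_real mD _ iB); first exact/measurable_normc/mF.
  by move=> x Dx; rewrite ger0_norm ?normc_ge0 //; exact: FB.
suff I0 : I t @[t --> +oo] --> (0 : R).
  by rewrite -[X in _ --> X](mulr0 2); apply: cvgM => //; exact: cvg_cst.
apply/cvg_pinftyP => u uy.
pose v n := Num.max t0 (u n).
have vy : v n @[n --> \oo] --> +oo.
  apply/cvgryPge => A; near=> n; rewrite le_max; apply/orP; right; near: n.
  by move/cvgryPge : uy; exact.
have IuvE : \forall n \near \oo, I (u n) = I (v n).
  near=> n; rewrite /v max_r //; near: n.
  by move/cvgryPge : uy; exact.
apply: (cvg_trans (near_eq_cvg (f := fun n => I (v n)) _)).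
  by apply: filterS IuvE => n ->.
have t0v n : t0 <= v n by rewrite le_max lexx.
have mv n : measurable_fun D (fun x => (normc (F (v n) x))%:E).
  exact/measurable_EFinP/measurable_normc/mF.
have [||_ _] := @dominated_convergence _ _ _ mu D mD
    (fun n x => (normc (F (v n) x))%:E) (cst 0%E) (fun x => (B x)%:E)
    mv (measurable_cst _) _ iB _.
- move: F0; apply: filterS; first exact: (ae_filter_ringOfSetsType mu).
  move=> x F0 Dx; apply/fine_cvgP; split; first by near=> n.
  rewrite [X in X @ _ --> _](_ : _ = (fun t => normc (F t x)) \o v) //.
  exact: cvg_comp vy (F0 Dx).
- apply: aeW => x n Dx; rewrite gee0_abs ?lee_fin ?normc_ge0 //.
  exact: FB.
rewrite integral0 => /fine_cvgP [_]; exact: cvg_trans.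
Unshelve. all: by end_near. Qed.

End Vanishing.

(** * The Riemann-Lebesgue lemma for a regular phase *)

Section Derivatives.
Context {R : realType}.
Implicit Types (f df : R -> R) (a c d x : R).

Lemma is_derive_continuous f x a :
  is_derive x (1 : R) f a -> {for x, continuous f}.
Proof.
by move=> fa; apply/differentiable_continuous; rewrite -derivable1_diffP.
Qed.

Lemma is_derive_within_continuous f df c d :
  (forall x : R, c <= x <= d -> is_derive x (1 : R) f (df x)) ->
  {within `[c, d], continuous f}.
Proof.
move=> fd; apply: derivable_within_continuous => x.
by rewrite in_itv /= => /fd fx; exact: ex_derive.
Qed.

Lemma is_derive_LRcontinuous f df c d : c < d ->
  (forall x : R, c <= x <= d -> is_derive x (1 : R) f (df x)) ->
  derivable_oo_LRcontinuous f c d.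
Proof.
move=> cd fd; split.
- move=> x; rewrite in_itv /= => /andP[cx xd].
  by have fx : is_derive x 1 f (df x); [apply: fd; rewrite !ltW|exact: ex_derive].
- apply: cvg_at_right_filter; apply: (@is_derive_continuous _ _ (df c)).
  by apply: fd; rewrite lexx ltW.
- apply: cvg_at_left_filter; apply: (@is_derive_continuous _ _ (df d)).
  by apply: fd; rewrite lexx ltW.
Qed.

Lemma is_derive_derive1 f df c d :
  (forall x : R, c <= x <= d -> is_derive x (1 : R) f (df x)) ->
  {in `]c, d[, derive1 f =1 df}.
Proof.
move=> fd x; rewrite in_itv /= => /andP[cx xd].
have fx : is_derive x 1 f (df x) by apply: fd; rewrite !ltW.
by rewrite derive1E derive_val.
Qed.

Lemma within_continuous_bounded f c d : {within `[c, d], continuous f} ->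
  exists2 M, 0 <= M & forall x, c <= x <= d -> `|f x| <= M.
Proof.
move=> cf.
have /compact_bounded[M [_ Mf]] := continuous_compact cf (@segment_compact _ c d).
exists (`|M| + 1); first by rewrite addr_ge0.
move=> x xcd; apply: Mf; last by exists x => //=; rewrite in_itv.
by rewrite (le_lt_trans (ler_norm _)) // ltrDl.
Qed.

Lemma cvg_inv_pinfty : x^-1 @[x --> +oo] --> (0 : R).
Proof.
apply: (@gtr0_cvgV0 _ _ _ _ (fun x : R => x) _).2; last exact: cvg_id.
by apply: nbhs_pinfty_gt; exact: num_real.
Qed.

Lemma within_continuous_measurable f c d :
  {within `[c, d], continuous f} -> measurable_fun `[c, d] f.
Proof. by move=> cf; exact: subspace_continuous_measurable_fun. Qed.

End Derivatives.

(** The functions [kappa] and [K] stand for cosine and sine, up to signs: real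
    and imaginary parts of oscillatory integrals are treated at once. *)
Section RiemannLebesgue.
Context {R : realType}.
Notation mu := (@lebesgue_measure R).
Variables (kappa K : R -> R).
Hypothesis K_deriv : forall x, is_derive x (1 : R) K (kappa x).
Hypothesis K_le1 : forall x, `|K x| <= 1.
Hypothesis kappa_le1 : forall x, `|kappa x| <= 1.
Hypothesis kappa_cont : continuous kappa.

Section Segment.
Variables (phi dphi : R -> R) (c d : R).
Hypothesis cd : c < d.
Hypothesis phi_deriv : forall x, c <= x <= d -> is_derive x (1 : R) phi (dphi x).
Hypothesis dphi_cont : {within `[c, d], continuous dphi}.

(** With the derivative of the phase as a factor, the oscillating function has
    the primitive K (s phi) / s. *)
Let osc s x := dphi x * kappa (s * phi x).

Let osc_cont s : {within `[c, d], continuous (osc s)}.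
Proof.
have phic := is_derive_within_continuous phi_deriv.
apply/subspace_continuousP => x xcd; apply: cvgM.
  by move/subspace_continuousP : dphi_cont; exact.
apply: (@cvg_comp _ _ _ (fun x => s * phi x) kappa); last exact: kappa_cont.
apply: cvgM; first exact: cvg_cst.
by move/subspace_continuousP : phic; exact.
Qed.

Let osc_le : exists2 M, 0 <= M & forall s x, c <= x <= d -> `|osc s x| <= M.
Proof.
have [M M0 dM] := within_continuous_bounded dphi_cont.
exists M => // s x xcd; rewrite normrM -[leRHS]mulr1.
by apply: ler_pM => //; exact: dM.
Qed.

Let osc_integrable s (g : R -> R) :
  mu.-integrable `[c, d] (fun x => (g x)%:E) ->
  mu.-integrable `[c, d] (fun x => (g x * osc s x)%:E).
Proof.
move=> ig; have [M M0 oM] := osc_le.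
have iMg : mu.-integrable `[c, d] (fun x => (M * `|g x|)%:E).
  by apply: integrableZ_real => //; exact: integrable_norm.
apply: (le_integrable_real _ _ iMg) => //.
  apply: measurable_funM; last exact: within_continuous_measurable.
  by move: ig => /measurable_int/measurable_EFinP.
move=> x; rewrite /= in_itv /= => xcd; rewrite normrM mulrC.
by apply: ler_wpM2r => //; exact: oM.
Qed.

Let I g s := \int[mu]_(x in `[c, d]) (g x * osc s x).

(** One integration by parts gives a bound of order 1 / s. *)
Let osc_C1 (g dg : R -> R) :
  (forall x : R, c <= x <= d -> is_derive x (1 : R) g (dg x)) ->
  {within `[c, d], continuous dg} ->
  I g s @[s --> +oo] --> (0 : R).
Proof.
move=> gd dgc.
have gc := is_derive_within_continuous gd.
have [M M0 gM] := within_continuous_bounded gc.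
have [M' M'0 dgM] := within_continuous_bounded dgc.
pose C := M + M + M' * (d - c).
suff IC s : 0 < s -> `|I g s| <= C * s^-1.
  apply/norm_cvg0P/(squeeze_cvgr _ (cvg_cst 0)); last first.
    rewrite -[X in _ --> X](mulr0 C); apply: cvgM; first exact: cvg_cst.
    exact: cvg_inv_pinfty.
  near=> s; rewrite normr_ge0 /=; apply: IC; near: s.
  by apply: nbhs_pinfty_gt; exact: num_real.
move=> s0.
pose P x := s^-1 * K (s * phi x).
have P_le x : `|P x| <= s^-1.
  rewrite normrM gtr0_norm ?invr_gt0 // -[leRHS]mulr1.
  by apply: ler_wpM2l => //; rewrite invr_ge0 ltW.
have Pd x : c <= x <= d -> is_derive x (1 : R) P (osc s x).
  move=> xcd; have phix := phi_deriv xcd.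
  rewrite /P /osc.
  have h1 : is_derive x (1 : R) (fun y => s * phi y) (s * dphi x).
    exact: is_deriveZ.
  have h2 : is_derive x (1 : R) (fun y => K (s * phi y)) (kappa (s * phi x) * (s * dphi x)).
    exact: (@is_derive1_comp _ K (fun y => s * phi y)).
  apply: (is_derive_eq (is_deriveZ _ h2)).
  by rewrite /GRing.scale /=; field; rewrite gt_eqF.
have Pc := is_derive_within_continuous Pd.
have -> : I g s = (g d * P d - g c * P c) - \int[mu]_(x in `[c, d]) (dg x * P x).
  apply: Rintegration_by_parts => //.
  - exact: is_derive_LRcontinuous gd.
  - exact: is_derive_derive1.
  - exact: is_derive_LRcontinuous Pd.
  - exact: is_derive_derive1.
have sV0 : 0 <= s^-1 by rewrite invr_ge0 ltW.
have gP x : c <= x <= d -> `|g x * P x| <= M * s^-1.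
  by move=> xcd; rewrite normrM; apply: ler_pM => //; exact: gM.
have intP : `|\int[mu]_(x in `[c, d]) (dg x * P x)| <= M' * s^-1 * (d - c).
  have idgP : mu.-integrable `[c, d] (fun x => (dg x * P x)%:E).
    apply: continuous_compact_integrable; first exact: segment_compact.
    move=> x; apply: cvgM; [exact: dgc|exact: Pc].
  apply: le_trans (le_normr_Rintegral _ idgP) _ => //.
  have -> : M' * s^-1 * (d - c) = \int[mu]_(x in `[c, d]) (M' * s^-1).
    rewrite Rintegral_cst //= lebesgue_measure_itv /= lte_fin cd.
    by rewrite -EFinD.
  apply: le_Rintegral => //; first exact: integrable_norm.
    apply: continuous_compact_integrable; first exact: segment_compact.
    by move=> x; exact: cvg_cst.
  move=> x; rewrite /= in_itv /= => xcd; rewrite normrM.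
  by apply: ler_pM => //; exact: dgM.
apply: le_trans (ler_normB _ _) _.
apply: le_trans (lerD (ler_normB _ _) intP) _.
have gPd : `|g d * P d| <= M * s^-1 by apply: gP; rewrite lexx ltW.
have gPc : `|g c * P c| <= M * s^-1 by apply: gP; rewrite lexx ltW.
apply: le_trans (lerD (lerD gPd gPc) (lexx _)) _.
by rewrite /C !mulrDl mulrAC.
Unshelve. all: by end_near. Qed.

Let osc_L1_closed (g : R -> R) (g_ : (R -> R)^nat) :
  mu.-integrable `[c, d] (fun x => (g x)%:E) ->
  (forall n, mu.-integrable `[c, d] (fun x => (g_ n x)%:E)) ->
  (\int[mu]_(x in `[c, d]) `|(g x - g_ n x)%:E|)%E @[n --> \oo] --> 0%E ->
  (forall n, I (g_ n) s @[s --> +oo] --> (0 : R)) ->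
  I g s @[s --> +oo] --> (0 : R).
Proof.
move=> ig ig_ gg I0; have [M M0 oM] := osc_le.
apply/cvgr0Pnorm_le => e e0.
have e2 : 0 < e / 2 / (M + 1) by rewrite !divr_gt0 // ltr_wpDl.
have /fine_cvgP[fin] := gg.
move/cvgr0Pnorm_le => /(_ _ e2) close.
have [n [fn cn]] : exists n,
   (\int[mu]_(x in `[c, d]) `|(g x - g_ n x)%:E|)%E \is a fin_num /\
   `|fine (\int[mu]_(x in `[c, d]) `|(g x - g_ n x)%:E|)%E| <= e / 2 / (M + 1).
  have [N _ NP] : \forall n \near \oo,
   (\int[mu]_(x in `[c, d]) `|(g x - g_ n x)%:E|)%E \is a fin_num /\
   `|fine (\int[mu]_(x in `[c, d]) `|(g x - g_ n x)%:E|)%E| <= e / 2 / (M + 1).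
    by near=> n; split; near: n.
  by exists N; apply: NP => /=.
have idg : mu.-integrable `[c, d] (fun x => (g x - g_ n x)%:E).
  exact: integrableB_real.
have In s : `|I g s| <= `|I (g_ n) s| + e / 2.
  have -> : I g s = I (g_ n) s + \int[mu]_(x in `[c, d]) ((g x - g_ n x) * osc s x).
    rewrite /I -RintegralD //; try exact: osc_integrable.
    by apply: eq_Rintegral => x _; ring.
  apply: le_trans (ler_normD _ _) _; rewrite lerD2l.
  apply: le_trans (le_normr_Rintegral _ (osc_integrable s idg)) _ => //.
  apply: (@le_trans _ _ (\int[mu]_(x in `[c, d]) (M * `|g x - g_ n x|))).
    apply: le_Rintegral => //.
    - by apply: integrable_norm => //; exact: osc_integrable.
    - by apply: integrableZ_real => //; exact: integrable_norm.
    - move=> x; rewrite /= in_itv /= => xcd; rewrite normrM mulrC.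
      by apply: ler_wpM2r => //; exact: oM.
  rewrite RintegralZl //; last exact: integrable_norm.
  have Mc : \int[mu]_(x in `[c, d]) `|g x - g_ n x| <= e / 2 / (M + 1).
    exact: le_trans (ler_norm _) cn.
  apply: le_trans (ler_wpM2l M0 Mc) _.
  rewrite mulrCA -[leRHS]mulr1; apply: ler_wpM2l; first by rewrite divr_ge0 // ltW.
  by rewrite ler_pdivrMr ?mul1r ?lerDl // ltr_wpDl.
have e20 : 0 < e / 2 by rewrite divr_gt0.
near=> s; apply: le_trans (In s) _; rewrite [leRHS](splitr e) lerD2r.
by near: s; move/cvgr0Pnorm_le : (I0 n); exact.
Unshelve. all: by end_near. Qed.

(** The moving averages of a continuous amplitude are of class C^1 and converge
    to it. *)
Let osc_continuous (g : R -> R) : continuous g -> I g s @[s --> +oo] --> (0 : R).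
Proof.
move=> gc.
have gwc (p q : R) : {within `[p, q], continuous g}.
  by apply: continuous_subspaceT.
have gi (p q : R) : mu.-integrable `[p, q] (fun x => (g x)%:E).
  by apply: continuous_compact_integrable => //; exact: segment_compact.
pose A x := \int[mu]_(t in `[c - 1, x]) g t.
have Ad x : c <= x <= d + 2 -> is_derive x (1 : R) A (g x).
  move=> /andP[cx xd].
  have xd3 : x < d + 3 by lra.
  have cx1 : c - 1 < x by lra.
  have [dA A'] := continuous_FTC1_closed xd3 (gi _ _) cx1 (gc x).
  by apply: DeriveDef; [exact: dA|rewrite -derive1E; exact: A'].
pose h (n : nat) : R := n.+1%:R^-1.
have h0 n : 0 < h n by rewrite invr_gt0.
have h1 n : h n <= 1 by rewrite invf_le1 // ler1n.
pose g_ n x := (h n)^-1 * (A (x + h n) - A x).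
have gE n x : c <= x <= d -> exists2 xi, x <= xi <= x + h n & g_ n x = g xi.
  move=> /andP[cx xd]; have hn0 := h0 n; have hn1 := h1 n.
  have xh : x <= x + h n by rewrite lerDl ltW.
  have dA y : y \in `]x, (x + h n)[ -> is_derive y (1 : R) A (g y).
    by rewrite in_itv /= => /andP[xy yx]; apply: Ad; lra.
  have cA : {within `[x, x + h n], continuous A}.
    by apply: (@is_derive_within_continuous _ _ g) => y /andP[xy yx]; apply: Ad; lra.
  have [xi] := MVT_segment xh dA cA.
  rewrite in_itv /= => xixh AE; exists xi => //.
  by rewrite /g_ AE addrAC subrr add0r mulrC mulfK // gt_eqF.
have [M M0 gM] := within_continuous_bounded (gwc c (d + 2)).
have g_M n x : c <= x <= d -> `|g_ n x| <= M.
  move=> xcd; have [xi /andP[xi1 xi2] ->] := gE n x xcd; apply: gM.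
  by case/andP: xcd => cx xd; have := h1 n; lra.
pose dg n x := (h n)^-1 * (g (x + h n) - g x).
have gd n x : c <= x <= d -> is_derive x (1 : R) (g_ n) (dg n x).
  move=> /andP[cx xd]; have hn0 := h0 n; have hn1 := h1 n.
  have d1 : is_derive x (1 : R) A (g x) by apply: Ad; lra.
  have d2 : is_derive (x + h n) (1 : R) A (g (x + h n)) by apply: Ad; lra.
  have d3 : is_derive x (1 : R) (fun y => y + h n) 1.
    by apply: (is_derive_eq (is_deriveD _ _)); rewrite addr0.
  have d4 : is_derive x (1 : R) (fun y => A (y + h n)) (g (x + h n) * 1).
    exact: (@is_derive1_comp _ A (fun y => y + h n)).
  apply: (is_derive_eq (is_deriveZ _ (is_deriveB _ _))).
  by rewrite /GRing.scale /= mulr1.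
have dgc n : continuous (dg n).
  move=> x; apply: cvgM; first exact: cvg_cst.
  apply: cvgB; last exact: gc.
  apply: (@cvg_comp _ _ _ (fun y => y + h n) g); last exact: gc.
  by apply: cvgD; [exact: cvg_id|exact: cvg_cst].
have gic n : mu.-integrable `[c, d] (fun x => (g_ n x)%:E).
  apply: continuous_compact_integrable; first exact: segment_compact.
  exact: is_derive_within_continuous (gd n).
apply: (osc_L1_closed (g_ := g_)) => //; last first.
  move=> n; apply: osc_C1 (gd n) _.
  exact: continuous_subspaceT.
have m2 n : measurable_fun `[c, d] (fun x => (g x - g_ n x)%:E).
  apply/measurable_EFinP; apply: measurable_funB.
    exact: within_continuous_measurable.
  by move: (gic n) => /measurable_int/measurable_EFinP.
have [|||||_ _] := @dominated_convergence _ _ _ mu `[c, d] _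
    (fun n x => (`|g x - g_ n x|)%:E) (cst 0%E) (fun x => (M + M)%:E) _
    (measurable_cst _) _ _ _.
- by [].
- by move=> n; apply/measurable_EFinP; apply: measurableT_comp => //; apply/measurable_EFinP; exact: m2.
- apply: aeW => x; rewrite /= in_itv /= => xcd; apply/fine_cvgP; split.
    by near=> n.
  apply/cvgr0Pnorm_le => e e0.
  have /cvgrPdist_le/(_ e e0) := gc x; rewrite near_nbhs => /nbhs_ballP[/= r r0 xr].
  have hc : h n @[n --> \oo] --> (0 : R) by exact: cvg_harmonic.
  move/cvgr0Pnorm_lt : hc => /(_ r r0) hr.
  near=> n; rewrite /= normr_id.
  have [xi /andP[xi1 xi2] ->] := gE n x xcd; apply: xr.
  rewrite /ball /= distrC ger0_norm ?subr_ge0 //.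
  have : `|h n| < r by near: n.
  by rewrite gtr0_norm //; lra.
- apply: continuous_compact_integrable; first exact: segment_compact.
  by move=> x; exact: cvg_cst.
- apply: aeW => x n; rewrite /= in_itv /= => xcd; rewrite lee_fin normr_id.
  apply: le_trans (ler_normB _ _) _; apply: lerD; last exact: g_M.
  by apply: gM; case/andP: xcd => *; lra.
rewrite integral0; exact: cvg_trans.
Unshelve. all: by end_near. Qed.

(** The amplitude divided by dphi is integrable, hence a limit in L^1 of
    continuous functions. *)
Lemma riemann_lebesgue_segment (G : R -> R) :
  (forall x, c <= x <= d -> dphi x != 0) ->
  mu.-integrable `[c, d] (fun x => (G x)%:E) ->
  \int[mu]_(x in `[c, d]) (G x * kappa (s * phi x)) @[s --> +oo] --> (0 : R).
Proof.
move=> dphi0 iG.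
have mdphi := within_continuous_measurable dphi_cont.
have dVc : {within `[c, d], continuous (fun x => (dphi x)^-1)}.
  apply/subspace_continuousP => x xcd; apply: cvgV.
    by apply: dphi0; move: xcd; rewrite /= in_itv.
  by move/subspace_continuousP : dphi_cont; exact.
have [M M0 dM] := within_continuous_bounded dVc.
pose psi x := G x / dphi x.
have ipsi : mu.-integrable `[c, d] (fun x => (psi x)%:E).
  have iMG : mu.-integrable `[c, d] (fun x => (M * `|G x|)%:E).
    by apply: integrableZ_real => //; exact: integrable_norm.
  apply: (le_integrable_real _ _ iMG) => //.
    apply: measurable_funM; last exact: measurable_invr.
    by move: iG => /measurable_int/measurable_EFinP.
  move=> x; rewrite /= in_itv /= => xcd; rewrite normrM mulrC.
  by apply: ler_wpM2r => //; exact: dM.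
have mucd : (mu `[c, d] < +oo)%E.
  by rewrite /= lebesgue_measure_itv /= lte_fin cd ltry.
have [g_ [gc gi gg]] := approximation_continuous_integrable
  (measurable_itv _ : measurable `[c, d]) mucd ipsi.
have -> : (fun s => \int[mu]_(x in `[c, d]) (G x * kappa (s * phi x))) = I psi.
  apply/funext => s; apply: eq_Rintegral => x /set_mem.
  rewrite /= in_itv /= => xcd; rewrite /psi /osc mulrA; congr (_ * _).
  by rewrite mulfVK // dphi0.
by apply: (osc_L1_closed (g_ := g_)) => // n; exact: osc_continuous.
Qed.

End Segment.

(** The phase may be singular at the ends of D.  The integral over D outside a
    large segment is small uniformly in s, because kappa is bounded. *)
Lemma riemann_lebesgue_exhaustion (phi dphi : R -> R) (D : set R) (c d : R^nat)
    (G : R -> R) :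
  measurable D -> (forall n, c n < d n) -> (forall n, `[c n, d n] `<=` D) ->
  (forall x, D x -> \forall n \near \oo, c n <= x <= d n) ->
  (forall x, D x -> is_derive x (1 : R) phi (dphi x)) ->
  (forall x, D x -> {for x, continuous dphi}) ->
  (forall x, D x -> dphi x != 0) ->
  measurable_fun D phi ->
  mu.-integrable D (fun x => (G x)%:E) ->
  \int[mu]_(x in D) (G x * kappa (s * phi x)) @[s --> +oo] --> (0 : R).
Proof.
move=> mD cd cdD Dcd phid dphic dphi0 mphi iG.
have mG : measurable_fun D G by move: iG => /measurable_int/measurable_EFinP.
have mk s : measurable_fun D (fun x => kappa (s * phi x)).
  apply: measurableT_comp; first exact: continuous_measurable_fun.
  by apply: measurable_funM.
have ik s E : measurable E -> E `<=` D ->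
    mu.-integrable E (fun x => (G x * kappa (s * phi x))%:E).
  move=> mE ED; apply: (@integrableS _ _ _ mu D) => //.
  have inG : mu.-integrable D (fun x => `|G x|%:E) by exact: integrable_norm.
  apply: (le_integrable_real mD _ inG).
    exact: measurable_funM.
  move=> x _; rewrite normrM -[leRHS]mulr1.
  by apply: ler_pM.
pose E n : set R := `[c n, d n]%classic.
pose tail n := \int[mu]_(x in D) (`|G x| - \1_(E n) x * `|G x|).
have tail0 : tail n @[n --> \oo] --> 0.
  have mi n : measurable_fun D (\1_(E n) : R -> R).
    by apply: measurable_indic; exact: measurable_itv.
  have [||||_ _] := @dominated_convergence _ _ _ mu D mD
      (fun n x => (`|G x| - \1_(E n) x * `|G x|)%:E) (cst 0%E)
      (fun x => (`|G x|)%:E) _ (measurable_cst _) _ _ _.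
  - move=> n; apply/measurable_EFinP; apply: measurable_funB.
      by apply: measurableT_comp.
    by apply: measurable_funM; [exact: mi|exact: measurableT_comp].
  - apply: aeW => x Dx; apply/fine_cvgP; split; first by near=> n.
    apply: cvg_near_cst; near=> n; rewrite /= indicE mem_set ?mul1r ?subrr //.
    by rewrite /E /= in_itv /=; near: n; exact: Dcd.
  - exact: integrable_norm.
  - apply: aeW => x n Dx; rewrite lee_fin indicE.
    by case: (_ \in _); rewrite ?mul1r ?subrr ?normr0 ?mul0r ?subr0 ?normr_id.
  by rewrite integral0 => /fine_cvgP [_]; exact: cvg_trans.
apply/cvgr0Pnorm_le => e e0.
have e2 : 0 < e / 2 by rewrite divr_gt0.
have [n tn] : exists n, `|tail n| <= e / 2.
  move/cvgr0Pnorm_le : tail0 => /(_ _ e2)[N _ NP].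
  by exists N; apply: NP => /=.
have mE : measurable (E n) by exact: measurable_itv.
have segm : \int[mu]_(x in E n) (G x * kappa (s * phi x)) @[s --> +oo] --> (0 : R).
  have inD x : c n <= x <= d n -> D x by move=> xcd; apply: (cdD n); rewrite /= in_itv.
  apply: (@riemann_lebesgue_segment phi dphi) => //.
  - by move=> x /inD; exact: phid.
  - apply: continuous_in_subspaceT => x; rewrite inE /= in_itv /= => /inD.
    exact: dphic.
  - by move=> x /inD; exact: dphi0.
  - exact: (@integrableS _ _ _ mu D).
move/cvgr0Pnorm_le : segm => /(_ _ e2) segm.
near=> s; rewrite [leRHS](splitr e).
have -> : \int[mu]_(x in D) (G x * kappa (s * phi x)) =
    \int[mu]_(x in E n) (G x * kappa (s * phi x)) +
    \int[mu]_(x in D `\` E n) (G x * kappa (s * phi x)).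
  rewrite -[X in \int[mu]_(x in X) _ = _](setDUK (cdD n)).
  rewrite Rintegral_setU //.
  - exact: measurableD.
  - by rewrite setDUK //; exact: ik.
  - by apply/disj_setPS => x [? []].
apply: le_trans (ler_normD _ _) _; apply: lerD; first by near: s.
have mDE : measurable (D `\` E n) by exact: measurableD.
apply: le_trans tn; apply: le_trans (ler_norm _).
have ikDE : mu.-integrable (D `\` E n) (fun x => (G x * kappa (s * phi x))%:E).
  by apply: ik => // x [].
apply: le_trans (@le_normr_Rintegral _ _ _ mu _
  (fun x => G x * kappa (s * phi x)) mDE ikDE) _.
have -> : tail n = \int[mu]_(x in D `\` E n) `|G x|.
  rewrite /tail setDE Rintegral_mkcondr; apply: eq_Rintegral => x _.
  rewrite /patch indicE in_setC.
  by case: (x \in E n) => /=; rewrite ?mul1r ?subrr ?mul0r ?subr0.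
apply: le_Rintegral => //; first exact: integrable_norm.
  apply: integrable_norm => //.
  by apply: (@integrableS _ _ _ mu D) => // x [].
move=> x _; rewrite normrM -[leRHS]mulr1.
by apply: ler_pM.
Unshelve. all: by end_near. Qed.

(** The phase may be singular at 0 only: the two half-lines are exhausted
    separately. *)
Lemma riemann_lebesgue_real (phi dphi : R -> R) (G : R -> R) :
  (forall x, x != 0 -> is_derive x (1 : R) phi (dphi x)) ->
  (forall x, x != 0 -> {for x, continuous dphi}) ->
  (forall x, x != 0 -> dphi x != 0) ->
  measurable_fun setT phi ->
  mu.-integrable setT (fun x => (G x)%:E) ->
  \int[mu]_x (G x * kappa (s * phi x)) @[s --> +oo] --> (0 : R).
Proof.
move=> phid dphic dphi0 mphi iG.
have hE (n : nat) : (n.+2%:R^-1 : R) < n.+2%:R.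
  by apply: (@lt_trans _ _ 1); rewrite ?invf_lt1 ?ltr1n.
have nearV (x : R) : 0 < x -> \forall n \near \oo, n.+2%:R^-1 <= x <= n.+2%:R.
  move=> x0; exists (Num.truncn (x + x^-1)) => // n /= nx.
  have xn : x + x^-1 < n.+2%:R.
    apply: lt_le_trans (truncnS_gt _) _.
    by rewrite ler_nat; apply: leq_trans nx _.
  have xV0 : 0 < x^-1 by rewrite invr_gt0.
  apply/andP; split; last by lra.
  by rewrite invf_ple ?posrE //; lra.
have pos : \int[mu]_(x in `]0, +oo[) (G x * kappa (s * phi x)) @[s --> +oo] --> (0 : R).
  apply: (@riemann_lebesgue_exhaustion phi dphi _
      (fun n => n.+2%:R^-1) (fun n => n.+2%:R)) => //.
  - move=> n x; rewrite /= !in_itv /= andbT => /andP[+ _].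
    by apply: lt_le_trans; rewrite invr_gt0.
  - by move=> x; rewrite /= in_itv /= andbT => /nearV.
  - by move=> x; rewrite /= in_itv /= andbT => x0; apply: phid; rewrite gt_eqF.
  - by move=> x; rewrite /= in_itv /= andbT => x0; apply: dphic; rewrite gt_eqF.
  - by move=> x; rewrite /= in_itv /= andbT => x0; apply: dphi0; rewrite gt_eqF.
  - exact: measurable_funS mphi.
  - exact: (@integrableS _ _ _ mu setT).
have neg : \int[mu]_(x in `]-oo, 0[) (G x * kappa (s * phi x)) @[s --> +oo] --> (0 : R).
  apply: (@riemann_lebesgue_exhaustion phi dphi _
      (fun n => - n.+2%:R) (fun n => - n.+2%:R^-1)) => //.
  - by move=> n; rewrite ltrN2.
  - move=> n x; rewrite /= !in_itv /= => /andP[_].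
    by move=> /le_lt_trans; apply; rewrite oppr_lt0 invr_gt0.
  - move=> x; rewrite /= in_itv /= -oppr_gt0 => /nearV; apply: filterS => n.
    by rewrite lerNl lerNr andbC.
  - by move=> x; rewrite /= in_itv /= => x0; apply: phid; rewrite lt_eqF.
  - by move=> x; rewrite /= in_itv /= => x0; apply: dphic; rewrite lt_eqF.
  - by move=> x; rewrite /= in_itv /= => x0; apply: dphi0; rewrite lt_eqF.
  - exact: measurable_funS mphi.
  - exact: (@integrableS _ _ _ mu setT).
have ik s : mu.-integrable setT (fun x => (G x * kappa (s * phi x))%:E).
  have inG : mu.-integrable setT (fun x => `|G x|%:E) by exact: integrable_norm.
  apply: (le_integrable_real _ _ inG) => //.
    apply: measurable_funM.
      by move: iG => /measurable_int/measurable_EFinP.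
    apply: measurableT_comp; first exact: continuous_measurable_fun.
    exact: measurable_funM.
  move=> x _; rewrite normrM -[leRHS]mulr1.
  by apply: ler_pM.
have -> : (fun s => \int[mu]_x (G x * kappa (s * phi x))) =
    (fun s => \int[mu]_(x in `]-oo, 0[) (G x * kappa (s * phi x)) +
      \int[mu]_(x in `]0, +oo[) (G x * kappa (s * phi x))).
  apply/funext => s.
  rewrite Rintegral_itv_obnd_cbnd; last first.
    apply: (@integrableS _ _ _ mu setT) (ik s); by [].
  have <- : `]-oo, 0[%classic `|` `[0, +oo[%classic = [set: R].
    rewrite -subTset => x _; rewrite /= !in_itv /= andbT.
    by case: (ltP x 0); [left|right].
  rewrite Rintegral_setU //.
    apply: (@integrableS _ _ _ mu setT) (ik s) => //.
    by apply: measurableU; exact: measurable_itv.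
  apply/disj_setPS => x [] /=; rewrite !in_itv /= andbT => x0.
  by rewrite leNgt x0.
by rewrite -[X in _ --> X]addr0; exact: cvgD.
Qed.

End RiemannLebesgue.

(** * Oscillatory integrals with an imaginary exponent *)

Lemma riemann_lebesgue {R : realType} (w : R -> R[i]) (dphi : R -> R)
    (G : R -> R[i]) :
  (forall a, Re (w a) = 0) ->
  (forall a, a != 0 -> is_derive a (1 : R) (fun b => Im (w b)) (dphi a)) ->
  (forall a, a != 0 -> {for a, continuous dphi}) ->
  (forall a, a != 0 -> dphi a != 0) ->
  measurable_fun setT (fun a => Im (w a)) ->
  cintegrable setT G ->
  vanishing (fun s => cintegral setT (fun a => cexp (- (w a * s%:C)) * G a)).
Proof.
move=> w0 wd dc d0 mw [iGr iGi].
have cos1 (x : R) : `|cos x| <= 1 by rewrite ler_norml cos_geN1 cos_le1.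
have sin1 (x : R) : `|sin x| <= 1 by rewrite ler_norml sin_geN1 sin_le1.
have lim_cos g : (@lebesgue_measure R).-integrable setT (fun x => (g x)%:E) ->
    \int[lebesgue_measure]_x (g x * cos (s * Im (w x))) @[s --> +oo] --> (0 : R).
  apply: (@riemann_lebesgue_real _ cos sin _ _ _ _ (fun b => Im (w b)) dphi) => //.
  exact: continuous_cos.
have lim_sin g : (@lebesgue_measure R).-integrable setT (fun x => (g x)%:E) ->
    \int[lebesgue_measure]_x (g x * sin (s * Im (w x))) @[s --> +oo] --> (0 : R).
  apply: (@riemann_lebesgue_real _ sin (fun x => - cos x) _ _ _ _ (fun b => Im (w b)) dphi) => //.
  - by move=> x; apply: (is_derive_eq (is_deriveN _)); rewrite opprK.
  - by move=> x; rewrite normrN.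
  - exact: continuous_sin.
have cexpE a s : cexp (- (w a * s%:C)) = cos (s * Im (w a)) -i* sin (s * Im (w a)).
  rewrite /cexp.
  have -> : Re (- (w a * s%:C)) = 0.
    by rewrite ReN ReM w0 /= mul0r mulr0 subrr oppr0.
  have -> : Im (- (w a * s%:C)) = - (s * Im (w a)).
    by rewrite ImN ImM w0 /= mul0r add0r mulrC.
  by rewrite expR0 cosN sinN; apply: complexP => /=; ring.
have isc g k s : (@lebesgue_measure R).-integrable setT (fun x => (g x)%:E) ->
    continuous k -> (forall x, `|k x| <= 1) ->
    (@lebesgue_measure R).-integrable setT (fun x => (g x * k (s * Im (w x)))%:E).
  move=> ig ck k1; apply: (le_integrable_real _ _ (B := fun x => `|g x|)) => //.
  - apply: measurable_funM.
      by move: ig => /measurable_int/measurable_EFinP.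
    apply: (measurableT_comp (continuous_measurable_fun ck)).
    exact: measurable_funM.
  - exact: integrable_norm.
  - by move=> x _; rewrite normrM -[leRHS]mulr1; apply: ler_pM.
have ic g s ig := @isc g cos s ig (@continuous_cos R) cos1.
have is_ g s ig := @isc g sin s ig (@continuous_sin R) sin1.
apply: vanishing_ReIm.
  rewrite [X in X @ _ --> _](_ : _ = fun s =>
      \int[lebesgue_measure]_x (Re (G x) * cos (s * Im (w x))) +
      \int[lebesgue_measure]_x (Im (G x) * sin (s * Im (w x)))); last first.
    apply/funext => s; rewrite -RintegralD //; last 2 first.
    - exact: ic.
    - exact: is_.
    by apply: eq_Rintegral => x _; rewrite cexpE ReM /=; ring.
  by rewrite -[X in _ --> X]addr0; apply: cvgD; [exact: lim_cos|exact: lim_sin].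
rewrite [X in X @ _ --> _](_ : _ = fun s =>
    \int[lebesgue_measure]_x (Im (G x) * cos (s * Im (w x))) -
    \int[lebesgue_measure]_x (Re (G x) * sin (s * Im (w x)))); last first.
  apply/funext => s; rewrite -RintegralB //; last 2 first.
  - exact: ic.
  - exact: is_.
  by apply: eq_Rintegral => x _; rewrite cexpE ImM /=; ring.
by rewrite -[X in _ --> X]subr0; apply: cvgB; [exact: lim_cos|exact: lim_sin].
Qed.

(** * The two branches of the boundary curve *)

Lemma ge0_sqr_le {R : realType} (x y : R) :
  0 <= x -> 0 <= y -> x ^+ 2 <= y ^+ 2 -> x <= y.
Proof. by move=> x0 y0; rewrite ler_sqr. Qed.

Section DeriveFun.
Context {R : realType}.
Implicit Types (f g : R -> R) (x a b c : R).

Lemma is_derive_addf f g x a b :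
  is_derive x (1 : R) f a -> is_derive x (1 : R) g b ->
  is_derive x (1 : R) (fun y => f y + g y) (a + b).
Proof. by move=> fa gb; exact: is_deriveD. Qed.

Lemma is_derive_mulf f g x a b :
  is_derive x (1 : R) f a -> is_derive x (1 : R) g b ->
  is_derive x (1 : R) (fun y => f y * g y) (a * g x + f x * b).
Proof.
move=> fa gb; apply: (is_derive_eq (is_deriveM _ _)).
by rewrite /GRing.scale /= addrC mulrC.
Qed.

Lemma is_derive_mulcf c f x a : is_derive x (1 : R) f a ->
  is_derive x (1 : R) (fun y => c * f y) (c * a).
Proof. by move=> fa; exact: is_deriveZ. Qed.

Lemma is_derive_expf f x a n : is_derive x (1 : R) f a ->
  is_derive x (1 : R) (fun y => f y ^+ n) (n%:R * f x ^+ n.-1 * a).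
Proof.
move=> fa; have := is_deriveX n fa.
rewrite (_ : f ^+ n = fun y => f y ^+ n) //.
by apply/funext => y; rewrite exprfctE.
Qed.

Lemma is_derive_sqrtf f x a : 0 < f x -> is_derive x (1 : R) f a ->
  is_derive x (1 : R) (fun y => Num.sqrt (f y)) (a / (2 * Num.sqrt (f x))).
Proof.
move=> fx fa; rewrite mulrC.
exact: (@is_derive1_comp _ Num.sqrt f _ _ _ (is_derive1_sqrt fx) fa).
Qed.

End DeriveFun.

Section Curve.
Context {R : realType} (alpha beta : R).
Hypothesis alpha_gt0 : 0 < alpha.
Hypothesis beta_gt0 : 0 < beta.

(** The sign [sigma] selects the branch: -1 for the lower curve, 1 for the
    upper one. *)
Section Branch.
Variable sigma : R.
Hypothesis sigma2 : sigma ^+ 2 = 1.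

Let P (a : R) := alpha + 6 * beta * a ^+ 2.
Let D (a : R) := Omega_disc alpha beta a.

Definition height (a : R) : R :=
  Num.sqrt ((alpha + 6 * beta * a ^+ 2 + sigma * Omega_disc alpha beta a)
            / (2 * beta)).

Definition dheight (a : R) : R :=
  (6 * a + sigma * (4 * alpha * a + 32 * beta * a ^+ 3)
           / Omega_disc alpha beta a) / (2 * height a).

Let disc_gt0 a :
  0 < alpha ^+ 2 + 8 * alpha * beta * a ^+ 2 + 32 * beta ^+ 2 * a ^+ 4.
Proof.
have a4 : 0 <= a ^+ 4 by exact: exprn_even_ge0.
have := mulr_ge0 (mulr_ge0 (ltW alpha_gt0) (ltW beta_gt0)) (sqr_ge0 a).
have := mulr_ge0 (sqr_ge0 beta) a4.
have : 0 < alpha ^+ 2 by rewrite exprn_gt0.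
by lra.
Qed.

Let D2 a : D a ^+ 2 =
  alpha ^+ 2 + 8 * alpha * beta * a ^+ 2 + 32 * beta ^+ 2 * a ^+ 4.
Proof. by rewrite sqr_sqrtr // ltW. Qed.

Let D_gt0 a : 0 < D a. Proof. by rewrite sqrtr_gt0. Qed.

Let P_gt0 a : 0 < P a.
Proof.
have := mulr_ge0 (ltW beta_gt0) (sqr_ge0 a).
by have := alpha_gt0; rewrite /P; lra.
Qed.

Let D_le_P a : D a <= P a.
Proof.
apply: ge0_sqr_le; [exact: ltW|exact: ltW|rewrite D2 -subr_ge0].
have -> : P a ^+ 2 - (alpha ^+ 2 + 8 * alpha * beta * a ^+ 2 +
    32 * beta ^+ 2 * a ^+ 4) = 4 * alpha * beta * a ^+ 2 + 4 * (beta * a ^+ 2) ^+ 2.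
  by rewrite /P; ring.
have := mulr_ge0 (mulr_ge0 (ltW alpha_gt0) (ltW beta_gt0)) (sqr_ge0 a).
by have := sqr_ge0 (beta * a ^+ 2); lra.
Qed.

Let alpha_le_D a : alpha <= D a.
Proof.
apply: ge0_sqr_le; [exact: ltW|exact: ltW|rewrite D2 -subr_ge0].
have a4 : 0 <= a ^+ 4 by exact: exprn_even_ge0.
have := mulr_ge0 (mulr_ge0 (ltW alpha_gt0) (ltW beta_gt0)) (sqr_ge0 a).
by have := mulr_ge0 (sqr_ge0 beta) a4; lra.
Qed.

Let beta_le_D a : 5 * beta * a ^+ 2 <= D a.
Proof.
have ba : 0 <= beta * a ^+ 2 by rewrite mulr_ge0 ?sqr_ge0 // ltW.
apply: ge0_sqr_le; [by rewrite -mulrA mulr_ge0|exact: ltW|rewrite D2 -subr_ge0].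
have a4 : 0 <= a ^+ 4 by exact: exprn_even_ge0.
have -> : alpha ^+ 2 + 8 * alpha * beta * a ^+ 2 + 32 * beta ^+ 2 * a ^+ 4 -
    (5 * beta * a ^+ 2) ^+ 2 =
    alpha ^+ 2 + 8 * (alpha * beta * a ^+ 2) + 7 * (beta ^+ 2 * a ^+ 4) by ring.
have := mulr_ge0 (mulr_ge0 (ltW alpha_gt0) (ltW beta_gt0)) (sqr_ge0 a).
have := sqr_ge0 alpha.
by have := mulr_ge0 (sqr_ge0 beta) a4; lra.
Qed.

Let sigma_cases : sigma = 1 \/ sigma = -1.
Proof.
have /eqP : sigma ^+ 2 = 1 ^+ 2 by rewrite expr1n.
by rewrite eqf_sqr => /orP[] /eqP ->; [left|right].
Qed.

Let sigma_norm : `|sigma| = 1.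
Proof. by case: sigma_cases => ->; rewrite ?normrN normr1. Qed.

(** The square of the height. *)
Let Q a := (P a + sigma * D a) / (2 * beta).

Let QE a : 2 * beta * Q a = P a + sigma * D a.
Proof. by rewrite /Q; field; rewrite gt_eqF. Qed.

Let Q_lower a : a ^+ 2 / 6 <= Q a.
Proof.
rewrite /Q ler_pdivlMr ?mulr_gt0 //.
have D0 := D_gt0 a; have P0 := P_gt0 a; have DP := D_le_P a.
have a2 := sqr_ge0 a.
have base : a ^+ 2 / 6 * (2 * beta) <= P a - D a.
  rewrite -(ler_pM2r (addr_gt0 P0 D0)).
  have -> : (P a - D a) * (P a + D a) = P a ^+ 2 - D a ^+ 2 by ring.
  rewrite D2.
  have le1 : a ^+ 2 / 6 * (2 * beta) * (P a + D a) <=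
             a ^+ 2 / 6 * (2 * beta) * (P a + P a).
    apply: ler_wpM2l; last by rewrite lerD2l.
    by rewrite mulr_ge0 // ?divr_ge0 // mulr_ge0 // ltW.
  apply: le_trans le1 _; rewrite -subr_ge0.
  have -> : P a ^+ 2 - (alpha ^+ 2 + 8 * alpha * beta * a ^+ 2 +
      32 * beta ^+ 2 * a ^+ 4) - a ^+ 2 / 6 * (2 * beta) * (P a + P a) =
      10 / 3 * (alpha * beta * a ^+ 2).
    by rewrite /P; field.
  by rewrite mulr_ge0 // mulr_ge0 // mulr_ge0 // ltW.
case: sigma_cases => ->; lra.
Qed.

Let Q_upper a : Q a <= (alpha + 6 * beta * a ^+ 2) / beta.
Proof.
rewrite /Q ler_pdivrMr ?mulr_gt0 //.
rewrite [leRHS](_ : _ = P a + P a); last by rewrite /P; field; rewrite gt_eqF.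
rewrite lerD2l; have D0 := D_gt0 a; have DP := D_le_P a.
by case: sigma_cases => ->; lra.
Qed.

Let Q_ge0 a : 0 <= Q a.
Proof. by apply: le_trans (Q_lower a); rewrite divr_ge0 ?sqr_ge0. Qed.

Let Q_gt0 a : a != 0 -> 0 < Q a.
Proof.
move=> a0; apply: lt_le_trans (Q_lower a).
by rewrite divr_gt0 // exprn_even_gt0.
Qed.

Let height2 a : height a ^+ 2 = Q a. Proof. exact: sqr_sqrtr (Q_ge0 a). Qed.

Lemma height_ge0 a : 0 <= height a. Proof. exact: sqrtr_ge0. Qed.

Lemma height_gt0 a : a != 0 -> 0 < height a.
Proof. by move=> a0; rewrite sqrtr_gt0; exact: Q_gt0. Qed.

Lemma height_ge_norm a : `|a| / 3 <= height a.
Proof.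
apply: ge0_sqr_le; [by rewrite divr_ge0|exact: height_ge0|rewrite height2].
 apply: le_trans (Q_lower a).
by rewrite exprMn real_normK ?num_real //; have := sqr_ge0 a; lra.
Qed.

Lemma height_le a : height a <= 1 + (alpha + 6 * beta * a ^+ 2) / beta.
Proof.
have := height2 a; have := Q_upper a; have := sqr_ge0 (height a - 1).
by rewrite sqrrB expr1n mulr1 => *; have := height_ge0 a; nra.
Qed.

Lemma Re_omega_height a : Re (omega alpha beta (a +i* height a)) = 0.
Proof.
have -> : Re (omega alpha beta (a +i* height a)) =
    alpha * (a ^+ 2 - height a ^+ 2)
    + beta * (a ^+ 4 - 6 * a ^+ 2 * height a ^+ 2 + (height a ^+ 2) ^+ 2).
  by rewrite /omega !exprS expr0 /=; ring.
rewrite height2.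
have b4 : 4 * beta != 0 by rewrite lt0r_neq0 // mulr_gt0.
apply: (mulfI b4); rewrite mulr0.
transitivity ((2 * beta * Q a - P a) ^+ 2 -
   (alpha ^+ 2 + 8 * alpha * beta * a ^+ 2 + 32 * beta ^+ 2 * a ^+ 4)).
  by rewrite /P; ring.
by rewrite QE -D2 addrAC subrr add0r exprMn sigma2 mul1r subrr.
Qed.

Let dQ a := 6 * a + sigma * (4 * alpha * a + 32 * beta * a ^+ 3) / D a.

Let D_deriv a : is_derive a (1 : R) D
  ((8 * alpha * beta * a + 64 * beta ^+ 2 * a ^+ 3) / D a).
Proof.
have id : is_derive a (1 : R) (fun y : R => y) 1 by exact: is_derive_id.
have d2 := is_derive_mulcf (8 * alpha * beta) (is_derive_expf 2 id).
have d4 := is_derive_mulcf (32 * beta ^+ 2) (is_derive_expf 4 id).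
have dc : is_derive a (1 : R) (fun _ : R => alpha ^+ 2) 0 by exact: is_derive_cst.
apply: (is_derive_eq (is_derive_sqrtf _ (is_derive_addf (is_derive_addf dc d2) d4))) => //.
rewrite (_ : Num.sqrt _ = D a) //=.
by field; rewrite gt_eqF.
Qed.

Let Q_deriv a : is_derive a (1 : R) Q (dQ a).
Proof.
have id : is_derive a (1 : R) (fun y : R => y) 1 by exact: is_derive_id.
have d2 := is_derive_mulcf (6 * beta) (is_derive_expf 2 id).
have dD := is_derive_mulcf sigma (D_deriv a).
have dc : is_derive a (1 : R) (fun _ : R => alpha) 0 by exact: is_derive_cst.
have := is_derive_mulcf (2 * beta)^-1 (is_derive_addf (is_derive_addf dc d2) dD).
rewrite (_ : (fun y => (2 * beta)^-1 * (alpha + 6 * beta * y ^+ 2 + sigma * D y)) = Q).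
  move=> d; apply: (is_derive_eq d).
  by rewrite /dQ /=; field; rewrite !gt_eqF.
by apply/funext => y; rewrite mulrC.
Qed.

Lemma is_derive_height a : a != 0 -> is_derive a (1 : R) height (dheight a).
Proof.
by move=> a0; exact: (is_derive_sqrtf (Q_gt0 a0) (Q_deriv a)).
Qed.

(** The bounds alpha <= D and 5 beta a ^ 2 <= D give 4 + 32 / 5 <= 11. *)
Let dQ_le a : `|dQ a| <= 17 * `|a|.
Proof.
have D0 := D_gt0 a.
apply: le_trans (ler_normD _ _) _.
rewrite !normrM sigma_norm mul1r normfV (gtr0_norm D0) (ger0_norm (_ : 0 <= 6)) //.
suff : `|4 * alpha * a + 32 * beta * a ^+ 3| / D a <= 11 * `|a| by lra.
rewrite ler_pdivrMr //.
have -> : 4 * alpha * a + 32 * beta * a ^+ 3 = (4 * alpha + 32 * beta * a ^+ 2) * a by ring.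
rewrite normrM [leRHS]mulrAC; apply: ler_wpM2r => //.
have b0 := mulr_ge0 (ltW beta_gt0) (sqr_ge0 a).
rewrite ger0_norm; last by have := alpha_gt0; lra.
by have := alpha_le_D a; have := beta_le_D a; lra.
Qed.

(** The value 26 bounds 17 |a| / (2 h), since h >= |a| / 3. *)
Lemma dheight_le a : a != 0 -> `|dheight a| <= 26.
Proof.
move=> a0; have h0 := height_gt0 a0.
rewrite /dheight normrM normfV [X in _ / X]gtr0_norm ?mulr_gt0 //.
rewrite ler_pdivrMr ?mulr_gt0 //; apply: le_trans (dQ_le a) _.
by have := height_ge_norm a; have := normr_ge0 a; lra.
Qed.

Definition dphase a := - 2 * sigma * height a * D a * (1 + dheight a ^+ 2).

Lemma dphase_neq0 a : a != 0 -> dphase a != 0.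
Proof.
move=> a0; have h0 := height_gt0 a0.
rewrite /dphase !mulf_neq0 //.
- by case: sigma_cases => ->; rewrite ?oppr_eq0 oner_eq0.
- by rewrite gt_eqF.
- by rewrite gt_eqF.
- by rewrite gt_eqF // ltr_pwDl // sqr_ge0.
Qed.

(** The derivative of omega along the curve is purely imaginary, so that the
    real part of omega' (a + i h) is h' times its imaginary part; this leaves
    a product of nonzero factors. *)
Lemma is_derive_phase a : a != 0 ->
  is_derive a (1 : R) (fun b => Im (omega alpha beta (b +i* height b))) (dphase a).
Proof.
move=> a0; have h0 := height_gt0 a0; have D0 := D_gt0 a.
have -> : (fun b => Im (omega alpha beta (b +i* height b))) =
   (fun b => (2 * alpha) * (b * height b) +
             ((4 * beta) * (b ^+ 3 * height b) + (- 4 * beta) * (b * height b ^+ 3))).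
  by apply/funext => b; rewrite /omega !exprS expr0 /=; ring.
have id : is_derive a (1 : R) (fun y : R => y) 1 by exact: is_derive_id.
have dh := is_derive_height a0.
have d1 := is_derive_mulcf (2 * alpha) (is_derive_mulf id dh).
have d2 := is_derive_mulcf (4 * beta) (is_derive_mulf (is_derive_expf 3 id) dh).
have d3 := is_derive_mulcf (- 4 * beta) (is_derive_mulf id (is_derive_expf 3 dh)).
apply: (is_derive_eq (is_derive_addf d1 (is_derive_addf d2 d3))).
have dhE : 2 * height a * dheight a = dQ a.
  by rewrite /dheight -/(D a) -/(dQ a); field; rewrite gt_eqF.
have h2 := height2 a.
have bh : 2 * beta * height a ^+ 2 = P a + sigma * D a by rewrite h2 QE.
have DdQ : D a * dQ a = 6 * a * D a + sigma * (4 * alpha * a + 32 * beta * a ^+ 3).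
  by rewrite /dQ; field; rewrite gt_eqF.
set h := height a in dhE h2 bh h0 *; set e := dheight a in dhE *.
(* the real and imaginary parts of omega' at a + i h *)
pose re := 2 * alpha * a + 4 * beta * a ^+ 3 - 12 * beta * a * h ^+ 2.
pose im := 2 * alpha * h + 12 * beta * a ^+ 2 * h - 4 * beta * h ^+ 3.
have imE : im = - 2 * sigma * h * D a.
  have -> : im = 2 * h * (P a - 2 * beta * h ^+ 2) by rewrite /im /P; ring.
  by rewrite bh; ring.
have reE : re = e * im.
  have -> : e * im = - sigma * (D a * dQ a) by rewrite imE -dhE; ring.
  have -> : re = 2 * alpha * a + 4 * beta * a ^+ 3 - 6 * a * (2 * beta * h ^+ 2).
    by rewrite /re; ring.
  rewrite DdQ bh /P.
  have -> : - sigma * (6 * a * D a + sigma * (4 * alpha * a + 32 * beta * a ^+ 3)) =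
      - (6 * a * (sigma * D a)) - sigma ^+ 2 * (4 * alpha * a + 32 * beta * a ^+ 3).
    by ring.
  by rewrite sigma2; ring.
transitivity (im + e * re); first by rewrite /im /re /=; ring.
by rewrite reE imE /dphase -/h -/e; ring.
Qed.

Lemma continuous_dphase a : a != 0 -> {for a, continuous dphase}.
Proof.
move=> a0; have h0 := height_gt0 a0; have D0 := D_gt0 a.
have ch := is_derive_continuous (is_derive_height a0).
have cD := is_derive_continuous (D_deriv a).
have cid : {for a, continuous (fun y : R => y)} by move=> ?; exact: cvg_id.
have cc (k : R) : {for a, continuous (fun _ : R => k)} by move=> ?; exact: cvg_cst.
have cX n : {for a, continuous (fun y : R => y ^+ n)} by exact: exprn_continuous.
have cdh : {for a, continuous dheight}.
  apply: cvgM; last first.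
    by apply: cvgV; [rewrite lt0r_neq0 // mulr_gt0|apply: cvgM; [exact: cc|exact: ch]].
  apply: cvgD; first by apply: cvgM; [exact: cc|exact: cid].
  apply: cvgM; last by apply: cvgV; [rewrite gt_eqF|exact: cD].
  apply: cvgM; first exact: cc.
  apply: cvgD; first by apply: cvgM; [exact: cc|exact: cid].
  by apply: cvgM; [exact: cc|exact: cX].
apply: cvgM.
  apply: cvgM; last exact: cD.
  by apply: cvgM; [exact: cc|exact: ch].
by apply: cvgD; [exact: cc|apply: cvgM; exact: cdh].
Qed.

Lemma measurable_height : measurable_fun setT height.
Proof.
have mX n : measurable_fun setT (fun y : R => y ^+ n) by exact: exprn_measurable.
apply: measurable_sqrtr; apply: measurable_funM => //.
apply: measurable_funD.
  by apply: measurable_funD => //; exact: measurable_funM.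
apply: measurable_funM => //; apply: measurable_sqrtr.
by do 2?apply: measurable_funD => //; exact: measurable_funM.
Qed.

Lemma measurable_derive1_height : measurable_fun setT (derive1 height).
Proof.
have mX n : measurable_fun setT (fun y : R => y ^+ n) by exact: exprn_measurable.
have mid : measurable_fun setT (fun y : R => y) by exact: measurable_id.
have mD : measurable_fun setT (fun y : R => (D y)^-1).
  apply: measurable_invr; apply: measurable_sqrtr.
  by do 2?apply: measurable_funD => //; exact: measurable_funM.
have md : measurable_fun setT dheight.
  apply: measurable_funM; last first.
    by apply: measurable_invr; apply: measurable_funM => //; exact: measurable_height.
  apply: measurable_funD; first exact: measurable_funM.
  apply: measurable_funM => //; apply: measurable_funM => //.
  by apply: measurable_funD; exact: measurable_funM.
have -> : derive1 height = fun a => if a == 0 then derive1 height 0 else dheight a.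
  apply/funext => a; have [->//|a0] := eqVneq a 0.
  by have dh := is_derive_height a0; rewrite derive1E derive_val.
apply: measurable_fun_if => //.
- exact: measurable_fun_eqr.
- exact: measurable_funTS.
Qed.

Lemma derive1_height_le : exists C, forall a, `|derive1 height a| <= C.
Proof.
exists (Num.max 26 `|derive1 height 0|) => a; rewrite le_max.
have [->|a0] := eqVneq a 0; first by rewrite lexx orbT.
have dh := is_derive_height a0.
by rewrite derive1E derive_val dheight_le.
Qed.

End Branch.

Lemma lower_heightE : lower_height alpha beta = height (-1).
Proof. by apply/funext => a; rewrite /height mulN1r. Qed.

Lemma upper_heightE : upper_height alpha beta = height 1.
Proof. by apply/funext => a; rewrite /height mul1r. Qed.

End Curve.

(** * Fubini's theorem and translations *)

Section FubiniComplex.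
Context {R : realType}.
Notation mu := (@lebesgue_measure R).

Lemma integrable_fine (F : R -> \bar R) : mu.-integrable setT F ->
  mu.-integrable setT (fun x => (fine (F x))%:E).
Proof.
move=> iF; apply: (le_integrable _ _ _ iF) => //.
  apply/measurable_EFinP; apply: measurableT_comp.
    exact: fine_measurable.
  exact: (measurable_int mu).
by move=> x _; case: (F x) => [r| |] //=; rewrite ?normr0 leey.
Qed.

Lemma Rintegral_fine (F : R -> \bar R) : mu.-integrable setT F ->
  \int[mu]_x fine (F x) = fine (\int[mu]_x F x)%E.
Proof.
move=> iF; congr fine; apply: ae_eq_integral => //.
- exact: (measurable_int mu (integrable_fine iF)).
- exact: (measurable_int mu iF).
- apply: filterS (integrable_ae measurableT iF) => x /(_ I) Fx _.
  by rewrite fineK.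
Qed.

Lemma real_fubini (f : R * R -> R) :
  (mu \x mu)%E.-integrable setT (fun p => (f p)%:E) ->
  [/\ mu.-integrable setT (fun x => (\int[mu]_y f (x, y))%:E),
      mu.-integrable setT (fun y => (\int[mu]_x f (x, y))%:E) &
      \int[mu]_x \int[mu]_y f (x, y) = \int[mu]_y \int[mu]_x f (x, y)].
Proof.
move=> fi.
have iF := integrable_fubini_F fi.
have mf : measurable_fun setT (fun p => (f p)%:E) := measurable_int _ fi.
have iG : mu.-integrable setT (fun y => (\int[mu]_x (f (x, y))%:E)%E).
  apply/integrableP; split; first exact: measurable_fubini_G fi.
  apply: le_lt_trans ((integrable21ltyP mu mu mf).1 fi).
  apply: ge0_le_integral => //.
  - by apply: measurableT_comp => //; exact: measurable_fubini_G fi.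
  - apply: (@measurable_fun_fubini_tonelli_G _ _ _ _ _ mu (fun p : R * R => `|(f p)%:E|%E)) => //.
    exact: measurableT_comp.
  - move=> y _; apply: le_abse_integral => //.
    exact: (measurableT_comp mf (pair2_measurable y)).
split; [exact: integrable_fine iF|exact: integrable_fine iG|].
rewrite (Rintegral_fine iF) (Rintegral_fine iG).
by congr fine; exact: Fubini fi.
Qed.

Lemma complex_fubini (F : R -> R -> R[i]) (B : R -> R) :
  cmeasurable setT (fun p : R * R => F p.1 p.2) ->
  mu.-integrable setT (fun x => (B x)%:E) ->
  (forall x, (\int[mu]_y (normc (F x y))%:E <= (B x)%:E)%E) ->
  [/\ cintegrable setT (fun x => cintegral setT (F x)),
      cintegrable setT (fun y => cintegral setT (F ^~ y)) &
      cintegral setT (fun x => cintegral setT (F x)) =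
      cintegral setT (fun y => cintegral setT (F ^~ y))].
Proof.
move=> [mr mi] iB FB.
have mn : measurable_fun setT (fun p : R * R => normc (F p.1 p.2)).
  exact: measurable_normc.
have fin : (\int[mu]_x \int[mu]_y (normc (F x y))%:E < +oo)%E.
  move/integrableP : iB => [mB]; apply: le_lt_trans.
  apply: ge0_le_integral => //.
  - by move=> x _; apply: integral_ge0 => y _; rewrite lee_fin normc_ge0.
  - apply: (@measurable_fun_fubini_tonelli_F _ _ _ _ _ mu
      (fun p : R * R => (normc (F p.1 p.2))%:E)) => /=.
      exact/measurable_EFinP.
    by move=> p; rewrite lee_fin normc_ge0.
  - exact: measurableT_comp.
  - by move=> x _; apply: le_trans (FB x) _; rewrite lee_fin ler_norm.
have part (f : R * R -> R) : measurable_fun setT f ->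
    (forall x y, `|f (x, y)| <= normc (F x y)) ->
    (mu \x mu)%E.-integrable setT (fun p => (f p)%:E).
  move=> mf fF.
  have mfE : measurable_fun setT (fun p => (f p)%:E) by exact/measurable_EFinP.
  apply/(integrable12ltyP mu mu mfE); apply: le_lt_trans fin.
  have mnE : measurable_fun setT (fun p => (`|f p|)%:E).
    by apply/measurable_EFinP; exact: measurableT_comp.
  apply: ge0_le_integral => //.
  - by move=> x _; apply: integral_ge0.
  - apply: (@measurable_fun_fubini_tonelli_F _ _ _ _ _ mu (fun p : R * R => (`|f p|)%:E)) => //.
  - apply: (@measurable_fun_fubini_tonelli_F _ _ _ _ _ mu
      (fun p : R * R => (normc (F p.1 p.2))%:E)) => /=.
      exact/measurable_EFinP.
    by move=> p; rewrite lee_fin normc_ge0.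
  - move=> x _; apply: ge0_le_integral => //.
    + by apply/measurable_EFinP; apply: measurableT_comp => //; exact: measurableT_comp.
    + apply/measurable_EFinP.
      exact: (measurableT_comp mn (pair1_measurable x)).
    + by move=> y _; rewrite lee_fin.
have [r1 r2 r3] := real_fubini (part (fun p => Re (F p.1 p.2)) mr
   (fun x y => Re_le_normc _)).
have [i1 i2 i3] := real_fubini (part (fun p => Im (F p.1 p.2)) mi
   (fun x y => Im_le_normc _)).
by split; [split; [exact: r1|exact: i1]|split; [exact: r2|exact: i2]|
  apply: complexP; [exact: r3|exact: i3]].
Qed.

Lemma lebesgue_shift (T : R) (A : set R) : measurable A ->
  mu A = mu [set x | A (x + T)].
Proof.
pose phi (x : measurableTypeR R) : measurableTypeR R := x + T.
have mphi : measurable_fun setT phi by exact: measurable_funD.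
pose nu := measure_function_pushforward__canonical__measure_function_Measure
  (@lebesgue_measure R) mphi.
move=> mA; apply: (@lebesgue_measure_unique R nu) => // X [[a b] _ <-] /=.
rewrite /nu /= /pushforward.
have -> : phi @^-1` `]a, b]%classic = `]a - T, b - T]%classic.
  by apply/seteqP; split => x; rewrite /phi /= !in_itv /= ltrBlDr lerBrDr.
rewrite !lebesgue_measure_itv /= !lte_fin ltrD2r.
by case: ifP => // _; rewrite -!EFinB; congr EFin; ring.
Qed.

Lemma ge0_integral_shift (T : R) (D : set R) (g : R -> \bar R) :
  measurable D -> measurable_fun D g -> (forall x, 0 <= g x)%E ->
  (\int[mu]_(x in D) g x = \int[mu]_(x in [set x | D (x + T)%R]) g (x + T)%R)%E.
Proof.
move=> mD mg g0.
pose phi (x : measurableTypeR R) : measurableTypeR R := x + T.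
have mphi : measurable_fun setT phi by exact: measurable_funD.
pose nu := measure_function_pushforward__canonical__measure_function_Measure
  (@lebesgue_measure R) mphi.
transitivity (\int[nu]_(y in D) g y)%E.
  by apply: eq_measure_integral => A mA _; exact: lebesgue_shift.
exact: (ge0_integral_pushforward mphi).
Qed.

Lemma measurable_shift (T : R) (D : set R) (f : R -> R) : measurable D ->
  measurable_fun D f ->
  measurable_fun [set x | D (x + T)] (fun x => f (x + T)).
Proof.
move=> mD mf.
have mphi : measurable_fun [set x | D (x + T)] (fun x : R => x + T).
  exact: measurable_funD.
by apply: (measurable_comp mD _ mf mphi) => x [y Dy <-].
Qed.

Lemma Rintegral_shift (T : R) (D : set R) (f : R -> R) : measurable D ->
  measurable_fun D f ->
  \int[mu]_(x in D) f x = \int[mu]_(x in [set x | D (x + T)]) f (x + T).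
Proof.
move=> mD mf; congr fine.
have mfE : measurable_fun D (fun x => (f x)%:E) by exact/measurable_EFinP.
rewrite integralE [RHS]integralE.
congr (_ - _)%E.
  apply: (etrans (ge0_integral_shift T mD (measurable_funepos mfE) _)) => //.
  by apply: eq_integral => x _; rewrite !funepos.unlock.
apply: (etrans (ge0_integral_shift T mD (measurable_funeneg mfE) _)) => //.
by apply: eq_integral => x _; rewrite !funeneg.unlock.
Qed.

Lemma integrable_shift (T : R) (D : set R) (f : R -> R) : measurable D ->
  mu.-integrable D (fun x => (f x)%:E) ->
  mu.-integrable [set x | D (x + T)] (fun x => (f (x + T))%:E).
Proof.
move=> mD /integrableP[mf fi]; apply/integrableP; split.
  by apply/measurable_EFinP; apply: measurable_shift => //; exact/measurable_EFinP.
apply: le_lt_trans fi.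
rewrite le_eqVlt; apply/orP; left; apply/eqP/esym.
apply: (@ge0_integral_shift T D (fun x => `|(f x)%:E|%E)) => //.
exact: measurableT_comp.
Qed.

Lemma cintegrable_shift (T : R) (D : set R) (F : R -> R[i]) : measurable D ->
  cintegrable D F ->
  cintegrable [set x | D (x + T)] (fun x => F (x + T)).
Proof.
move=> mD [Fr Fi]; split.
  exact: (@integrable_shift T D (fun x => Re (F x))).
exact: (@integrable_shift T D (fun x => Im (F x))).
Qed.

Lemma cintegral_shift (T : R) (D : set R) (F : R -> R[i]) : measurable D ->
  cmeasurable D F ->
  cintegral D F = cintegral [set x | D (x + T)] (fun x => F (x + T)).
Proof.
by move=> mD [Fr Fi]; apply: complexP => /=; rewrite (Rintegral_shift T).
Qed.

End FubiniComplex.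

(** * Duhamel integrals *)

Section Duhamel.
Context {R : realType}.
Notation mu := (@lebesgue_measure R).

Lemma vanishing_shift (F : R -> R[i]) (c : R) :
  vanishing F -> vanishing (fun t => F (t + c)).
Proof.
have tc : t + c @[t --> +oo] --> +oo.
  apply/cvgryPge => A; near=> t.
  rewrite -lerBlDr; near: t; apply: nbhs_pinfty_ge; exact: num_real.
by move=> F0; exact: (@cvg_comp _ _ _ (fun t => t + c) (fun t => normc (F t))
  _ _ _ tc F0).
Unshelve. all: by end_near. Qed.

(** Shifting by the period the part of the first integral beyond T leaves an
    initial layer, where tau < T, and the increments over one period. *)
Lemma duhamel_increment_vanishing (T : R) (Phi : R -> R -> R[i]) (M : R)
    (N : R -> R) : 0 < T ->
  (forall t, 0 < t -> cintegrable `[0, t[ (fun tau => Phi (t - tau) tau)) ->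
  (forall s tau, 1 <= s -> 0 <= tau <= T -> normc (Phi s tau) <= M) ->
  (forall s tau, 0 < s -> 0 <= tau ->
     normc (Phi s (tau + T) - Phi s tau) <= N tau) ->
  mu.-integrable `[0, +oo[ (fun tau => (N tau)%:E) ->
  (forall tau, 0 <= tau -> vanishing (Phi ^~ tau)) ->
  vanishing (fun t =>
    cintegral `[0, t + T[ (fun tau => Phi (t + T - tau) tau) -
    cintegral `[0, t[ (fun tau => Phi (t - tau) tau)).
Proof.
move=> T0 iPhi PhiM PhiN iN Phi0.
pose layer t := cintegral `[0, T[ (fun tau => Phi (t + T - tau) tau).
pose incr t := cintegral `[0, +oo[ (fun tau =>
  (\1_(`[0, t[%classic : set R) tau)%:C *
  (Phi (t - tau) (tau + T) - Phi (t - tau) tau)).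
have iT t : 0 < t -> cintegrable `[0, T[ (fun tau => Phi (t + T - tau) tau).
  move=> t0; apply: cintegrableS (iPhi (t + T) _) => //; last by lra.
  by apply: subset_itvl; rewrite bnd_simp; lra.
have layer0 : vanishing layer.
  apply: (@dominated_vanishing _ _ _ (fun=> M) 1) => //.
  - move=> t t1; apply: cintegrable_measurable; apply: iT; lra.
  - apply: (@integrableS _ _ _ mu `[0, T]) => //.
      by apply: subset_itvl; rewrite bnd_simp.
    apply: continuous_compact_integrable; first exact: segment_compact.
    by move=> x; exact: cvg_cst.
  - move=> t x t1; rewrite /= in_itv /= => /andP[x0 xT].
    by apply: PhiM; [lra|rewrite x0 ltW].
  - apply: aeW => x; rewrite /= in_itv /= => /andP[x0 xT].
    have := vanishing_shift (T - x) (Phi0 x x0).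
    by rewrite /vanishing; under eq_fun do rewrite addrA.
have shiftE t : 0 < t ->
    cintegral `[T, t + T[ (fun tau => Phi (t + T - tau) tau) =
      cintegral `[0, t[ (fun tau => Phi (t - tau) (tau + T)) /\
    cintegrable `[0, t[ (fun tau => Phi (t - tau) (tau + T)).
  move=> t0.
  have i1 : cintegrable `[T, t + T[ (fun tau => Phi (t + T - tau) tau).
    apply: cintegrableS (iPhi (t + T) _) => //; last by lra.
    by apply: subset_itvr; rewrite bnd_simp; lra.
  have setE : [set x | `[T, t + T[%classic (x + T)] = `[0, t[%classic.
    by apply/seteqP; split => x; rewrite /= !in_itv /= lerDr ltrD2r.
  have funE : (fun x => Phi (t + T - (x + T)) (x + T)) =
      (fun tau => Phi (t - tau) (tau + T)).
    by apply/funext => x; congr Phi; ring.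
  split.
    rewrite (cintegral_shift T) //; last exact: cintegrable_measurable.
    by rewrite setE funE.
  by have := cintegrable_shift T (measurable_itv _) i1; rewrite setE funE.
have incr0 : vanishing incr.
  apply: (@dominated_vanishing _ _ _ N 1) => //.
  - move=> t t1; have t0 : 0 < t by lra.
    have [_ i2] := shiftE t t0.
    have := cintegrableB (measurable_itv _) i2 (iPhi t t0).
    move/(cintegrableT_indic _ (measurable_itv _))/cintegrable_measurable.
    exact: cmeasurableT.
  - move=> t x t1; rewrite /= in_itv /= andbT => x0.
    rewrite indicE; have [|_] := boolP (_ \in _).
      rewrite inE /= in_itv /= => /andP[_ xt]; rewrite mul1r; apply: PhiN => //.
      by rewrite subr_gt0.
    by rewrite mul0r normc0; apply: le_trans (PhiN 1 x _ x0); rewrite ?normc_ge0.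
  - apply: aeW => x; rewrite /= in_itv /= andbT => x0.
    have xT0 : 0 <= x + T by lra.
    have := vanishingB (vanishing_shift (- x) (Phi0 _ xT0)) (vanishing_shift (- x) (Phi0 _ x0)).
    apply: near_eq_vanishing; near=> t.
    rewrite indicE mem_set ?mul1r //= in_itv /= x0 /=.
    by near: t; apply: nbhs_pinfty_gt; exact: num_real.
apply: (near_eq_vanishing _ (vanishingD layer0 incr0)).
near=> t; have t0 : 0 < t by near: t; apply: nbhs_pinfty_gt; exact: num_real.
have [E1 i2] := shiftE t t0.
have tT : 0 < t + T by lra.
have setE : `[0, t + T[%classic = `[0, T[%classic `|` `[T, t + T[%classic :> set R.
  by rewrite -itv_bndbnd_setU // bnd_simp; lra.
rewrite setE cintegral_setU //; last 2 first.
- by rewrite -setE; exact: iPhi.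
- apply/disj_setPS => x [] /=; rewrite !in_itv /= => /andP[_ xT] /andP[].
  by rewrite leNgt xT.
rewrite -addrA; congr (_ + _).
rewrite E1 -cintegralB //; last exact: iPhi.
rewrite /incr cintegral_indic_sub //.
by apply: subset_itvl.
Unshelve. all: by end_near. Qed.

End Duhamel.

Section DuhamelSuperposition.
Context {R : realType}.
Notation mu := (@lebesgue_measure R).

(** Adding the bounds of the integral by t and of r times the integral by 1
    gives one that is also good for r = 0. *)
Lemma Rintegral_exp_le (r t : R) : 0 <= r -> 0 < t ->
  \int[mu]_(tau in `[0, t]) expR (- (r * (t - tau))) <= (t + 1) / (1 + r).
Proof.
move=> r0 t0; rewrite ler_pdivlMr ?ltr_pwDl // mulrDr mulr1.
pose e tau := expR (- (r * (t - tau))).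
have de tau : is_derive tau (1 : R) e (r * e tau).
  have id : is_derive tau (1 : R) (fun y : R => y) 1 by exact: is_derive_id.
  have dc : is_derive tau (1 : R) (fun _ : R => - (r * t)) 0 by exact: is_derive_cst.
  have dl := is_derive_addf dc (is_derive_mulcf r id).
  have -> : e = fun y => expR (- (r * t) + r * y).
    by apply/funext => y; rewrite /e; congr expR; ring.
  apply: (is_derive_eq (@is_derive1_comp _ expR _ _ _ _ (is_derive_expR _) dl)).
  by rewrite add0r mulr1 mulrC.
have ec : {within `[0, t], continuous e}.
  exact: (is_derive_within_continuous (df := fun tau => r * e tau)).
have ie : mu.-integrable `[0, t] (fun tau => (e tau)%:E).
  by apply: continuous_compact_integrable => //; exact: segment_compact.
apply: lerD.
  apply: (@le_trans _ _ (\int[mu]_(tau in `[0, t]) 1)).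
    apply: le_Rintegral => //.
      apply: continuous_compact_integrable; first exact: segment_compact.
      by move=> x; exact: cvg_cst.
    move=> tau; rewrite /= in_itv /= => /andP[_ taut].
    by rewrite /e expR_le1 oppr_le0 mulr_ge0 // subr_ge0.
  rewrite Rintegral_cst //= lebesgue_measure_itv /= lte_fin t0.
  by rewrite -EFinD /= mul1r subr0.
rewrite mulrC -RintegralZl //.
have -> : \int[mu]_(tau in `[0, t]) (r * e tau) = e t - e 0.
  rewrite /Rintegral (@continuous_FTC2 _ (fun tau => r * e tau) e) //.
  - by apply/subspace_continuousP => x xt; apply: cvgM;
      [exact: cvg_cst|move/subspace_continuousP : ec; exact].
  - exact: (is_derive_LRcontinuous (df := fun tau => r * e tau)).
  - exact: (is_derive_derive1 (df := fun tau => r * e tau)).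
by rewrite /e subrr mulr0 oppr0 expR0 gerBl expR_ge0.
Qed.

Variables (w : R -> R[i]) (V : R -> R -> R[i]).
Hypothesis mw : cmeasurable setT w.
Hypothesis w_ge0 : forall a, 0 <= Re (w a).
Hypothesis mV : cmeasurable setT (fun p : R * R => V p.1 p.2).

Lemma Re_decay (a s : R) : Re (- (w a * s%:C)) = - (Re (w a) * s).
Proof. by rewrite ReN ReM /= mulr0 subr0. Qed.

Lemma normc_decay_le1 (a s : R) : 0 <= s -> normc (cexp (- (w a * s%:C))) <= 1.
Proof.
by move=> s0; apply: normc_cexp_le1; rewrite Re_decay oppr_le0 mulr_ge0.
Qed.

Lemma cmeasurable_decay (s : R) : cmeasurable setT (fun a => cexp (- (w a * s%:C))).
Proof.
apply: cmeasurable_cexp; apply: cmeasurableN; by apply: cmeasurableM => //; exact: cmeasurable_cst.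
Qed.

Lemma cmeasurable_section (tau : R) : cmeasurable setT (V ^~ tau).
Proof.
have := pair2_measurable tau; move=> mp.
by case: mV => mr mi; split; [exact: (measurableT_comp mr (mp _ _))|
  exact: (measurableT_comp mi (mp _ _))].
Qed.

(** Integrating the kernel in time gains the factor 1 / (1 + Re w), which is
    what makes the double integral absolutely convergent on the real line. *)
Lemma duhamel_fubini (B : R -> R) (t : R) : 0 < t ->
  (forall a, 0 <= B a) ->
  (forall a tau, 0 <= tau <= t -> normc (V a tau) <= B a) ->
  mu.-integrable setT (fun a => (B a / (1 + Re (w a)))%:E) ->
  [/\ cintegrable setT (fun a => cintegral `[0, t[
         (fun tau => cexp (- (w a * (t - tau)%:C)) * V a tau)),
      cintegrable `[0, t[ (fun tau => cintegral setT
         (fun a => cexp (- (w a * (t - tau)%:C)) * V a tau)) &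
      cintegral setT (fun a => cintegral `[0, t[
         (fun tau => cexp (- (w a * (t - tau)%:C)) * V a tau)) =
      cintegral `[0, t[ (fun tau => cintegral setT
         (fun a => cexp (- (w a * (t - tau)%:C)) * V a tau))].
Proof.
move=> t0 B0 VB iB.
pose E a tau := cexp (- (w a * (t - tau)%:C)) * V a tau.
pose D : set R := `[0, t[%classic.
pose D' : set R := `[0, t]%classic.
pose F a tau := (\1_D tau)%:C * E a tau.
have mD : measurable D by exact: measurable_itv.
have mD' : measurable D' by exact: measurable_itv.
have mF : cmeasurable setT (fun p : R * R => F p.1 p.2).
  apply: cmeasurableM.
    apply: cmeasurable_real.
    by apply: measurableT_comp => //; exact: measurable_indic.
  apply: cmeasurableM => //; apply: cmeasurable_cexp; apply: cmeasurableN.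
  apply: cmeasurableM.
    exact: (cmeasurable_comp (g := fst) mw).
  apply: cmeasurable_real; apply: measurable_funB => //; exact: measurable_snd.
have normE a tau : 0 <= tau <= t ->
    normc (E a tau) <= expR (- (Re (w a) * (t - tau))) * B a.
  move=> taut; rewrite /E normcM normc_cexp Re_decay.
  by apply: ler_wpM2l; [exact: expR_ge0|exact: VB].
have FB a : (\int[mu]_tau (normc (F a tau))%:E <=
    ((t + 1) * (B a / (1 + Re (w a))))%:E)%E.
  have -> : (\int[mu]_tau (normc (F a tau))%:E =
      \int[mu]_(tau in D) (normc (E a tau))%:E)%E.
    rewrite [RHS]integral_mkcond; apply: eq_integral => tau _.
    rewrite /patch /F indicE; case: ifP => _; first by rewrite mul1r.
    by rewrite mul0r normc0.
  have mE : cmeasurable setT (E a).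
    apply: cmeasurableM.
      apply: cmeasurable_cexp; apply: cmeasurableN; apply: cmeasurableM.
        exact: cmeasurable_cst.
      by apply: cmeasurable_real; exact: measurable_funB.
    exact: (cmeasurable_comp (g := pair a) mV).
  have mnE (A : set R) : measurable_fun A (fun tau => (normc (E a tau))%:E).
    by apply/measurable_EFinP; apply: measurable_normc; exact: cmeasurableT.
  apply: (@le_trans _ _ (\int[mu]_(tau in D') (normc (E a tau))%:E)%E).
    apply: ge0_subset_integral => //.
    - exact: mnE.
    - by move=> tau Dtau; rewrite lee_fin normc_ge0.
    - by move=> y; rewrite /D /D' /= !in_itv /= => /andP[-> /ltW ->].
  have ce : {within `[0, t], continuous
      (fun tau => B a * expR (- (Re (w a) * (t - tau))))}.
    apply: continuous_subspaceT => tau; apply: cvgM; first exact: cvg_cst.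
    apply: (@cvg_comp _ _ _ (fun tau => - (Re (w a) * (t - tau))) expR);
      last exact: continuous_expR.
    apply: cvgN; apply: cvgM; first exact: cvg_cst.
    by apply: cvgB; [exact: cvg_cst|exact: cvg_id].
  have ie : mu.-integrable D'
      (fun tau => (B a * expR (- (Re (w a) * (t - tau))))%:E).
    by apply: continuous_compact_integrable => //; exact: segment_compact.
  have ie1 : mu.-integrable D'
      (fun tau => (expR (- (Re (w a) * (t - tau))))%:E).
    apply: continuous_compact_integrable; first exact: segment_compact.
    apply: continuous_subspaceT => tau.
    apply: (@cvg_comp _ _ _ (fun tau => - (Re (w a) * (t - tau))) expR);
      last exact: continuous_expR.
    apply: cvgN; apply: cvgM; first exact: cvg_cst.
    by apply: cvgB; [exact: cvg_cst|exact: cvg_id].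
  apply: (@le_trans _ _ (\int[mu]_(tau in D')
      (B a * expR (- (Re (w a) * (t - tau))))%:E)%E).
    apply: ge0_le_integral => //.
    - by move=> tau Dtau; rewrite lee_fin normc_ge0.
    - exact: mnE.
    - exact: (measurable_int mu ie).
    - move=> tau; rewrite /D' /= in_itv /= => taut; rewrite lee_fin mulrC.
      exact: normE.
  rewrite -[leLHS]fineK; last exact: integrable_fin_num.
  rewrite lee_fin -[leLHS]/(\int[mu]_(tau in D')
      (B a * expR (- (Re (w a) * (t - tau))))).
  rewrite RintegralZl // mulrCA; apply: ler_wpM2l => //.
  exact: (Rintegral_exp_le (w_ge0 a) t0).
have [] := @complex_fubini _ F (fun a => (t + 1) * (B a / (1 + Re (w a)))) mF _ FB.
  exact: integrableZ_real.
have FE a : cintegral setT (F a) = cintegral D (E a).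
  by rewrite [RHS]cintegralT_indic.
have GE tau : cintegral setT (F ^~ tau) = (\1_D tau)%:C * cintegral setT (E ^~ tau).
  rewrite /F indicE; case: (tau \in D).
    by rewrite mul1r; apply: eq_cintegral => a _; rewrite mul1r.
  rewrite mul0r; apply: complexP => /=; under eq_Rintegral do rewrite mul0r /=;
    by rewrite Rintegral_cst // mul0r.
have FEf : (fun a => cintegral setT (F a)) = (fun a => cintegral D (E a)).
  by apply/funext.
have GEf : (fun tau => cintegral setT (F ^~ tau)) =
    (fun tau => (\1_D tau)%:C * cintegral setT (E ^~ tau)) by apply/funext.
rewrite FEf GEf => i1 i2 eq12; split.
- exact: i1.
- exact/(cintegrableT_indic _ mD).
- exact: (etrans eq12 (esym (cintegralT_indic D (fun tau => cintegral setT (E ^~ tau))))).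
Qed.

End DuhamelSuperposition.

Section DuhamelVanishing.
Context {R : realType}.
Notation mu := (@lebesgue_measure R).
Variables (w : R -> R[i]) (V : R -> R -> R[i]) (T : R).
Hypothesis mw : cmeasurable setT w.
Hypothesis w_ge0 : forall a, 0 <= Re (w a).
Hypothesis mV : cmeasurable setT (fun p : R * R => V p.1 p.2).
Hypothesis T_gt0 : 0 < T.

Let Phi s tau := cintegral setT (fun a => cexp (- (w a * s%:C)) * V a tau).

(** The bounds are imposed on Phi, not on V: on the real line the increments
    of V need not be integrable in a. *)
Lemma duhamel_vanishing (M : R) (N : R -> R) :
  (forall t, 0 < t -> exists B : R -> R, [/\ forall a, 0 <= B a,
     forall a tau, 0 <= tau <= t -> normc (V a tau) <= B a &
     mu.-integrable setT (fun a => (B a / (1 + Re (w a)))%:E)]) ->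
  (forall s tau, 1 <= s -> 0 <= tau <= T -> normc (Phi s tau) <= M) ->
  (forall s tau, 0 < s -> 0 <= tau ->
     normc (Phi s (tau + T) - Phi s tau) <= N tau) ->
  mu.-integrable `[0, +oo[ (fun tau => (N tau)%:E) ->
  (forall tau, 0 <= tau -> vanishing (Phi ^~ tau)) ->
  vanishing (fun t =>
    cintegral setT (fun a => cintegral `[0, t + T[
      (fun tau => cexp (- (w a * (t + T - tau)%:C)) * V a tau)) -
    cintegral setT (fun a => cintegral `[0, t[
      (fun tau => cexp (- (w a * (t - tau)%:C)) * V a tau))).
Proof.
move=> VB PhiM PhiN iN Phi0.
have fub t : 0 < t ->
  cintegrable `[0, t[ (fun tau => Phi (t - tau) tau) /\
  cintegral setT (fun a => cintegral `[0, t[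
         (fun tau => cexp (- (w a * (t - tau)%:C)) * V a tau)) =
  cintegral `[0, t[ (fun tau => Phi (t - tau) tau).
  move=> t0; have [B [B0 BV iB]] := VB t t0.
  have [_ i2 E] := duhamel_fubini mw w_ge0 mV t0 B0 BV iB.
  by split; [exact: i2|exact: E].
have := @duhamel_increment_vanishing _ T Phi M N T_gt0
  (fun t t0 => (fub t t0).1) PhiM PhiN iN Phi0.
apply: near_eq_vanishing; near=> t.
have t0 : 0 < t by near: t; apply: nbhs_pinfty_gt; exact: num_real.
have tT : 0 < t + T by have := T_gt0; lra.
by rewrite (fub t t0).2 (fub _ tT).2.
Unshelve. all: by end_near. Qed.

(** On the boundary curve the amplitude is dominated by an integrable function
    of a, and the exponential has modulus at most 1. *)
Lemma duhamel_L1_vanishing (B N : R -> R) :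
  (forall a, 0 <= B a) -> mu.-integrable setT (fun a => (B a)%:E) ->
  (forall t, 0 < t -> exists2 M, 0 <= M &
     forall a tau, 0 <= tau <= t -> normc (V a tau) <= B a * M) ->
  (forall a tau, 0 <= tau -> normc (V a (tau + T) - V a tau) <= B a * N tau) ->
  mu.-integrable `[0, +oo[ (fun tau => (N tau)%:E) ->
  (forall G, cintegrable setT G ->
     vanishing (fun s => cintegral setT (fun a => cexp (- (w a * s%:C)) * G a))) ->
  vanishing (fun t =>
    cintegral setT (fun a => cintegral `[0, t + T[
      (fun tau => cexp (- (w a * (t + T - tau)%:C)) * V a tau)) -
    cintegral setT (fun a => cintegral `[0, t[
      (fun tau => cexp (- (w a * (t - tau)%:C)) * V a tau))).
Proof.
move=> B0 iB VM VN iN RL.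
have iV tau : 0 <= tau -> cintegrable setT (V ^~ tau).
  move=> tau0; have tau1 : 0 < tau + 1 by lra.
  have [M M0 VMt] := VM _ tau1.
  apply: (cintegrable_le measurableT (cmeasurable_section mV tau)
    (integrableZ_real M measurableT iB)) => a _.
  by rewrite mulrC; apply: VMt; lra.
have decay_le (G : R -> R[i]) (C : R) s : 0 <= s -> cmeasurable setT G ->
    (forall a, normc (G a) <= B a * C) ->
    normc (cintegral setT (fun a => cexp (- (w a * s%:C)) * G a)) <=
      2 * (\int[mu]_a B a) * C.
  move=> s0 mG GC.
  have -> : 2 * (\int[mu]_a B a) * C = 2 * \int[mu]_a (C * B a).
    by rewrite RintegralZl //; ring.
  apply: normc_cintegral_le => //.
  - by apply: cmeasurableM => //; exact: cmeasurable_decay.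
  - exact: integrableZ_real.
  - move=> a _; rewrite normcM mulrC [C * _]mulrC -[leRHS]mulr1.
    by apply: ler_pM; rewrite ?normc_ge0 //; exact: normc_decay_le1.
have [MT MT0 VMT] := VM T T_gt0.
apply: (@duhamel_vanishing (2 * (\int[mu]_a B a) * MT)
  (fun tau => 2 * (\int[mu]_a B a) * N tau)).
- move=> t t0; have [M M0 VMt] := VM t t0.
  exists (fun a => B a * M); split => //.
    by move=> a; rewrite mulr_ge0.
  have iMB : mu.-integrable setT (fun a => (M * B a)%:E).
    exact: integrableZ_real.
  apply: (le_integrable_real _ _ iMB) => //.
    have mB : measurable_fun setT B by move: iB => /measurable_int/measurable_EFinP.
    apply: measurable_funM; first exact: measurable_funM.
    by apply: measurable_invr; apply: measurable_funD => //; case: mw.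
  move=> a _; have wa := w_ge0 a.
  rewrite ger0_norm; last by rewrite divr_ge0 ?mulr_ge0 // addr_ge0.
  rewrite mulrC [M * _]mulrC ler_pdivrMl ?ltr_pwDl //.
  by rewrite ler_peMl ?mulr_ge0 // lerDl.
- move=> s tau s1 tauT; apply: decay_le; first by lra.
    exact: cmeasurable_section.
  by move=> a; exact: VMT.
- move=> s tau s0 tau0; have tauT : 0 <= tau + T by have := T_gt0; lra.
  have idec tau' : 0 <= tau' ->
      cintegrable setT (fun a => cexp (- (w a * s%:C)) * V a tau').
    move=> tau'0; apply: (cintegrable_le (B := fun a => normc (V a tau'))) => //.
    - apply: cmeasurableM; [exact: cmeasurable_decay|exact: cmeasurable_section].
    - exact: cintegrable_normc (iV _ tau'0).
    - move=> a _; rewrite normcM -[leRHS]mul1r.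
      by apply: ler_wpM2r; [exact: normc_ge0|apply: normc_decay_le1 => //; exact: ltW].
  rewrite /Phi -cintegralB //; try exact: idec.
  rewrite (_ : (fun a => _ - _) =
      (fun a => cexp (- (w a * s%:C)) * (V a (tau + T) - V a tau))); last first.
    by apply/funext => a; rewrite mulrBr.
  apply: decay_le; first exact: ltW.
    by apply: cmeasurableB; exact: cmeasurable_section.
  by move=> a; exact: VN.
- exact: integrableZ_real.
- by move=> tau tau0; apply: RL; exact: iV.
Qed.

End DuhamelVanishing.

Section TimeTransform.
Context {R : realType}.

Lemma cintegral_itv_bndo_bndc (t : R) (F : R -> R[i]) : cintegrable `[0, t] F ->
  cintegral `[0, t] F = cintegral `[0, t[ F.
Proof.
move=> iF.
have [Fr Fi] : cintegrable `[0, t[ F.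
  by apply: cintegrableS iF => //; apply: subset_itvl; rewrite bnd_simp.
by apply: complexP => /=; rewrite Rintegral_itv_bndo_bndc.
Qed.

Lemma cintegrable_time (g : R -> R[i]) (w : R[i]) (t M : R) :
  cmeasurable `[0, t] g -> (forall tau, 0 <= tau <= t -> normc (g tau) <= M) ->
  cintegrable `[0, t] (fun tau => cexp (w * tau%:C) * g tau).
Proof.
move=> mg gM.
apply: (cintegrable_le (B := fun=> expR (`|Re w| * t) * M)) => //.
- apply: cmeasurableM => //; apply: cmeasurable_cexp; apply: cmeasurableM.
    exact: cmeasurable_cst.
  exact: cmeasurable_real.
- apply: continuous_compact_integrable; first exact: segment_compact.
  by move=> x; exact: cvg_cst.
- move=> tau; rewrite /= in_itv /= => /andP[tau0 taut].
  rewrite normcM normc_cexp; apply: ler_pM; rewrite ?normc_ge0 ?expR_ge0 //.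
    rewrite ler_expR ReM /= mulr0 subr0; apply: le_trans (ler_norm _) _.
    by rewrite normrM (ger0_norm tau0); apply: ler_wpM2l.
  by apply: gM; rewrite tau0.
Qed.

(** The damping factor exp (- w t) turns the weight exp (w tau) of the transform
    into exp (- w (t - tau)).  The half-open interval can be cut at T without
    overlap. *)
Lemma duhamel_transform (z w c1 c2 : R[i]) (g1 g2 : R -> R[i]) (t : R) :
  cintegrable `[0, t] (fun tau => cexp (w * tau%:C) * g1 tau) ->
  cintegrable `[0, t] (fun tau => cexp (w * tau%:C) * g2 tau) ->
  cexp (z - w * t%:C) * (c1 * time_transform g1 w t - c2 * time_transform g2 w t) =
  cintegral `[0, t[ (fun tau =>
    cexp (- (w * (t - tau)%:C)) * (cexp z * (c1 * g1 tau - c2 * g2 tau))).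
Proof.
move=> i1 i2; have m : measurable (`[0, t]%classic : set R) by [].
rewrite /time_transform -!cintegralZ // -cintegralB //; try exact: cintegrableZ.
rewrite -cintegralZ //; last by apply: cintegrableB => //; exact: cintegrableZ.
rewrite cintegral_itv_bndo_bndc; last first.
  by apply: cintegrableZ => //; apply: cintegrableB => //; exact: cintegrableZ.
apply: eq_cintegral => tau _.
have -> : cexp (- (w * (t - tau)%:C)) = cexp (- (w * t%:C)) * cexp (w * tau%:C).
  by rewrite -cexpD; congr cexp; rewrite rmorphB /=; ring.
by rewrite cexpD; ring.
Qed.

End TimeTransform.

(** * Regularity of the data *)

Section HalfDerivative.
Context {R : realType}.
Implicit Types u : R -> R[i].

Lemma half_derive_near u (x e : R) : half_derivable u x -> 0 < e ->
  \forall y \near x, y != x -> 0 <= y ->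
    normc (half_quotient u x y - half_derive u x) < e.
Proof.
move=> ux e0; have e0C : 0 < e%:C :> R[i] by rewrite ltcR.
have := (cvgrPdist_lt _ _).1 ux _ e0C; rewrite !near_withinE => near_x.
apply: filterS (near_x _) => y yx yneq y0.
have := yx yneq; rewrite /= in_itv /= andbT => /(_ y0).
by rewrite distrC -[`|_|]/((normc _)%:C) ltcR.
Qed.

Lemma half_quotientK u (x y : R) : y != x ->
  u y - u x = half_quotient u x y * (y - x)%:C.
Proof.
by move=> yx; rewrite /half_quotient divfK // (inj_eq (@complexI R)) subr_eq0.
Qed.

Lemma half_derivable_near u (x e : R) : 0 <= x -> half_derivable u x -> 0 < e ->
  \forall y \near x, 0 <= y -> normc (u y - u x) < e.
Proof.
move=> x0 ux e0; have := half_derive_near ux ltr01.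
pose L := normc (half_derive u x) + 1.
have L0 : 0 < L by rewrite ltr_wpDl ?normc_ge0.
have xe : \forall y \near x, `|y - x| < e / L.
  by apply/nbhs_ballP; exists (e / L) => /=; [rewrite divr_gt0|move=> y; rewrite /ball /= distrC].
apply: filterS2 xe => y yx yq y0.
have [->|yneq] := eqVneq y x; first by rewrite subrr normc0.
rewrite half_quotientK // normcM normcR.
have qL : normc (half_quotient u x y) <= L.
  rewrite -[half_quotient u x y](subrK (half_derive u x)).
  apply: le_trans (normcD _ _) _; rewrite addrC lerD2l.
  exact: ltW (yq yneq y0).
apply: le_lt_trans (ler_wpM2r _ qL) _ => //.
by rewrite mulrC -ltr_pdivlMr.
Qed.

(** Composing with the absolute value turns one-sided continuity at 0 into
    two-sided continuity. *)
Lemma continuous_half u : (forall x : R, 0 <= x -> half_derivable u x) ->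
  continuous (fun x : R => Re (u `|x|)) /\
  continuous (fun x : R => Im (u `|x|)).
Proof.
move=> du.
have near_le (x e : R) : 0 < e -> \forall y \near x, normc (u `|y| - u `|x|) < e.
  move=> e0; have := half_derivable_near (normr_ge0 x) (du _ (normr_ge0 x)) e0.
  have cn := @norm_continuous _ R x.
  move=> H.
  have Hx : \forall y \near x, 0 <= `|y| -> normc (u `|y| - u `|x|) < e := cn _ H.
  by apply: filterS Hx => y; apply.
split=> x; apply/(@cvgrPdist_lt _ R) => e e0.
  apply: filterS (near_le x e e0) => y; apply: le_lt_trans.
  by rewrite distrC; apply: le_trans (Re_le_normc _); rewrite ReB.
apply: filterS (near_le x e e0) => y; apply: le_lt_trans.
by rewrite distrC; apply: le_trans (Im_le_normc _); rewrite ImB.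
Qed.

Lemma cmeasurable_half u : (forall x : R, 0 <= x -> half_derivable u x) ->
  cmeasurable setT (fun x : R => u `|x|).
Proof.
by move=> /continuous_half[cr ci]; split; exact: continuous_measurable_fun.
Qed.

Lemma half_bounded u (t : R) : (forall x : R, 0 <= x -> half_derivable u x) ->
  exists2 M, 0 <= M & forall x, 0 <= x <= t -> normc (u x) <= M.
Proof.
move=> /continuous_half[cr ci].
have [M1 M10 M1u] := within_continuous_bounded
  (continuous_subspaceT (A := `[0, t]%classic) cr).
have [M2 M20 M2u] := within_continuous_bounded
  (continuous_subspaceT (A := `[0, t]%classic) ci).
exists (M1 + M2); first exact: addr_ge0.
move=> x xt; have := M1u x xt; have := M2u x xt; case/andP: xt => x0 _.
rewrite (ger0_norm x0) => h2 h1.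
by apply: le_trans (normc_le_ReIm _) _; exact: lerD.
Qed.

End HalfDerivative.

Section JointMeasurability.
Context {R : realType}.
Notation mu := (@lebesgue_measure R).

(** Discretizing the first variable gives measurable approximations. *)
Lemma caratheodory_measurable (g : R -> R -> R) :
  (forall t, continuous (fun x : R => g `|x| t)) ->
  (forall x, 0 <= x -> measurable_fun setT (g x)) ->
  measurable_fun setT (fun p : R * R => g `|p.1| p.2).
Proof.
move=> gc gm.
pose x_ (n : nat) (x : R) : R := (Num.truncn (n.+1%:R * `|x|))%:R / n.+1%:R.
have x_le n x : `|x| - n.+1%:R^-1 <= x_ n x <= `|x|.
  have n0 : (0 : R) < n.+1%:R by [].
  have nx0 : 0 <= n.+1%:R * `|x| by rewrite mulr_ge0.
  have := truncn_itv nx0 => /andP[lo hi].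
  rewrite /x_; apply/andP; split; last by rewrite ler_pdivrMr // [leRHS]mulrC.
  rewrite ler_pdivlMr // mulrBl mulVf ?gt_eqF // lerBlDr [leLHS]mulrC natr1.
  exact: ltW.
apply: (@measurable_fun_cvg _ _ _ setT (fun n (p : R * R) => g (x_ n p.1) p.2)).
  move=> n _ A mA; rewrite setTI.
  have -> : (fun p : R * R => g (x_ n p.1) p.2) @^-1` A =
     \bigcup_k ([set x : R | Num.truncn (n.+1%:R * `|x|) = k] `*`
                (g (k%:R / n.+1%:R) @^-1` A)).
    apply/seteqP; split => [[x t] /= gA|[x t] [k _ [/= <- //]]].
    by exists (Num.truncn (n.+1%:R * `|x|)).
  apply: bigcupT_measurable => k; apply: measurableX.
    have -> : [set x : R | Num.truncn (n.+1%:R * `|x|) = k] =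
       (fun x : R => n.+1%:R * `|x|) @^-1` `[k%:R, k.+1%:R[%classic.
      apply/seteqP; split => x /=; rewrite in_itv /=.
        by move=> <-; apply: truncn_itv; rewrite mulr_ge0.
      by move/truncn_def.
    rewrite -[X in measurable X]setTI.
    apply: measurable_funM => //.
  have mg := gm (k%:R / n.+1%:R : R) (divr_ge0 (ler0n _ _) (ler0n _ _)).
  by rewrite -[X in measurable X]setTI; exact: mg.
move=> [x t] _ /=.
have xc : x_ n x @[n --> \oo] --> `|x|.
  apply: (@squeeze_cvgr _ _ _ _ (fun n => `|x| - n.+1%:R^-1) (fun=> `|x|)).
  - by near=> n; exact: x_le.
  - rewrite -[X in _ --> X]subr0; apply: cvgB; first exact: cvg_cst.
    exact: cvg_harmonic.
  - exact: cvg_cst.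
have := gc t `|x|; rewrite /continuous_at /= normr_id => gcx.
have := @cvg_comp _ _ _ (fun n => x_ n x) (fun y => g `|y| t) _ _ _ xc gcx.
rewrite (_ : _ \o _ = fun n => g (x_ n x) t) //.
by apply/funext => n /=; rewrite ger0_norm // divr_ge0.
Unshelve. all: by end_near. Qed.

Lemma cmeasurable_quadrant (f : R -> R -> R[i]) :
  (forall x t : R, 0 <= x -> 0 <= t ->
     half_derivable (fun y => f y t) x /\ half_derivable (f x) t) ->
  cmeasurable setT (fun p : R * R => f `|p.1| `|p.2|).
Proof.
move=> df.
have dx (t : R) : forall x : R, 0 <= x -> half_derivable (fun y => f y `|t|) x.
  by move=> x x0; have [] := df x `|t| x0 (normr_ge0 t).
have dt (x : R) : 0 <= x -> forall t : R, 0 <= t -> half_derivable (f x) t.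
  by move=> x0 t t0; have [] := df x t x0 t0.
split.
  apply: (caratheodory_measurable (g := fun x t => Re (f x `|t|))).
    by move=> t; have [] := continuous_half (dx t).
  by move=> x x0; case: (cmeasurable_half (dt x x0)).
apply: (caratheodory_measurable (g := fun x t => Im (f x `|t|))).
  by move=> t; have [] := continuous_half (dx t).
by move=> x x0; case: (cmeasurable_half (dt x x0)).
Qed.

Lemma measurable_parameter_integral d (X : measurableType d) (D : set R)
    (g : X * R -> R) : measurable D -> measurable_fun setT g ->
  measurable_fun setT (fun p => \int[mu]_(y in D) g (p, y)).
Proof.
move=> mD mg.
pose h (q : X * R) : \bar R := (\1_D q.2 * g q)%:E.
have mh : measurable_fun setT h.
  apply/measurable_EFinP; apply: measurable_funM => //.
  apply: measurableT_comp; first exact: measurable_indic.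
  exact: measurable_snd.
apply: (measurableT_comp (fine_measurable measurableT)).
have -> : (fun p => \int[mu]_(y in D) (g (p, y))%:E)%E =
    (fun p => \int[mu]_y h^\+%E (p, y) - \int[mu]_y h^\-%E (p, y))%E.
  apply/funext => p.
  rewrite integral_mkcond integralE.
  congr (_ - _)%E; apply: eq_integral => y _;
    rewrite ?funepos.unlock ?funeneg.unlock /h /patch indicE /=;
    by case: ifP => _; rewrite ?mul1r ?mul0r.
apply: emeasurable_funB.
  apply: (@measurable_fun_fubini_tonelli_F _ _ _ _ _ mu h^\+%E) => //.
  exact: measurable_funepos.
apply: (@measurable_fun_fubini_tonelli_F _ _ _ _ _ mu h^\-%E) => //.
exact: measurable_funeneg.
Qed.

Lemma cmeasurable_parameter_integral d (X : measurableType d) (D : set R)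
    (G : X -> R -> R[i]) : measurable D ->
  cmeasurable setT (fun q : X * R => G q.1 q.2) ->
  cmeasurable setT (fun p => cintegral D (G p)).
Proof.
move=> mD [mr mi]; split.
  exact: (measurable_parameter_integral mD mr).
exact: (measurable_parameter_integral mD mi).
Qed.

End JointMeasurability.

(** * The kernel of the boundary trace on the real line *)

Section Exhaustion.
Context {R : realType}.
Notation mu := (@lebesgue_measure R).

Lemma continuous_lorentz : continuous (fun x : R => (1 + x ^+ 2)^-1).
Proof. exact: continuous_oneDsqrV. Qed.

Lemma lorentz_gt0 (x : R) : 0 < (1 + x ^+ 2)^-1.
Proof. by rewrite invr_gt0 ltr_pwDl // sqr_ge0. Qed.

Lemma integrable_lorentz : mu.-integrable setT (fun x => ((1 + x ^+ 2)^-1)%:E).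
Proof.
apply/integrableP; split.
  by apply/measurable_EFinP; apply: continuous_measurable_fun; exact: continuous_lorentz.
under eq_integral => x _ do rewrite gee0_abs ?lee_fin ?(ltW (lorentz_gt0 x)) //.
rewrite ge0_symfun_integralT.
- by rewrite -set_itvcy (@integral0y_oneDsqr R) -EFinM ltry.
- by move=> x; exact/ltW/lorentz_gt0.
- exact: continuous_lorentz.
- by move=> x /=; rewrite sqrrN.
Qed.

(** The fundamental theorem of calculus on a set exhausted by segments. *)
Lemma Rintegral_exhaustion (D : set R) (c d : R^nat) (F f : R -> R) (l : R) :
  measurable D -> (forall n, c n < d n) -> (forall n, `[c n, d n] `<=` D) ->
  (forall x, D x -> \forall n \near \oo, c n <= x <= d n) ->
  continuous F -> continuous f ->
  (forall n x, c n < x < d n -> is_derive x (1 : R) F (f x)) ->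
  mu.-integrable D (fun x => (f x)%:E) ->
  F (d n) - F (c n) @[n --> \oo] --> l ->
  \int[mu]_(x in D) f x = l.
Proof.
move=> mD cd cdD Dcd cF cf Ff fi Fl.
pose E n : set R := `[c n, d n]%classic.
have ftc n : \int[mu]_(x in E n) f x = F (d n) - F (c n).
  rewrite /Rintegral (@continuous_FTC2 _ f F) //.
  - exact: continuous_subspaceT.
  - split.
    + by move=> x; rewrite in_itv /= => xcd; have dF := Ff n x xcd; exact: ex_derive.
    + by apply: cvg_at_right_filter; exact: cF.
    + by apply: cvg_at_left_filter; exact: cF.
  - move=> x; rewrite in_itv /= => xcd; have dF := Ff n x xcd.
    by rewrite derive1E derive_val.
have mf : measurable_fun D f by move: fi => /measurable_int/measurable_EFinP.
have lim : (\int[mu]_(x in D) (\1_(E n) x * f x)) @[n --> \oo] --> \int[mu]_(x in D) f x.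
  have mi n : measurable_fun D (\1_(E n) : R -> R).
    by apply: measurable_indic; exact: measurable_itv.
  have [|||||_ _] := @dominated_convergence _ _ _ mu D mD
      (fun n x => (\1_(E n) x * f x)%:E) (fun x => (f x)%:E)
      (fun x => (`|f x|)%:E) _ _ _ _ _.
  - by move=> n; apply/measurable_EFinP; apply: measurable_funM => //; exact: mi.
  - exact/measurable_EFinP.
  - apply: aeW => x Dx; apply/fine_cvgP; split; first by near=> n.
    apply: cvg_near_cst; near=> n; rewrite /= indicE mem_set ?mul1r //.
    by rewrite /E /= in_itv /=; near: n; exact: Dcd.
  - exact: integrable_norm.
  - apply: aeW => x n Dx; rewrite lee_fin indicE.
    by case: (_ \in _); rewrite ?mul1r ?mul0r ?normr0.
  move=> lim; apply: fine_cvg.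
  rewrite (_ : (\int[mu]_(x in D) f x)%:E = (\int[mu]_(x in D) (f x)%:E)%E).
    exact: lim.
  by apply: fineK; exact: integrable_fin_num.
have EnE n : \int[mu]_(x in D) (\1_(E n) x * f x) = F (d n) - F (c n).
  rewrite -ftc RintegralT_indic [RHS]RintegralT_indic.
  apply: eq_Rintegral => x _; rewrite !indicE.
  have [xE|xE] := boolP (x \in E n); last by rewrite mul0r mulr0.
  by rewrite (mem_set (cdD n x _)) ?mul1r //; exact: set_mem.
rewrite (funext EnE) in lim.
exact: (cvg_unique _ lim Fl).
Unshelve. all: by end_near. Qed.

End Exhaustion.

Section LineKernel.
Context {R : realType} (alpha beta : R).
Notation mu := (@lebesgue_measure R).
Hypothesis alpha_gt0 : 0 < alpha.
Hypothesis beta_gt0 : 0 < beta.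

Definition romega (l : R) : R := alpha * l ^+ 2 + beta * l ^+ 4.

Lemma omega_real (l : R) : omega alpha beta l%:C = (romega l)%:C.
Proof.
by rewrite /omega /romega; apply: complexP; rewrite !exprS !expr0 /=; ring.
Qed.

Lemma romega_ge (l : R) : alpha * l ^+ 2 <= romega l.
Proof.
by rewrite /romega lerDl mulr_ge0 ?(ltW beta_gt0) // exprn_even_ge0.
Qed.

Lemma romega_ge0 (l : R) : 0 <= romega l.
Proof. by apply: le_trans (romega_ge l); rewrite mulr_ge0 ?sqr_ge0 // ltW. Qed.

Lemma romega_gt0 (l : R) : l != 0 -> 0 < romega l.
Proof.
move=> l0; apply: lt_le_trans (romega_ge l).
by rewrite mulr_gt0 // exprn_even_gt0.
Qed.

Lemma mul_expRN_le1 (y : R) : 0 <= y -> y * expR (- y) <= 1.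
Proof.
move=> y0; rewrite expRN ler_pdivrMr ?expR_gt0 // mul1r.
by apply: le_trans (expR_ge1Dx y); rewrite lerDr.
Qed.

Lemma decay_lorentz (s : R) : 0 < s -> exists2 C, 0 <= C &
  forall s' l : R, s <= s' -> expR (- (romega l * s')) <= C * (1 + l ^+ 2)^-1.
Proof.
move=> s0; pose C := 1 + (alpha * s)^-1.
have as0 : 0 < alpha * s by rewrite mulr_gt0.
exists C; first by rewrite addr_ge0 // invr_ge0 ltW.
move=> s' l ss'; rewrite expRN ler_pdivlMr ?ltr_pwDl ?sqr_ge0 //.
rewrite mulrC ler_pdivrMr ?expR_gt0 //.
have l2 := sqr_ge0 l.
have e1 : 1 + alpha * s * l ^+ 2 <= expR (romega l * s').
  apply: le_trans (expR_ge1Dx _); rewrite lerD2l mulrAC.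
  apply: ler_pM => //; [|exact: ltW|exact: romega_ge].
  by rewrite mulr_ge0 // ltW.
apply: le_trans (ler_wpM2l _ e1); last by rewrite addr_ge0 // invr_ge0 ltW.
have -> : C * (1 + alpha * s * l ^+ 2) =
    1 + l ^+ 2 + alpha * s * l ^+ 2 + (alpha * s)^-1.
  by rewrite /C; field; rewrite !gt_eqF.
have asl : 0 <= alpha * s * l ^+ 2 by rewrite mulr_ge0 // ltW.
have asV : 0 <= (alpha * s)^-1 by rewrite invr_ge0 ltW.
by lra.
Qed.

(** As above, [kappa] and [K] stand for cosine and sine, up to signs. *)
Section Frequency.
Variables (x : R) (kappa K : R -> R).
Hypothesis x_gt0 : 0 < x.
Hypothesis K_deriv : forall y, is_derive y (1 : R) K (kappa y).
Hypothesis K_le1 : forall y, `|K y| <= 1.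
Hypothesis kappa_le1 : forall y, `|kappa y| <= 1.
Hypothesis kappa_cont : continuous kappa.

(** One integration by parts: the derivative of
    exp (- omega s) l / (1 + l ^ 2) is dominated by 5 / (1 + l ^ 2), uniformly
    in s, because y exp (- y) is bounded. *)
Lemma trace_kernel_real_le (s : R) : 0 < s ->
  `|\int[mu]_l (expR (- (romega l * s)) * (l / (1 + l ^+ 2)) * kappa (x * l))|
    <= 5 * x^-1 * \int[mu]_l (1 + l ^+ 2)^-1.
Proof.
move=> s0.
pose W (l : R) := (1 + l ^+ 2)^-1.
pose e (l : R) := expR (- (romega l * s)).
pose r l := e l * (l * W l).
pose de l := - ((2 * alpha * l + 4 * beta * l ^+ 3) * s) * e l.
pose dW l := - (2 * l) * W l ^+ 2.
pose dr l := de l * (l * W l) + e l * (1 * W l + l * dW l).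
have W0 l : 0 < W l := lorentz_gt0 l.
have Wn0 l : 1 + l ^+ 2 != 0 :> R by rewrite gt_eqF // ltr_pwDl // sqr_ge0.
have id l : is_derive l (1 : R) (fun y : R => y) 1 by exact: is_derive_id.
have dE l : is_derive l (1 : R) e (de l).
  have d1 := is_derive_mulcf (- (alpha * s)) (is_derive_expf 2 (id l)).
  have d2 := is_derive_mulcf (- (beta * s)) (is_derive_expf 4 (id l)).
  have -> : e = fun y => expR (- (alpha * s) * y ^+ 2 + - (beta * s) * y ^+ 4).
    by apply/funext => y; rewrite /e /romega; congr expR; ring.
  apply: (is_derive_eq (@is_derive1_comp _ expR _ _ _ _ (is_derive_expR _)
    (is_derive_addf d1 d2))).
  rewrite /de /e /romega mulrC /=; congr (_ * _); first by ring.
  by congr expR; ring.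
have dWd l : is_derive l (1 : R) W (dW l).
  have d1 := is_derive_expf 2 (id l).
  have dc : is_derive l (1 : R) (fun _ : R => (1 : R)) 0 by exact: is_derive_cst.
  have dV := @is_deriveV R (fun y => 1 + y ^+ 2) l _ 1 (Wn0 l) (is_derive_addf dc d1).
  apply: (is_derive_eq dV).
  rewrite /dW /W /GRing.scale /= expr1 exprVn; field.
  exact: Wn0.
have rd l : is_derive l (1 : R) r (dr l).
  exact: (is_derive_mulf (dE l) (is_derive_mulf (id l) (dWd l))).
have cW : continuous W := @continuous_lorentz R.
have ce : continuous e by move=> l; exact: (is_derive_continuous (dE l)).
have cr : continuous r by move=> l; exact: (is_derive_continuous (rd l)).
have cX n : continuous (fun y : R => y ^+ n) by move=> l; exact: exprn_continuous.
have cid : continuous (fun y : R => y) by move=> l; exact: cvg_id.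
have cc (k : R) : continuous (fun _ : R => k) by move=> l; exact: cvg_cst.
have cdr : continuous dr.
  move=> l; apply: cvgD.
    apply: cvgM; last by apply: cvgM; [exact: cid|exact: cW].
    apply: cvgM; last exact: ce.
    apply: cvgN; apply: cvgM; last exact: cc.
    apply: cvgD; first by apply: cvgM; [exact: cc|exact: cid].
    by apply: cvgM; [exact: cc|exact: cX].
  apply: cvgM; first exact: ce.
  apply: cvgD; first by apply: cvgM; [exact: cc|exact: cW].
  apply: cvgM; first exact: cid.
  apply: cvgM; last by apply: (@cvg_comp _ _ _ W (fun y => y ^+ 2)); [exact: cW|exact: cX].
  by apply: cvgN; apply: cvgM; [exact: cc|exact: cid].
have e0 l : 0 < e l := expR_gt0 _.
have e1 l : e l <= 1.
  by rewrite /e expR_le1 oppr_le0 mulr_ge0 ?romega_ge0 // ltW.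
have dr_le l : `|dr l| <= 5 * W l.
  have -> : dr l = - ((2 * alpha * l ^+ 2 + 4 * beta * l ^+ 4) * s * e l) * W l
     + e l * ((1 - l ^+ 2) * W l) * W l.
    rewrite /dr /de /dW /W; field; exact: Wn0.
  have l2 := sqr_ge0 l.
  have l4 : 0 <= l ^+ 4 by rewrite exprn_even_ge0.
  apply: le_trans (ler_normD _ _) _.
  rewrite !normrM normrN (gtr0_norm (W0 l)) (gtr0_norm (e0 l)).
  have h1 : `|(2 * alpha * l ^+ 2 + 4 * beta * l ^+ 4) * s * e l| <= 4.
    have a2 := mulr_ge0 (ltW alpha_gt0) l2.
    have b4 := mulr_ge0 (ltW beta_gt0) l4.
    have -> : (2 * alpha * l ^+ 2 + 4 * beta * l ^+ 4) * s * e l =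
      (2 * (alpha * l ^+ 2) + 4 * (beta * l ^+ 4)) * (s * e l) by ring.
    have se : 0 <= s * e l by rewrite mulr_ge0 // ltW.
    rewrite ger0_norm; last by rewrite mulr_ge0 //; lra.
    apply: (@le_trans _ _ (4 * romega l * (s * e l))).
      by apply: ler_wpM2r => //; rewrite /romega; lra.
    have := @mul_expRN_le1 (romega l * s).
    rewrite mulr_ge0 ?romega_ge0 ?(ltW s0) // => /(_ isT).
    rewrite -/(e l); have -> : 4 * romega l * (s * e l) = 4 * (romega l * s * e l) by ring.
    by lra.
  have h2 : `|1 - l ^+ 2| * W l <= 1.
    rewrite ler_pdivrMr ?ltr_pwDl // mul1r ler_norml; apply/andP; split; lra.
  have h3 : e l * (`|1 - l ^+ 2| * W l) <= 1.
    rewrite -[leRHS]mulr1; apply: ler_pM => //; first exact: ltW.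
    by rewrite mulr_ge0 // ltW.
  rewrite -mulrDl; apply: ler_wpM2r; first exact: ltW.
  rewrite normrM normrM in h1.
  by move: h1 h3; rewrite !normrM (gtr0_norm (e0 l)); lra.
have [C C0 eC] := decay_lorentz s0.
have r_le l : `|r l| <= C * W l.
  rewrite /r normrM gtr0_norm // -[leRHS]mulr1; apply: ler_pM => //; first exact: ltW.
    exact: eC.
  rewrite normrM (gtr0_norm (W0 l)) ler_pdivrMr ?ltr_pwDl ?sqr_ge0 // mul1r.
  by rewrite ler_norml; apply/andP; split; have := sqr_ge0 (l - 1); have := sqr_ge0 (l + 1);
    rewrite !expr2; lra.
have cK : continuous K by move=> l; exact: (is_derive_continuous (K_deriv l)).
have cxl (k : R -> R) : continuous k -> continuous (fun l => k (x * l)).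
  move=> ck l; apply: (@cvg_comp _ _ _ (fun l => x * l) k); last exact: ck.
  by apply: cvgM; [exact: cc|exact: cid].
pose F l := r l * (x^-1 * K (x * l)).
pose f l := dr l * (x^-1 * K (x * l)) + r l * kappa (x * l).
have iW k : mu.-integrable setT (fun l => (k * W l)%:E).
  by apply: integrableZ_real => //; exact: integrable_lorentz.
have x0V : 0 <= x^-1 by rewrite invr_ge0 ltW.
have i1 : mu.-integrable setT (fun l => (dr l * (x^-1 * K (x * l)))%:E).
  apply: (le_integrable_real measurableT _ (iW (5 * x^-1))).
    apply: continuous_measurable_fun => l; apply: cvgM; first exact: cdr.
    by apply: cvgM; [exact: cc|exact: cxl].
  move=> l _; rewrite normrM mulrAC; apply: ler_pM => //.
  by rewrite normrM ger0_norm // -[leRHS]mulr1; apply: ler_wpM2l.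
have i2 : mu.-integrable setT (fun l => (r l * kappa (x * l))%:E).
  apply: (le_integrable_real measurableT _ (iW C)).
    apply: continuous_measurable_fun => l; apply: cvgM; first exact: cr.
    exact: cxl.
  by move=> l _; rewrite normrM -[leRHS]mulr1; apply: ler_pM.
have Fd l : is_derive l (1 : R) F (f l).
  have d1 := is_derive_mulcf x (id l).
  have d2 := @is_derive1_comp _ K (fun y => x * y) _ _ _ (K_deriv _) d1.
  apply: (is_derive_eq (is_derive_mulf (rd l) (is_derive_mulcf x^-1 d2))).
  rewrite /f /=; congr (_ + _ * _); rewrite mulr1 mulrCA mulVf ?mulr1 //.
  by rewrite gt_eqF.
have F_le l : `|F l| <= C * x^-1 * W l.
  rewrite normrM mulrAC; apply: ler_pM => //.
  by rewrite normrM ger0_norm // -[leRHS]mulr1; apply: ler_wpM2l.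
have intf : \int[mu]_l f l = 0.
  apply: (@Rintegral_exhaustion _ _ (fun n => - n.+1%:R) (fun n => n.+1%:R) F) => //.
  - by move=> n; apply: (@lt_trans _ _ 0); rewrite ?oppr_lt0.
  - move=> l _; exists (Num.truncn `|l|) => // n /= nl.
    rewrite -ler_norml; apply: le_trans (ltW (truncnS_gt _)) _.
    by rewrite ler_nat.
  - by move=> l; exact: (is_derive_continuous (Fd l)).
  - move=> l; apply: cvgD.
      by apply: cvgM; [exact: cdr|apply: cvgM; [exact: cc|exact: cxl]].
    by apply: cvgM; [exact: cr|exact: cxl].
  - by under eq_fun do rewrite EFinD; exact: integrableD.
  - apply/cvgr0Pnorm_le => eps eps0.
    have WO : C * x^-1 * (2 * n.+1%:R^-1) @[n --> \oo] --> (0 : R).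
      rewrite -[X in _ --> X](mulr0 (C * x^-1)); apply: cvgM; first exact: cvg_cst.
      rewrite -[X in _ --> X](mulr0 2); apply: cvgM; first exact: cvg_cst.
      exact: cvg_harmonic.
    move/cvgr0Pnorm_le : WO => /(_ _ eps0); apply: filterS => n.
    apply: le_trans; apply: le_trans (ler_norm _).
    apply: le_trans (ler_normB _ _) _.
    have Wn : W n.+1%:R <= n.+1%:R^-1.
      have N0 : 0 <= n.+1%:R :> R by exact: ler0n.
      rewrite /W lef_pV2 ?posrE // -?invr_gt0 //.
      by have := sqr_ge0 (n.+1%:R - 1 : R); rewrite !expr2; lra.
    have WNn : W (- n.+1%:R) <= n.+1%:R^-1 by rewrite /W sqrrN.
    have Cx : 0 <= C * x^-1 by rewrite mulr_ge0.
    apply: le_trans (lerD (F_le _) (F_le _)) _.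
    by rewrite -mulrDr; apply: ler_wpM2l => //; rewrite mulr_natl mulr2n; exact: lerD.
have -> : \int[mu]_l (expR (- (romega l * s)) * (l / (1 + l ^+ 2)) * kappa (x * l)) =
    - \int[mu]_l (dr l * (x^-1 * K (x * l))).
  move: intf; rewrite RintegralD // => /eqP; rewrite addrC addr_eq0 => /eqP <-.
  by [].
rewrite normrN; apply: le_trans (le_normr_Rintegral measurableT i1) _.
rewrite -RintegralZl //; last exact: integrable_lorentz.
apply: le_Rintegral => //; first exact: integrable_norm.
  exact: iW.
move=> l _; rewrite normrM mulrAC; apply: ler_pM => //.
by rewrite normrM ger0_norm // -[leRHS]mulr1; apply: ler_wpM2l.
Qed.

End Frequency.

Lemma cexp_decay_line (l s : R) :
  cexp (- (omega alpha beta l%:C * s%:C)) = (expR (- (romega l * s)))%:C.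
Proof.
rewrite omega_real /cexp ReN ImN ReM ImM /= !mulr0 mul0r subr0 addr0 oppr0.
by rewrite cos0 sin0; apply: complexP => /=; ring.
Qed.

Lemma cexp_wave (l x : R) :
  cexp ('i%C * l%:C * x%:C) = cos (x * l) +i* sin (x * l).
Proof.
have E : 'i%C * l%:C * x%:C = 0 +i* (x * l) by apply: complexP => /=; ring.
by rewrite E /cexp /= expR0; apply: complexP => /=; ring.
Qed.

(** The kernel is not absolutely integrable uniformly in s: its boundedness as
    s tends to 0 is due to the oscillation of exp (i l x), for x > 0. *)
Lemma trace_kernel_le (x : R) : 0 < x -> exists2 C, 0 <= C & forall s, 0 < s ->
  normc (cintegral setT (fun l =>
    cexp (- (omega alpha beta l%:C * s%:C)) *
    (cexp ('i%C * l%:C * x%:C) * (l / (1 + l ^+ 2))%:C))) <= C.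
Proof.
move=> x0; pose C := 5 * x^-1 * \int[mu]_l (1 + l ^+ 2)^-1.
have C0 : 0 <= C.
  rewrite mulr_ge0 ?mulr_ge0 ?invr_ge0 ?(ltW x0) //.
  by apply: Rintegral_ge0 => l _; exact/ltW/lorentz_gt0.
have cos1 (y : R) : `|cos y| <= 1 by rewrite ler_norml cos_geN1 cos_le1.
have sin1 (y : R) : `|sin y| <= 1 by rewrite ler_norml sin_geN1 sin_le1.
exists (C + C) => [|s s0]; first exact: addr_ge0.
apply: le_trans (normc_le_ReIm _) _; apply: lerD.
  have -> F : Re (cintegral setT F) = \int[mu]_l Re (F l) by [].
  rewrite (@eq_Rintegral _ _ _ mu setT (fun l =>
    expR (- (romega l * s)) * (l / (1 + l ^+ 2)) * cos (x * l))).
    by apply: (@trace_kernel_real_le x cos sin) => //; exact: continuous_cos.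
  by move=> l _; rewrite cexp_decay_line cexp_wave /=; ring.
have -> F : Im (cintegral setT F) = \int[mu]_l Im (F l) by [].
rewrite (@eq_Rintegral _ _ _ mu setT (fun l =>
    expR (- (romega l * s)) * (l / (1 + l ^+ 2)) * sin (x * l))).
  apply: (@trace_kernel_real_le x sin (fun y => - cos y)) => //.
  - by move=> y; apply: (is_derive_eq (is_deriveN _)); rewrite opprK.
  - by move=> y; rewrite normrN.
  - exact: continuous_sin.
by move=> l _; rewrite cexp_decay_line cexp_wave /=; ring.
Qed.

(** For s >= 1 the exponential is smaller than a multiple of
    1 / (1 + l ^ 2), and it tends to 0 for l <> 0. *)
Lemma line_decay (M : R) : 0 <= M -> exists2 C, 0 <= C &
  forall G, cmeasurable setT G -> (forall l, normc (G l) <= M) ->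
  (forall s, 1 <= s -> normc (cintegral setT
     (fun l => cexp (- (omega alpha beta l%:C * s%:C)) * G l)) <= C) /\
  vanishing (fun s => cintegral setT
     (fun l => cexp (- (omega alpha beta l%:C * s%:C)) * G l)).
Proof.
move=> M0; have [C C0 eC] := decay_lorentz (ltr01 : (0 : R) < 1).
have iB : mu.-integrable setT (fun l => (C * M * (1 + l ^+ 2)^-1)%:E).
  by apply: integrableZ_real => //; exact: integrable_lorentz.
exists (2 * \int[mu]_l (C * M * (1 + l ^+ 2)^-1)).
  apply: mulr_ge0 => //; apply: Rintegral_ge0 => l _.
  by rewrite !mulr_ge0 // ltW // lorentz_gt0.
move=> G mG GM.
have mE s : cmeasurable setT
    (fun l : R => cexp (- (omega alpha beta l%:C * s%:C)) * G l).
  apply: cmeasurableM => //.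
  rewrite (_ : (fun l => cexp _) = fun l => (expR (- (romega l * s)))%:C); last first.
    by apply/funext => l; rewrite cexp_decay_line.
  apply: cmeasurable_real; apply: continuous_measurable_fun => l.
  apply: (@cvg_comp _ _ _ (fun l => - (romega l * s)) expR);
    last exact: continuous_expR.
  apply: cvgN; apply: cvgM; last exact: cvg_cst.
  by apply: cvgD; apply: cvgM; try exact: cvg_cst; exact: exprn_continuous.
have EB s l : 1 <= s -> normc (cexp (- (omega alpha beta l%:C * s%:C)) * G l)
    <= C * M * (1 + l ^+ 2)^-1.
  move=> s1; rewrite normcM cexp_decay_line normcR gtr0_norm ?expR_gt0 //.
  by rewrite mulrAC; apply: ler_pM; rewrite ?expR_ge0 ?normc_ge0 //; exact: eC.
split.
  by move=> s s1; apply: normc_cintegral_le => // l _; exact: EB.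
apply: (@dominated_vanishing _ _ _ (fun l => C * M * (1 + l ^+ 2)^-1) 1) => //.
- by move=> s l s1 _; exact: EB.
- have := @lebesgue_measure_set1 R 0 => mu0.
  exists [set 0]; split => // l /= nl; apply: contrapT => /eqP l0; apply: nl => _.
  apply: (@vanishing_le _ _ (fun s => M * (romega l * s)^-1)).
    near=> s; have s0 : 0 < s by near: s; apply: nbhs_pinfty_gt; exact: num_real.
    have ls : 0 < romega l * s by rewrite mulr_gt0 // romega_gt0.
    rewrite normcM cexp_decay_line normcR gtr0_norm ?expR_gt0 // mulrC.
    apply: ler_pM; rewrite ?expR_ge0 ?normc_ge0 //.
    by rewrite -[leRHS]mul1r ler_pdivlMr // mulrC mul_expRN_le1 // ltW.
  rewrite -[X in _ --> X](mulr0 M); apply: cvgM; first exact: cvg_cst.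
  rewrite [X in X @ _ --> _](_ : _ = fun s => (romega l)^-1 * s^-1); last first.
    by apply/funext => s; rewrite invfM.
  rewrite -[X in _ --> X](mulr0 (romega l)^-1); apply: cvgM; first exact: cvg_cst.
  exact: cvg_inv_pinfty.
Unshelve. all: by end_near. Qed.

End LineKernel.

(** * Half-line Fourier transforms *)

Section HalfFourier.
Context {R : realType}.
Notation mu := (@lebesgue_measure R).
Notation D0 := (`[0%R, +oo[%classic : set R).

Lemma eq_cmeasurable d (X : measurableType d) (D : set X) (F G : X -> R[i]) :
  (forall x, D x -> F x = G x) -> cmeasurable D F -> cmeasurable D G.
Proof.
move=> FG [Fr Fi]; split.
  apply: (eq_measurable_fun (fun x => Re (F x))) => // x /set_mem Dx /=.
  by rewrite FG.
apply: (eq_measurable_fun (fun x => Im (F x))) => // x /set_mem Dx /=.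
by rewrite FG.
Qed.

Lemma Re_fourier_phase (l : R[i]) (y : R) : Re (- 'i%C * l * y%:C) = Im l * y.
Proof. by case: l => a b /=; ring. Qed.

Lemma cmeasurable_fourier_phase (D : set R) (l : R[i]) :
  cmeasurable D (fun y => cexp (- 'i%C * l * y%:C)).
Proof.
apply: cmeasurable_cexp; apply: cmeasurableM; first exact: cmeasurable_cst.
by apply: cmeasurable_real; exact: measurable_id.
Qed.

Lemma cintegrable_fourier (u : R -> R[i]) (l : R[i]) : Im l <= 0 ->
  cintegrable D0 u ->
  cintegrable D0 (fun y => cexp (- 'i%C * l * y%:C) * u y).
Proof.
move=> l0 iu; apply: (cintegrable_le (B := fun y => normc (u y))) => //.
- apply: cmeasurableM; first exact: cmeasurable_fourier_phase.
  exact: cintegrable_measurable.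
- exact: cintegrable_normc.
- move=> y; rewrite /= in_itv /= andbT => y0; rewrite normcM -[leRHS]mul1r.
  apply: ler_wpM2r; first exact: normc_ge0.
  by apply: normc_cexp_le1; rewrite Re_fourier_phase mulr_le0_ge0.
Qed.

Lemma half_fourier_le (u : R -> R[i]) (l : R[i]) : Im l <= 0 ->
  cintegrable D0 u ->
  normc (half_fourier u l) <= 2 * \int[mu]_(y in D0) normc (u y).
Proof.
move=> l0 iu; apply: normc_cintegral_le => //.
- apply: cmeasurableM; first exact: cmeasurable_fourier_phase.
  exact: cintegrable_measurable.
- exact: cintegrable_normc.
- move=> y; rewrite /= in_itv /= andbT => y0; rewrite normcM -[leRHS]mul1r.
  apply: ler_wpM2r; first exact: normc_ge0.
  by apply: normc_cexp_le1; rewrite Re_fourier_phase mulr_le0_ge0.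
Qed.

Lemma half_fourierB (u v : R -> R[i]) (l : R[i]) : Im l <= 0 ->
  cintegrable D0 u -> cintegrable D0 v ->
  half_fourier (fun y => u y - v y) l = half_fourier u l - half_fourier v l.
Proof.
move=> l0 iu iv; rewrite /half_fourier -cintegralB //; try exact: cintegrable_fourier.
by apply: eq_cintegral => y _; rewrite mulrBr.
Qed.

Lemma integrable_lorentz_half (C : R) :
  mu.-integrable D0 (fun y => (C * (1 + y ^+ 2)^-1)%:E).
Proof.
apply: integrableZ_real => //.
by apply: (@integrableS _ _ _ mu setT) => //; exact: integrable_lorentz.
Qed.

Lemma cintegrable_lorentz (u : R -> R[i]) (C : R) : cmeasurable D0 u ->
  (forall y, 0 <= y -> normc (u y) <= C * (1 + y ^+ 2)^-1) -> cintegrable D0 u.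
Proof.
move=> mu' uC; apply: (cintegrable_le (B := fun y => C * (1 + y ^+ 2)^-1)) => //.
  exact: integrable_lorentz_half.
by move=> y; rewrite /= in_itv /= andbT; exact: uC.
Qed.

(** What the half-line transforms use of the forcing term and of its second
    derivative; the initial datum is the case of a function constant in time.
    The absolute values make the measurability independent of the values at
    negative arguments. *)
Definition tame (p : R -> R -> R[i]) :=
  cmeasurable setT (fun q : R * R => p `|q.1| `|q.2|) /\
  forall t, 0 < t -> exists2 C, 0 <= C &
    forall y tau, 0 <= y -> 0 <= tau <= t ->
      normc (p y tau) <= C * (1 + y ^+ 2)^-1.

Section Tame.
Variable p : R -> R -> R[i].
Hypothesis p_tame : tame p.

Lemma tame_section (tau : R) : 0 <= tau -> cintegrable D0 (fun y => p y tau).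
Proof.
move=> tau0; have [mp pC] := p_tame.
have tau1 : 0 < tau + 1 by lra.
have [C C0 pCt] := pC _ tau1.
apply: (@cintegrable_lorentz _ C).
  apply: (@eq_cmeasurable _ R D0 (fun y : R => p `|y| `|tau|)).
    move=> y; rewrite /= in_itv /= andbT => y0.
    by rewrite (ger0_norm y0) (ger0_norm tau0).
  apply: (@cmeasurable_comp _ _ _ R (R * R)%type
    (fun q : R * R => p `|q.1| `|q.2|) (fun y => (y, tau)) D0 mp).
  exact: measurable_funTS.
by move=> y y0; apply: pCt; lra.
Qed.

Lemma tame_fourier_le (t : R) : 0 < t -> exists2 M, 0 <= M &
  forall (l : R[i]) tau, Im l <= 0 -> 0 <= tau <= t ->
    normc (half_fourier (fun y => p y tau) l) <= M.
Proof.
move=> t0; have [_ /(_ t t0)[C C0 pC]] := p_tame.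
exists (2 * \int[mu]_(y in D0) (C * (1 + y ^+ 2)^-1)).
  rewrite mulr_ge0 //; apply: Rintegral_ge0 => y _.
  by rewrite mulr_ge0 // ltW // lorentz_gt0.
move=> l tau l0 tau_t; have tau0 : 0 <= tau by case/andP: tau_t.
apply: le_trans (half_fourier_le l0 (tame_section tau0)) _.
apply: ler_wpM2l => //; apply: le_Rintegral => //.
- by apply: cintegrable_normc => //; exact: tame_section.
- exact: integrable_lorentz_half.
- by move=> y; rewrite /= in_itv /= andbT => y0; exact: pC.
Qed.

Lemma tame_fourier_measurable (l : R -> R[i]) : cmeasurable setT l ->
  cmeasurable setT
    (fun q : R * R => half_fourier (fun y => p y `|q.2|) (l q.1)).
Proof.
move=> ml; have [mp _] := p_tame.
have -> : (fun q : R * R => half_fourier (fun y => p y `|q.2|) (l q.1)) =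
   (fun q : R * R => cintegral D0
      (fun y => cexp (- 'i%C * l q.1 * y%:C) * p `|y| `|q.2|)).
  apply/funext => q; apply: eq_cintegral => y.
  by rewrite /= in_itv /= andbT => y0; rewrite (ger0_norm y0).
apply: (@cmeasurable_parameter_integral _ _ (R * R)%type D0 (fun (q : R * R) (y : R) =>
  cexp (- 'i%C * l q.1 * y%:C) * p `|y| `|q.2|)) => //.
apply: cmeasurableM.
  apply: cmeasurable_cexp; apply: cmeasurableM.
    apply: cmeasurableM; first exact: cmeasurable_cst.
    apply: (cmeasurable_comp (g := fun z : (R * R) * R => z.1.1) ml).
    exact: (measurableT_comp measurable_fst measurable_fst).
  by apply: cmeasurable_real; exact: measurable_snd.
apply: (@cmeasurable_comp _ _ _ ((R * R) * R)%type (R * R)%type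
  (fun q : R * R => p `|q.1| `|q.2|) (fun z => (z.2, z.1.2)) setT mp).
apply: measurable_fun_pair; first exact: measurable_snd.
exact: (measurableT_comp measurable_snd measurable_fst).
Qed.

(** Tonelli's theorem exchanges the two integrals of the weak periodicity
    assumption, so that the increments of the transform over one period are
    integrable in time, uniformly in the frequency. *)
Lemma tame_fourier_increment (T : R) : 0 < T -> weakly_periodic2 T p ->
  exists2 N : R -> R, mu.-integrable D0 (fun tau => (N tau)%:E) &
  forall (l : R[i]) tau, Im l <= 0 -> 0 <= tau ->
    normc (half_fourier (fun y => p y (tau + T)) l -
           half_fourier (fun y => p y tau) l) <= N tau.
Proof.
move=> T0 wp; have [mp _] := p_tame.
pose N tau := 2 * \int[mu]_(y in D0) normc (p y (tau + T) - p y tau).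
have iinc tau : 0 <= tau -> cintegrable D0 (fun y => p y (tau + T) - p y tau).
  by move=> tau0; apply: cintegrableB => //; apply: tame_section; lra.
exists N; last first.
  move=> l tau l0 tau0.
  rewrite -half_fourierB //; [|by apply: tame_section; lra|exact: tame_section].
  by apply: half_fourier_le => //; exact: iinc.
apply: integrableZ_real => //.
pose k (q : R * R) := normc (p `|q.1| (`|q.2| + T) - p `|q.1| `|q.2|).
have mk : measurable_fun setT k.
  apply: measurable_normc; apply: cmeasurableB => //.
  have -> : (fun q : R * R => p `|q.1| (`|q.2| + T)) =
      (fun q : R * R => p `|q.1| `| `|q.2| + T|).
    by apply/funext => q; rewrite [ `| _ + T| ]ger0_norm // addr_ge0 // ltW.
  apply: (@cmeasurable_comp _ _ _ (R * R)%type (R * R)%type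
    (fun q : R * R => p `|q.1| `|q.2|) (fun z => (z.1, `|z.2| + T)) setT mp).
  apply: measurable_fun_pair => //.
  by apply: measurable_funD => //; apply: measurableT_comp.
pose K (q : R * R) : \bar R := (\1_D0 q.1 * (\1_D0 q.2 * k q))%:E.
have mK : measurable_fun setT K.
  apply/measurable_EFinP; apply: measurable_funM.
    by apply: measurableT_comp => //; exact: measurable_indic.
  apply: measurable_funM => //.
  by apply: measurableT_comp => //; exact: measurable_indic.
have K0 q : (0 <= K q)%E.
  by rewrite lee_fin !mulr_ge0 ?indic_ge0 ?normc_ge0.
have inner1 y : (\int[mu]_tau K (y, tau) =
    ((fun y => \int[mu]_(tau in D0) (normc (p y (tau + T)%R - p y tau))%:E) \_ D0) y)%E.
  rewrite /patch; case: ifPn => [yD|yD].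
    rewrite [RHS]integral_mkcond; apply: eq_integral => tau _.
    rewrite /K /patch /= !indicE yD mul1r; case: ifPn => [tauD|tauD].
      move: yD tauD; rewrite !inE /= !in_itv /= !andbT => y0 tau0.
      by rewrite mul1r /k /= (ger0_norm y0) (ger0_norm tau0).
    by rewrite mul0r.
  apply: integral0_eq => tau _; rewrite /K /= indicE (negbTE yD).
  by rewrite mul0r.
have inner2 tau : (\int[mu]_y K (y, tau) =
    ((fun tau => (\int[mu]_(y in D0) normc (p y (tau + T) - p y tau))%R%:E) \_ D0) tau)%E.
  rewrite /patch; case: ifPn => [tauD|tauD].
    have tau0 : 0 <= tau by move: tauD; rewrite inE /= in_itv /= andbT.
    transitivity (\int[mu]_(y in D0) (normc (p y (tau + T)%R - p y tau))%:E)%E.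
      rewrite [RHS]integral_mkcond; apply: eq_integral => y _.
      rewrite /K /patch /= !indicE tauD mul1r; case: ifPn => [yD|yD].
        move: yD; rewrite !inE /= !in_itv /= !andbT => y0.
        by rewrite mul1r /k /= (ger0_norm y0) (ger0_norm tau0).
      by rewrite mul0r.
    rewrite fineK //; apply: integrable_fin_num => //.
    exact: cintegrable_normc (iinc _ tau0).
  apply: integral0_eq => y _; rewrite /K /= !indicE (negbTE tauD).
  by rewrite mul0r mulr0.
have fin : (\int[mu]_tau \int[mu]_y K (y, tau) < +oo)%E.
  have -> : (\int[mu]_tau \int[mu]_y K (y, tau) =
      \int[mu]_y \int[mu]_tau K (y, tau))%E.
    exact/esym/(@fubini_tonelli _ _ _ _ _ mu mu K mK K0).
  under eq_integral => y _ do rewrite inner1.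
  by rewrite -integral_mkcond.
have mG : measurable_fun setT (fun tau => \int[mu]_y K (y, tau))%E.
  exact: (@measurable_fun_fubini_tonelli_G _ _ _ _ _ mu K mK K0).
move: fin; under eq_integral => tau _ do rewrite inner2.
rewrite -integral_mkcond => fin.
apply/integrableP; split.
  apply/(measurable_restrictT _ _).2 => //.
  by rewrite -(funext inner2).
under eq_integral => tau _.
  rewrite gee0_abs; last by rewrite lee_fin; apply: Rintegral_ge0 => y _; exact: normc_ge0.
  over.
exact: fin.
Qed.

End Tame.
End HalfFourier.

Section SecondDerivative.
Context {R : realType}.
Notation mu := (@lebesgue_measure R).
Notation D0 := (`[0%R, +oo[%classic : set R).

Lemma is_derive_near (g : R -> R) (x l : R) :
  (forall e, 0 < e -> \forall y \near x, y != x ->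
     `|(g y - g x) / (y - x) - l| < e) ->
  is_derive x (1 : R) g l.
Proof.
move=> gl.
have lim : (fun h => h^-1 *: ((g \o shift x) (h *: (1 : R)) - g x)) @ 0^' --> l.
  apply/cvgrPdist_lt => e e0; have /nbhs_ballP[r /= r0 xr] := gl e e0.
  rewrite near_withinE; apply/nbhs_ballP; exists r => //= h.
  rewrite /ball /= sub0r normrN => hr h0.
  have := xr (x + h); rewrite /ball /= opprD addNKr normrN => /(_ hr).
  rewrite -subr_eq0 addrAC subrr add0r => /(_ h0).
  by rewrite distrC /GRing.scale /= mulr1 [h + x]addrC mulrC.
by apply: DeriveDef; [exact: cvgP lim|exact: (cvg_lim _ lim)].
Qed.

(** At interior points the one-sided notion gives a genuine derivative. *)
Lemma is_derive_half (u : R -> R[i]) (x : R) : 0 < x -> half_derivable u x ->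
  is_derive x (1 : R) (fun y => Re (u `|y|)) (Re (half_derive u x)) /\
  is_derive x (1 : R) (fun y => Im (u `|y|)) (Im (half_derive u x)).
Proof.
move=> x0 ux.
have xpos : \forall y \near x, 0 < y by exact: lt_nbhsr.
have quot (y : R) : y != x -> (u y - u x) / (y - x)%:C =
    (Re (u y) - Re (u x)) / (y - x) +i* ((Im (u y) - Im (u x)) / (y - x)).
  move=> yx; have yx0 : y - x != 0 by rewrite subr_eq0.
  have yxC : (y - x)%:C != 0 by rewrite (inj_eq (@complexI R)).
  apply: (mulIf yxC); rewrite divfK //.
  by apply: complexP; rewrite ?ReM ?ImM ?ReB ?ImB /=; field.
split; apply: is_derive_near => e e0.
  apply: filterS2 xpos (half_derive_near ux e0) => y y0 ye yx.
  rewrite (gtr0_norm y0) (gtr0_norm x0).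
  apply: le_lt_trans (ye yx (ltW y0)); apply: le_trans (Re_le_normc _).
  by rewrite ReB /half_quotient quot.
apply: filterS2 xpos (half_derive_near ux e0) => y y0 ye yx.
rewrite (gtr0_norm y0) (gtr0_norm x0).
apply: le_lt_trans (ye yx (ltW y0)); apply: le_trans (Im_le_normc _).
by rewrite ImB /half_quotient quot.
Qed.

(** The integrand is the derivative of
    cos (l y) (a1 - l b0) + sin (l y) (b1 + l a0). *)
Lemma Rintegral_wave_by_parts (a0 a1 a2 b0 b1 b2 : R -> R) (l C : R) :
  continuous a0 -> continuous a1 -> continuous a2 ->
  continuous b0 -> continuous b1 -> continuous b2 ->
  (forall y : R, 0 < y -> is_derive y (1 : R) a0 (a1 y)) ->
  (forall y : R, 0 < y -> is_derive y (1 : R) a1 (a2 y)) ->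
  (forall y : R, 0 < y -> is_derive y (1 : R) b0 (b1 y)) ->
  (forall y : R, 0 < y -> is_derive y (1 : R) b1 (b2 y)) ->
  (forall y : R, 0 <= y -> [/\ `|a0 y| <= C / (1 + y ^+ 2),
     `|a1 y| <= C / (1 + y ^+ 2) & `|a2 y| <= C / (1 + y ^+ 2)]) ->
  (forall y : R, 0 <= y -> [/\ `|b0 y| <= C / (1 + y ^+ 2),
     `|b1 y| <= C / (1 + y ^+ 2) & `|b2 y| <= C / (1 + y ^+ 2)]) ->
  \int[mu]_(y in D0) (cos (l * y) * (a2 y + l ^+ 2 * a0 y) +
                      sin (l * y) * (b2 y + l ^+ 2 * b0 y)) = l * b0 0 - a1 0.
Proof.
move=> ca0 ca1 ca2 cb0 cb1 cb2 da0 da1 db0 db1 aC bC.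
pose F y := cos (l * y) * (a1 y + - l * b0 y) + sin (l * y) * (b1 y + l * a0 y).
pose f y := cos (l * y) * (a2 y + l ^+ 2 * a0 y) + sin (l * y) * (b2 y + l ^+ 2 * b0 y).
have cos1 (y : R) : `|cos y| <= 1 by rewrite ler_norml cos_geN1 cos_le1.
have sin1 (y : R) : `|sin y| <= 1 by rewrite ler_norml sin_geN1 sin_le1.
have id y : is_derive y (1 : R) (fun y : R => y) 1 by exact: is_derive_id.
have dcos y : is_derive y (1 : R) (fun y => cos (l * y)) (- sin (l * y) * (l * 1)).
  exact: (@is_derive1_comp _ cos (fun y => l * y) _ _ _ (is_derive_cos _)
    (is_derive_mulcf l (id y))).
have dsin y : is_derive y (1 : R) (fun y => sin (l * y)) (cos (l * y) * (l * 1)).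
  exact: (@is_derive1_comp _ sin (fun y => l * y) _ _ _ (is_derive_sin _)
    (is_derive_mulcf l (id y))).
have ccos : continuous (fun y => cos (l * y)).
  by move=> y; exact: (is_derive_continuous (dcos y)).
have csin : continuous (fun y => sin (l * y)).
  by move=> y; exact: (is_derive_continuous (dsin y)).
have comb (k : R) (g1 g2 : R -> R) : continuous g1 -> continuous g2 ->
    continuous (fun y => g1 y + k * g2 y).
  move=> c1 c2 y; apply: cvgD; first exact: c1.
  by apply: cvgM; [exact: cvg_cst|exact: c2].
have cF : continuous F.
  move=> y; apply: cvgD; apply: cvgM; [exact: ccos|exact: comb|exact: csin|exact: comb].
have cf : continuous f.
  move=> y; apply: cvgD; apply: cvgM; [exact: ccos|exact: comb|exact: csin|exact: comb].
have norm_comb (k w x y B : R) : `|w| <= 1 -> `|x| <= B -> `|y| <= B ->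
    `|w * (x + k * y)| <= (1 + `|k|) * B.
  move=> w1 xB yB; rewrite normrM -[leRHS]mul1r; apply: ler_pM => //.
  apply: le_trans (ler_normD _ _) _; rewrite mulrDl mul1r; apply: lerD => //.
  by rewrite normrM; apply: ler_wpM2l.
have -> : l * b0 0 - a1 0 = 0 - F 0.
  by rewrite /F !mulr0 cos0 sin0; ring.
apply: (@Rintegral_exhaustion _ D0 (fun=> 0) (fun n => n.+1%:R) F f) => //.
- by move=> n; apply: subset_itvl.
- move=> y; rewrite /= in_itv /= andbT => y0; exists (Num.truncn y) => // n /= ny.
  rewrite y0 /=; apply: le_trans (ltW (truncnS_gt _)) _.
  by rewrite ler_nat.
- move=> n y /andP[y0 _].
  have h1 := is_derive_mulf (dcos y)
    (is_derive_addf (da1 y y0) (is_derive_mulcf (- l) (db0 y y0))).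
  have h2 := is_derive_mulf (dsin y)
    (is_derive_addf (db1 y y0) (is_derive_mulcf l (da0 y y0))).
  by apply: (is_derive_eq (is_derive_addf h1 h2)); rewrite /f; ring.
- apply: (le_integrable_real _ _ (integrable_lorentz_half
    ((1 + `|l ^+ 2|) * C + (1 + `|l ^+ 2|) * C))) => //.
    apply: measurable_funTS; exact: continuous_measurable_fun.
  move=> y; rewrite /= in_itv /= andbT => y0.
  have [aC0 aC1 aC2] := aC y y0; have [bC0 bC1 bC2] := bC y y0.
  apply: le_trans (ler_normD _ _) _; rewrite mulrDl -[(1 + _) * C * _]mulrA; apply: lerD.
    exact: (norm_comb _ _ _ _ _ (cos1 _) aC2 aC0).
  exact: (norm_comb _ _ _ _ _ (sin1 _) bC2 bC0).
- apply: cvgB; last exact: cvg_cst.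
  apply/cvgr0Pnorm_le => eps eps0.
  pose c := (1 + `|l|) * C + (1 + `|l|) * C.
  have Fc n : `|F n.+1%:R| <= `|c| * n.+1%:R^-1.
    have n0 : 0 <= n.+1%:R :> R by exact: ler0n.
    have [aC0 aC1 aC2] := aC _ n0; have [bC0 bC1 bC2] := bC _ n0.
    have Wn : (1 + n.+1%:R ^+ 2)^-1 <= n.+1%:R^-1 :> R.
      rewrite lef_pV2 ?posrE // -?invr_gt0 ?lorentz_gt0 //.
      by have := sqr_ge0 (n.+1%:R - 1 : R); rewrite !expr2; lra.
    apply: (@le_trans _ _ (c * (1 + n.+1%:R ^+ 2)^-1)).
      rewrite /c mulrDl -[(1 + _) * C * _]mulrA; apply: le_trans (ler_normD _ _) _; apply: lerD.
        by rewrite -[`|l|]normrN; exact: (norm_comb _ _ _ _ _ (cos1 _) aC1 bC0).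
      exact: (norm_comb _ _ _ _ _ (sin1 _) bC1 aC0).
    apply: le_trans (ler_wpM2r (ltW (lorentz_gt0 _)) (ler_norm c)) _.
    exact: ler_wpM2l.
  have WO : `|c| * n.+1%:R^-1 @[n --> \oo] --> (0 : R).
    rewrite -[X in _ --> X](mulr0 `|c|); apply: cvgM; first exact: cvg_cst.
    exact: cvg_harmonic.
  move/cvgr0Pnorm_le : WO => /(_ _ eps0); apply: filterS => n.
  by apply: le_trans; apply: le_trans (Fc n) _; exact: ler_norm.
Qed.

(** Two integrations by parts express the transform of u'' by - l ^ 2 times
    that of u and boundary terms.  Solving with 1 + l ^ 2 in place of l ^ 2
    avoids the singularity at l = 0, at the price of the transform of u on the
    right-hand side. *)
Lemma half_fourier_by_parts (u : R -> R[i]) (l C : R) :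
  (forall y : R, 0 <= y -> half_derivable u y) ->
  (forall y : R, 0 <= y -> half_derivable (half_derive u) y) ->
  (forall y : R, 0 <= y -> half_derivable (half_derive (half_derive u)) y) ->
  (forall y : R, 0 <= y -> [/\ normc (u y) <= C / (1 + y ^+ 2),
     normc (half_derive u y) <= C / (1 + y ^+ 2) &
     normc (half_derive (half_derive u) y) <= C / (1 + y ^+ 2)]) ->
  half_fourier u l%:C = ((1 + l ^+ 2)^-1)%:C *
    (half_fourier u l%:C - half_fourier (half_derive (half_derive u)) l%:C
     - half_derive u 0 - 'i%C * l%:C * u 0).
Proof.
move=> d0 d1 d2 uC.
set u1 := half_derive u; set u2 := half_derive u1.
have mD0 (v : R -> R[i]) : (forall y : R, 0 <= y -> half_derivable v y) ->
    cmeasurable D0 v.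
  move=> dv; apply: (@eq_cmeasurable _ _ R D0 (fun y : R => v `|y|)).
    by move=> y; rewrite /= in_itv /= andbT => y0; rewrite (ger0_norm y0).
  exact/cmeasurableT/cmeasurable_half.
have i0 : cintegrable D0 u.
  by apply: (@cintegrable_lorentz _ u C (mD0 _ d0)) => y /uC[].
have i2 : cintegrable D0 u2.
  by apply: (@cintegrable_lorentz _ u2 C (mD0 _ d2)) => y /uC[].
have Im0 : Im l%:C <= 0 by [].
have f0 := cintegrable_fourier Im0 i0; have f2 := cintegrable_fourier Im0 i2.
have key : half_fourier u2 l%:C + (l ^+ 2)%:C * half_fourier u l%:C =
    - (u1 0 + 'i%C * l%:C * u 0).
  rewrite /half_fourier -cintegralZ // -cintegralD //; last exact: cintegrableZ.
  have [r0 m0] := continuous_half d0; have [r1 m1] := continuous_half d1.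
  have [r2 m2] := continuous_half d2.
  have phase y : cexp (- 'i%C * l%:C * y%:C) = cos (l * y) -i* sin (l * y).
    have E : - 'i%C * l%:C * y%:C = 0 +i* (- (l * y)) by apply: complexP => /=; ring.
    by rewrite E /cexp /= expR0 cosN sinN; apply: complexP => /=; ring.
  have dN (g : R -> R) y a : is_derive y (1 : R) g a ->
      is_derive y (1 : R) (fun y => - g y) (- a).
    by move=> ga; exact: is_deriveN.
  have cN (g : R -> R) : continuous g -> continuous (fun y => - g y).
    by move=> cg y; apply: cvgN; exact: cg.
  have u1E y : 0 < y -> u1 y = u1 `|y| by move=> y0; rewrite gtr0_norm.
  have u2E y : 0 < y -> u2 y = u2 `|y| by move=> y0; rewrite gtr0_norm.
  have bRe (v : R -> R[i]) y : 0 <= y -> normc (v y) <= C / (1 + y ^+ 2) ->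
      `|Re (v `|y|)| <= C / (1 + y ^+ 2).
    by move=> y0; rewrite (ger0_norm y0); apply: le_trans; exact: Re_le_normc.
  have bIm (v : R -> R[i]) y : 0 <= y -> normc (v y) <= C / (1 + y ^+ 2) ->
      `|Im (v `|y|)| <= C / (1 + y ^+ 2).
    by move=> y0; rewrite (ger0_norm y0); apply: le_trans; exact: Im_le_normc.
  have dr0 (y : R) : 0 < y -> is_derive y (1 : R) (fun y => Re (u `|y|)) (Re (u1 `|y|)).
    by move=> y0; rewrite -u1E //; exact: (is_derive_half y0 (d0 _ (ltW y0))).1.
  have dr1 (y : R) : 0 < y -> is_derive y (1 : R) (fun y => Re (u1 `|y|)) (Re (u2 `|y|)).
    by move=> y0; rewrite -u2E //; exact: (is_derive_half y0 (d1 _ (ltW y0))).1.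
  have dm0 (y : R) : 0 < y -> is_derive y (1 : R) (fun y => Im (u `|y|)) (Im (u1 `|y|)).
    by move=> y0; rewrite -u1E //; exact: (is_derive_half y0 (d0 _ (ltW y0))).2.
  have dm1 (y : R) : 0 < y -> is_derive y (1 : R) (fun y => Im (u1 `|y|)) (Im (u2 `|y|)).
    by move=> y0; rewrite -u2E //; exact: (is_derive_half y0 (d1 _ (ltW y0))).2.
  have rC (y : R) : 0 <= y -> [/\ `|Re (u `|y|)| <= C / (1 + y ^+ 2),
      `|Re (u1 `|y|)| <= C / (1 + y ^+ 2) & `|Re (u2 `|y|)| <= C / (1 + y ^+ 2)].
    by move=> y0; have [? ? ?] := uC y y0; split; exact: bRe.
  have mC (y : R) : 0 <= y -> [/\ `|Im (u `|y|)| <= C / (1 + y ^+ 2),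
      `|Im (u1 `|y|)| <= C / (1 + y ^+ 2) & `|Im (u2 `|y|)| <= C / (1 + y ^+ 2)].
    by move=> y0; have [? ? ?] := uC y y0; split; exact: bIm.
  have rNC (y : R) : 0 <= y -> [/\ `|- Re (u `|y|)| <= C / (1 + y ^+ 2),
      `|- Re (u1 `|y|)| <= C / (1 + y ^+ 2) & `|- Re (u2 `|y|)| <= C / (1 + y ^+ 2)].
    by rewrite !normrN; exact: rC.
  apply: complexP.
    have := Rintegral_wave_by_parts l r0 r1 r2 m0 m1 m2 dr0 dr1 dm0 dm1 rC mC.
    rewrite normr0 => wave; rewrite -[LHS]/(\int[mu]_(y in D0) _).
    transitivity (l * Im (u 0) - Re (u1 0)); last by rewrite ReN ReD !ReM /=; ring.
    rewrite -wave; apply: eq_Rintegral => y; rewrite inE /= in_itv /= andbT => y0.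
    by rewrite phase (ger0_norm y0) ReD !ReM /=; ring.
  have := Rintegral_wave_by_parts l m0 m1 m2 (cN _ r0) (cN _ r1) (cN _ r2) dm0 dm1
    (fun y y0 => dN _ _ _ (dr0 y y0)) (fun y y0 => dN _ _ _ (dr1 y y0)) mC rNC.
  rewrite normr0 => wave; rewrite -[LHS]/(\int[mu]_(y in D0) _).
  transitivity (l * - Re (u 0) - Im (u1 0)); last by rewrite ImN ImD !ImM !ReM /=; ring.
  rewrite -wave; apply: eq_Rintegral => y; rewrite inE /= in_itv /= andbT => y0.
  by rewrite phase (ger0_norm y0) ImD !ImM /=; ring.
have W0 : (1 + l ^+ 2)%:C != 0.
  by rewrite (inj_eq (@complexI R)) gt_eqF // ltr_pwDl // sqr_ge0.
apply: (mulfI W0); rewrite mulrA -rmorphM mulfV ?mul1r; last first.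
  by rewrite gt_eqF // ltr_pwDl // sqr_ge0.
rewrite rmorphD mulrDl rmorph1 !mul1r.
have -> : (l ^+ 2)%:C * half_fourier u l%:C =
    - (u1 0 + 'i%C * l%:C * u 0) - half_fourier u2 l%:C.
  by rewrite -key; ring.
by ring.
Qed.

End SecondDerivative.

(** * The integrals over the boundary curve *)

Section PolynomialBounds.
Context {R : realType}.
Implicit Types F G : R -> R[i].

Definition poly_bounded F :=
  exists C k, 0 <= C /\ forall a : R, normc (F a) <= C * (1 + a ^+ 2) ^+ k.

Let X_ge1 (a : R) : 1 <= 1 + a ^+ 2.
Proof. by rewrite lerDl sqr_ge0. Qed.

Lemma poly_bounded_le F (C : R) k :
  (forall a, normc (F a) <= C * (1 + a ^+ 2) ^+ k) -> poly_bounded F.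
Proof.
move=> FC; exists `|C|, k; split => // a; apply: le_trans (FC a) _.
apply: ler_wpM2r; last exact: ler_norm.
by rewrite exprn_ge0 // (le_trans ler01).
Qed.

Lemma poly_bounded_cst (c : R[i]) : poly_bounded (fun=> c).
Proof. by apply: (@poly_bounded_le _ (normc c) 0) => a; rewrite expr0 mulr1. Qed.

Lemma poly_boundedM F G :
  poly_bounded F -> poly_bounded G -> poly_bounded (fun a => F a * G a).
Proof.
move=> [C [k [C0 FC]]] [C' [k' [C'0 GC]]].
apply: (@poly_bounded_le _ (C * C') (k + k')) => a.
by rewrite normcM exprD mulrACA; apply: ler_pM; rewrite ?normc_ge0.
Qed.

Lemma poly_boundedD F G :
  poly_bounded F -> poly_bounded G -> poly_bounded (fun a => F a + G a).
Proof.
move=> [C [k [C0 FC]]] [C' [k' [C'0 GC]]].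
apply: (@poly_bounded_le _ (C + C') (k + k')) => a.
apply: le_trans (normcD _ _) _; rewrite mulrDl; apply: lerD.
  apply: le_trans (FC a) _; apply: ler_wpM2l => //.
  by apply: ler_weXn2l => //; exact: leq_addr.
apply: le_trans (GC a) _; apply: ler_wpM2l => //.
by apply: ler_weXn2l => //; exact: leq_addl.
Qed.

Lemma poly_boundedN F : poly_bounded F -> poly_bounded (fun a => - F a).
Proof.
by move=> [C [k [C0 FC]]]; exists C, k; split => // a; rewrite normcN.
Qed.

(** Splitting exp (- c |a|) into k + 1 equal factors, each absorbs one factor
    1 + a ^ 2. *)
Lemma poly_bounded_exp F (c : R) : 0 < c -> poly_bounded F ->
  exists2 C, 0 <= C &
  forall a : R, normc (F a) * expR (- (c * `|a|)) <= C * (1 + a ^+ 2)^-1.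
Proof.
move=> c0 [C [k [C0 FC]]].
pose c1 := c / k.+1%:R.
have c10 : 0 < c1 by rewrite divr_gt0.
pose A := 1 + 2 * c1 ^- 2.
have A0 : 0 <= A by rewrite addr_ge0 // mulr_ge0 // invr_ge0 exprn_ge0 // ltW.
have base (a : R) : 1 + a ^+ 2 <= A * expR (c1 * `|a|).
  have ca : 0 <= c1 * `|a| by rewrite mulr_ge0 // ltW.
  have := expR_ge1Dxn 1 ca; rewrite exprMn real_normK ?num_real // => e1.
  apply: le_trans (ler_wpM2l A0 e1).
  have -> : A * (1 + c1 ^+ 2 * a ^+ 2 / 2`!%:R) =
      1 + a ^+ 2 + (2 * c1 ^- 2 + c1 ^+ 2 * a ^+ 2 / 2).
    by rewrite /A /factorial /=; field; rewrite gt_eqF.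
  rewrite lerDl; apply: addr_ge0.
    by apply: mulr_ge0 => //; rewrite invr_ge0 sqr_ge0.
  by apply: divr_ge0 => //; apply: mulr_ge0; exact: sqr_ge0.
exists (C * A ^+ k.+1); first by rewrite mulr_ge0 // exprn_ge0.
move=> a; have X0 : 0 < 1 + a ^+ 2 by rewrite ltr_pwDl // sqr_ge0.
rewrite ler_pdivlMr // expRN mulrAC ler_pdivrMr ?expR_gt0 //.
have ce : expR (c * `|a|) = expR (c1 * `|a|) ^+ k.+1.
  by rewrite -expRM_natl; congr expR; rewrite /c1; field.
rewrite ce -mulrA -exprMn.
apply: le_trans (ler_wpM2r (ltW X0) (FC a)) _.
rewrite -mulrA -exprSr; apply: ler_wpM2l => //.
by apply: lerXn2r; rewrite ?nnegrE ?mulr_ge0 ?expR_ge0 // ltW.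
Qed.

End PolynomialBounds.

Section BoundaryBranch.
Context {R : realType} (alpha beta sigma : R).
Notation mu := (@lebesgue_measure R).
Notation D0 := (`[0%R, +oo[%classic : set R).
Hypothesis alpha_gt0 : 0 < alpha.
Hypothesis beta_gt0 : 0 < beta.
Hypothesis sigma2 : sigma ^+ 2 = 1.

Let h := height alpha beta sigma.

Definition branch (a : R) : R[i] := a +i* h a.

Let w a := omega alpha beta (branch a).
Let rh a := rho alpha beta (branch a).

Lemma Re_rho_le0 (l : R[i]) : Re (rho alpha beta l) <= 0.
Proof.
rewrite /rho ReN oppr_le0 /sqrtc; case: (l ^+ 2 + (alpha / beta)%:C) => p q /=.
exact: sqrtr_ge0.
Qed.

Lemma rho_sqr (l : R[i]) : rho alpha beta l ^+ 2 = l ^+ 2 + (alpha / beta)%:C.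
Proof. by rewrite /rho sqrrN sqr_sqrtc. Qed.

(** This turns 1 / (i l - rho) into a polynomial expression in l and rho divided
    by 2 l ^ 2 + alpha / beta, which [denominator_ge] controls. *)
Lemma sum_diff_rho (l : R[i]) :
  ('i%C * l + rho alpha beta l) * ('i%C * l - rho alpha beta l) =
  - (2 * l ^+ 2 + (alpha / beta)%:C).
Proof.
have -> : ('i%C * l + rho alpha beta l) * ('i%C * l - rho alpha beta l) =
   'i%C ^+ 2 * l ^+ 2 - rho alpha beta l ^+ 2 by ring.
by rewrite rho_sqr sqr_i; ring.
Qed.

(** On the curve Re omega vanishes, and
    beta (2 l ^ 2 + alpha / beta) ^ 2 = 4 omega + alpha ^ 2 / beta: the
    denominators i l - rho stay away from 0. *)
Lemma denominator_ge (a : R) :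
  alpha / beta <= normc (2 * branch a ^+ 2 + (alpha / beta)%:C).
Proof.
have ab0 : 0 <= alpha / beta by rewrite divr_ge0 // ltW.
apply: ge0_sqr_le => //; first exact: normc_ge0.
rewrite -normcX; apply: le_trans (le_trans (ler_norm _) (Re_le_normc _)).
have -> : (2 * branch a ^+ 2 + (alpha / beta)%:C) ^+ 2 =
    (4 / beta)%:C * w a + ((alpha / beta) ^+ 2)%:C.
  rewrite /w /omega; have -> : (alpha / beta)%:C = alpha%:C / beta%:C :> R[i].
    by rewrite rmorphM fmorphV.
  have -> : (4 / beta)%:C = 4 / beta%:C :> R[i].
    by rewrite rmorphM fmorphV rmorph_nat.
  have -> : ((alpha / beta) ^+ 2)%:C = (alpha%:C / beta%:C) ^+ 2 :> R[i].
    by rewrite rmorphXn rmorphM fmorphV.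
  by field; rewrite (inj_eq (@complexI R)) gt_eqF.
rewrite ReD ReM (Re_omega_height alpha_gt0 beta_gt0 sigma2) /=.
by rewrite mulr0 mul0r subrr add0r.
Qed.

Let diff_neq0 a : 'i%C * branch a - rh a != 0.
Proof.
apply/eqP => d0; have := sum_diff_rho (branch a); rewrite -/(rh a) d0 mulr0.
move=> /esym/eqP; rewrite oppr_eq0 => /eqP e0.
have := denominator_ge a; rewrite e0 normc0.
by apply/negP; rewrite -ltNge divr_gt0.
Qed.

Let inv_diff a : ('i%C * branch a - rh a)^-1 =
  - ('i%C * branch a + rh a) / (2 * branch a ^+ 2 + (alpha / beta)%:C).
Proof.
have e := sum_diff_rho (branch a); rewrite -/(rh a) in e.
have d0 := diff_neq0 a.
have s0 : 2 * branch a ^+ 2 + (alpha / beta)%:C != 0.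
  apply/eqP => s0; have := denominator_ge a; rewrite s0 normc0.
  by apply/negP; rewrite -ltNge divr_gt0.
apply: (mulIf d0); rewrite mulVf // mulrAC mulNr e opprK.
by rewrite mulfV.
Qed.

Lemma poly_bounded_branch : poly_bounded branch.
Proof.
apply: (@poly_bounded_le _ _ (8 + alpha / beta) 1) => a; rewrite expr1.
apply: le_trans (normc_le_ReIm _) _ => /=.
rewrite (ger0_norm (height_ge0 _ _ _ _)).
have := height_le alpha_gt0 beta_gt0 sigma2 a; rewrite -/h.
have -> : (alpha + 6 * beta * a ^+ 2) / beta = alpha / beta + 6 * a ^+ 2.
  by field; rewrite gt_eqF.
have a2 := sqr_ge0 a.
have ab : 0 <= alpha / beta by rewrite divr_ge0 // ltW.
have aba := mulr_ge0 ab a2.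
have : `|a| <= 1 + a ^+ 2.
  by rewrite ler_norml; apply/andP; split; have := sqr_ge0 (a - 1);
    have := sqr_ge0 (a + 1); rewrite !expr2; lra.
by lra.
Qed.

Lemma poly_bounded_rho : poly_bounded rh.
Proof.
have [C [k [C0 bC]]] : poly_bounded (fun a => branch a ^+ 2 + (alpha / beta)%:C).
  apply: poly_boundedD; last exact: poly_bounded_cst.
  by under eq_fun do rewrite expr2; apply: poly_boundedM; exact: poly_bounded_branch.
apply: (@poly_bounded_le _ _ (1 + C) k) => a.
have X1 : 1 <= (1 + a ^+ 2) ^+ k by rewrite exprn_ege1 // lerDl sqr_ge0.
apply: (@le_trans _ _ (1 + normc (rh a) ^+ 2)).
  have := sqr_ge0 (normc (rh a) - 1); have := normc_ge0 (rh a); rewrite !expr2; lra.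
rewrite -normcX /rh rho_sqr mulrDl mul1r; apply: lerD => //.
Qed.

Lemma poly_bounded_inv_diff : poly_bounded (fun a => ('i%C * branch a - rh a)^-1).
Proof.
have -> : (fun a => ('i%C * branch a - rh a)^-1) = (fun a =>
    - ('i%C * branch a + rh a) * (2 * branch a ^+ 2 + (alpha / beta)%:C)^-1).
  by apply/funext => a; rewrite inv_diff.
apply: poly_boundedM.
  apply: poly_boundedN; apply: poly_boundedD; last exact: poly_bounded_rho.
  by apply: poly_boundedM; [exact: poly_bounded_cst|exact: poly_bounded_branch].
apply: (@poly_bounded_le _ _ (alpha / beta)^-1 0) => a.
rewrite expr0 mulr1 normcV lef_pV2 ?posrE ?divr_gt0 //.
  exact: denominator_ge.
by apply: lt_le_trans (denominator_ge a); rewrite divr_gt0.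
Qed.

Definition dbranch (a : R) : R[i] := 1 +i* derive1 h a.

Lemma poly_bounded_dbranch : poly_bounded dbranch.
Proof.
have [C hC] := derive1_height_le alpha_gt0 beta_gt0 sigma2.
apply: (@poly_bounded_le _ _ (1 + C) 0) => a; rewrite expr0 mulr1.
by apply: le_trans (normc_le_ReIm _) _; rewrite /= normr1 lerD2l.
Qed.

Lemma cmeasurable_branch : cmeasurable setT branch.
Proof. by apply: cmeasurable_complex => //; exact: measurable_height. Qed.

Lemma cmeasurable_dbranch : cmeasurable setT dbranch.
Proof.
by apply: cmeasurable_complex => //; exact: measurable_derive1_height.
Qed.

Lemma cmeasurable_omega_branch : cmeasurable setT w.
Proof.
apply: cmeasurableD; apply: cmeasurableM; try exact: cmeasurable_cst.
  exact/cmeasurableX/cmeasurable_branch.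
exact/cmeasurableX/cmeasurable_branch.
Qed.

Lemma cmeasurable_rho_branch : cmeasurable setT rh.
Proof.
apply: cmeasurableN; apply: cmeasurable_sqrtc => //.
apply: cmeasurableD; last exact: cmeasurable_cst.
exact/cmeasurableX/cmeasurable_branch.
Qed.

Lemma riemann_lebesgue_branch (G : R -> R[i]) : cintegrable setT G ->
  vanishing (fun s => cintegral setT (fun a => cexp (- (w a * s%:C)) * G a)).
Proof.
apply: (@riemann_lebesgue _ w (dphase alpha beta sigma)).
- by move=> a; exact: Re_omega_height.
- by move=> a a0; exact: is_derive_phase.
- by move=> a a0; exact: continuous_dphase.
- by move=> a a0; exact: dphase_neq0.
- by case: cmeasurable_omega_branch.
Qed.

Variable x : R.
Hypothesis x_gt0 : 0 < x.

Let wave a := cexp ('i%C * branch a * x%:C).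

Lemma cmeasurable_wave : cmeasurable setT wave.
Proof.
apply: cmeasurable_cexp; apply: cmeasurableM; last exact: cmeasurable_cst.
by apply: cmeasurableM; [exact: cmeasurable_cst|exact: cmeasurable_branch].
Qed.

(** The height grows at least linearly along the curve, so that the wave
    factor absorbs every polynomially bounded amplitude. *)
Lemma wave_poly_le (c : R -> R[i]) : poly_bounded c -> exists2 C, 0 <= C &
  forall a, normc (wave a) * normc (c a) <= C * (1 + a ^+ 2)^-1.
Proof.
move=> pc; have x3 : 0 < x / 3 by rewrite divr_gt0.
have [C C0 cC] := poly_bounded_exp x3 pc; exists C => // a.
apply: le_trans (cC a); rewrite mulrC; apply: ler_wpM2l; first exact: normc_ge0.
rewrite normc_cexp ler_expR.
have -> : Re ('i%C * branch a * x%:C) = - (h a * x) by rewrite /branch /=; ring.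
rewrite lerN2; have := height_ge_norm alpha_gt0 beta_gt0 sigma2 a; rewrite -/h => ah.
have -> : x / 3 * `|a| = `|a| / 3 * x by ring.
by apply: ler_wpM2r => //; exact: ltW.
Qed.

Lemma wave_pair_le (c1 c2 : R -> R[i]) : poly_bounded c1 -> poly_bounded c2 ->
  exists2 C, 0 <= C & forall a (z1 z2 : R[i]) M, normc z1 <= M -> normc z2 <= M ->
    normc (wave a * (c1 a * z1 - c2 a * z2)) <= C * (1 + a ^+ 2)^-1 * M.
Proof.
move=> /wave_poly_le[C1 C10 c1C] /wave_poly_le[C2 C20 c2C].
exists (C1 + C2); first exact: addr_ge0.
move=> a z1 z2 M z1M z2M.
rewrite mulrBr; apply: le_trans (normcB _ _) _.
rewrite mulrDl mulrDl; apply: lerD; rewrite mulrA normcM normcM;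
  by apply: ler_pM; rewrite ?mulr_ge0 ?normc_ge0.
Qed.

(** After absorption of the coefficients by the wave, this is the
    Riemann-Lebesgue lemma on the curve. *)
Lemma boundary_data_vanishing (c1 c2 z1 z2 : R -> R[i]) (M : R) :
  poly_bounded c1 -> poly_bounded c2 ->
  cmeasurable setT c1 -> cmeasurable setT c2 ->
  cmeasurable setT z1 -> cmeasurable setT z2 ->
  (forall a, normc (z1 a) <= M) -> (forall a, normc (z2 a) <= M) ->
  vanishing (fun t => cintegral setT (fun a =>
    cexp ('i%C * branch a * x%:C - w a * t%:C) * (c1 a * z1 a - c2 a * z2 a))).
Proof.
move=> p1 p2 mc1 mc2 mz1 mz2 z1M z2M.
have [C C0 CM] := wave_pair_le p1 p2.
have iG : cintegrable setT (fun a => wave a * (c1 a * z1 a - c2 a * z2 a)).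
  apply: (cintegrable_le (B := fun a => M * (C * (1 + a ^+ 2)^-1))) => //.
  - apply: cmeasurableM; first exact: cmeasurable_wave.
    by apply: cmeasurableB; exact: cmeasurableM.
  - by do 2!apply: integrableZ_real => //; exact: integrable_lorentz.
  - by move=> a _; rewrite [leRHS]mulrC; exact: CM.
rewrite (_ : (fun t => _) = fun t => cintegral setT (fun a =>
    cexp (- (w a * t%:C)) * (wave a * (c1 a * z1 a - c2 a * z2 a)))).
  exact: riemann_lebesgue_branch iG.
apply/funext => t; apply: eq_cintegral => a _.
by rewrite [RHS]mulrA; congr (_ * _); rewrite [RHS]mulrC -cexpD.
Qed.

Lemma boundary_duhamel_vanishing (T : R) (c1 c2 : R -> R[i])
    (v1 v2 : R -> R -> R[i]) (N1 N2 : R -> R) : 0 < T ->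
  poly_bounded c1 -> poly_bounded c2 ->
  cmeasurable setT c1 -> cmeasurable setT c2 ->
  cmeasurable setT (fun p : R * R => v1 p.1 p.2) ->
  cmeasurable setT (fun p : R * R => v2 p.1 p.2) ->
  (forall t, 0 < t -> exists2 M, 0 <= M &
     forall a tau, 0 <= tau <= t -> normc (v1 a tau) <= M) ->
  (forall t, 0 < t -> exists2 M, 0 <= M &
     forall a tau, 0 <= tau <= t -> normc (v2 a tau) <= M) ->
  (forall a tau, 0 <= tau -> normc (v1 a (tau + T) - v1 a tau) <= N1 tau) ->
  (forall a tau, 0 <= tau -> normc (v2 a (tau + T) - v2 a tau) <= N2 tau) ->
  mu.-integrable D0 (fun tau => (N1 tau)%:E) ->
  mu.-integrable D0 (fun tau => (N2 tau)%:E) ->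
  let I t := cintegral setT (fun a => cexp ('i%C * branch a * x%:C - w a * t%:C) *
    (c1 a * time_transform (v1 a) (w a) t - c2 a * time_transform (v2 a) (w a) t)) in
  vanishing (fun t => I (t + T) - I t).
Proof.
move=> T0 p1 p2 mc1 mc2 mv1 mv2 v1M v2M v1N v2N iN1 iN2 I.
have [C C0 CM] := wave_pair_le p1 p2.
pose V a tau := wave a * (c1 a * v1 a tau - c2 a * v2 a tau).
have mV : cmeasurable setT (fun p : R * R => V p.1 p.2).
  have fst_comp (F : R -> R[i]) : cmeasurable setT F ->
      cmeasurable setT (fun p : R * R => F p.1).
    by move=> mF; exact: (cmeasurable_comp (g := fst) mF).
  apply: cmeasurableM; first exact/fst_comp/cmeasurable_wave.
  by apply: cmeasurableB; apply: cmeasurableM => //; exact: fst_comp.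
have wge0 a : 0 <= Re (w a) by rewrite /w (Re_omega_height alpha_gt0 beta_gt0 sigma2).
have IE t : 0 < t -> I t = cintegral setT (fun a => cintegral `[0, t[
    (fun tau => cexp (- (w a * (t - tau)%:C)) * V a tau)).
  move=> t0; have [M1 M10 v1Mt] := v1M t t0; have [M2 M20 v2Mt] := v2M t t0.
  apply: eq_cintegral => a _; apply: duhamel_transform.
    apply: (@cintegrable_time _ _ _ _ M1) => [|tau]; last exact: v1Mt.
    apply: cmeasurableT; exact: (cmeasurable_comp (g := pair a) mv1).
  apply: (@cintegrable_time _ _ _ _ M2) => [|tau]; last exact: v2Mt.
  apply: cmeasurableT; exact: (cmeasurable_comp (g := pair a) mv2).
have := @duhamel_L1_vanishing _ w V T cmeasurable_omega_branch wge0 mV T0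
  (fun a => C * (1 + a ^+ 2)^-1) (fun tau => N1 tau + N2 tau).
move=> van; apply: (near_eq_vanishing _ (van _ _ _ _ _ _)).
- near=> t; have t0 : 0 < t by near: t; apply: nbhs_pinfty_gt; exact: num_real.
  by rewrite !IE // addr_gt0.
- by move=> a; rewrite mulr_ge0 // ltW // lorentz_gt0.
- by apply: integrableZ_real => //; exact: integrable_lorentz.
- move=> t t0; have [M1 M10 v1Mt] := v1M t t0; have [M2 M20 v2Mt] := v2M t t0.
  exists (M1 + M2); first exact: addr_ge0.
  move=> a tau taut; apply: CM.
    by apply: le_trans (v1Mt a tau taut) _; rewrite lerDl.
  by apply: le_trans (v2Mt a tau taut) _; rewrite lerDr.
- move=> a tau tau0.
  have -> : V a (tau + T) - V a tau = wave a *
      (c1 a * (v1 a (tau + T) - v1 a tau) - c2 a * (v2 a (tau + T) - v2 a tau)).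
    by rewrite /V; ring.
  have n1 := v1N a tau tau0; have n2 := v2N a tau tau0.
  have N10 := le_trans (normc_ge0 _) n1; have N20 := le_trans (normc_ge0 _) n2.
  apply: CM.
    by apply: le_trans n1 _; rewrite lerDl.
  by apply: le_trans n2 _; rewrite lerDr.
- exact: integrableD_real.
- exact: riemann_lebesgue_branch.
Unshelve. all: by end_near. Qed.

End BoundaryBranch.

(** * The forcing term on the real line *)

Section LineTerm.
Context {R : realType} (alpha beta x T : R).
Notation mu := (@lebesgue_measure R).
Notation D0 := (`[0%R, +oo[%classic : set R).
Hypothesis alpha_gt0 : 0 < alpha.
Hypothesis beta_gt0 : 0 < beta.
Hypothesis x_gt0 : 0 < x.
Hypothesis T_gt0 : 0 < T.

Let w (a : R) := omega alpha beta a%:C.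
Let wave (a : R) := cexp ('i%C * a%:C * x%:C).

Lemma cmeasurable_line_omega : cmeasurable setT w.
Proof.
have mid : cmeasurable setT (fun a : R => a%:C).
  by apply: cmeasurable_real; exact: measurable_id.
by apply: cmeasurableD; apply: cmeasurableM;
  try exact: cmeasurable_cst; exact: cmeasurableX.
Qed.

Lemma cmeasurable_line_wave : cmeasurable setT wave.
Proof.
apply: cmeasurable_cexp; apply: cmeasurableM; last exact: cmeasurable_cst.
apply: cmeasurableM; first exact: cmeasurable_cst.
by apply: cmeasurable_real; exact: measurable_id.
Qed.

Lemma normc_line_wave (a : R) : normc (wave a) = 1.
Proof.
rewrite normc_cexp (_ : Re _ = 0) ?expR0 //.
by rewrite /=; ring.
Qed.

Lemma line_data_vanishing (G : R -> R[i]) (M : R) : cmeasurable setT G ->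
  (forall a, normc (G a) <= M) ->
  vanishing (fun t => cintegral setT (fun a =>
    cexp ('i%C * a%:C * x%:C - w a * t%:C) * G a)).
Proof.
move=> mG GM.
have M0 : 0 <= M by apply: le_trans (GM 0); exact: normc_ge0.
have [C C0 dec] := line_decay alpha_gt0 beta_gt0 M0.
have [|a|_ van] := dec (fun a => wave a * G a).
- by apply: cmeasurableM => //; exact: cmeasurable_line_wave.
- by rewrite normcM normc_line_wave mul1r.
rewrite (_ : (fun t => _) = fun t => cintegral setT
    (fun a => cexp (- (w a * t%:C)) * (wave a * G a))); first exact: van.
apply/funext => t; apply: eq_cintegral => a _.
by rewrite [RHS]mulrA; congr (_ * _); rewrite [RHS]mulrC -cexpD.
Qed.

(** The transform v of the forcing term is bounded but need not be integrable
    in the frequency a.  Its expansion splits the increment over a period into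
    an integrable part and the boundary trace b0, which is paired with the
    kernel of [trace_kernel_le], bounded uniformly in time. *)
Lemma line_duhamel_vanishing (v v2 : R -> R -> R[i]) (b0 b1 : R -> R[i])
    (N N2 n0 n1 : R -> R) :
  cmeasurable setT (fun p : R * R => v p.1 p.2) ->
  (forall tau, cmeasurable setT (v2 ^~ tau)) ->
  (forall t, 0 < t -> exists2 M, 0 <= M &
     forall a tau, 0 <= tau <= t -> normc (v a tau) <= M) ->
  (forall a tau, 0 <= tau -> v a tau = ((1 + a ^+ 2)^-1)%:C *
     (v a tau - v2 a tau - b1 tau - 'i%C * a%:C * b0 tau)) ->
  (forall a tau, 0 <= tau -> normc (v a (tau + T) - v a tau) <= N tau) ->
  (forall a tau, 0 <= tau -> normc (v2 a (tau + T) - v2 a tau) <= N2 tau) ->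
  (forall tau, 0 <= tau -> normc (b0 (tau + T) - b0 tau) <= n0 tau) ->
  (forall tau, 0 <= tau -> normc (b1 (tau + T) - b1 tau) <= n1 tau) ->
  mu.-integrable D0 (fun tau => (N tau)%:E) ->
  mu.-integrable D0 (fun tau => (N2 tau)%:E) ->
  mu.-integrable D0 (fun tau => (n0 tau)%:E) ->
  mu.-integrable D0 (fun tau => (n1 tau)%:E) ->
  let I t := cintegral setT (fun a =>
    cexp ('i%C * a%:C * x%:C - w a * t%:C) * time_transform (v a) (w a) t) in
  vanishing (fun t => I (t + T) - I t).
Proof.
move=> mv mv2 vM v_id vN v2N b0n b1n iN iN2 in0 in1 I.
pose W (a : R) := (1 + a ^+ 2)^-1.
pose V a tau := wave a * v a tau.
pose E s a := cexp (- (w a * s%:C)).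
have mV : cmeasurable setT (fun p : R * R => V p.1 p.2).
  by apply: cmeasurableM => //; exact: (cmeasurable_comp (g := fst) cmeasurable_line_wave).
have wE a : Re (w a) = romega alpha beta a by rewrite /w omega_real.
have wge0 a : 0 <= Re (w a) by rewrite wE; exact: romega_ge0.
have mVs tau : cmeasurable setT (V ^~ tau) := cmeasurable_section mV tau.
have normV a tau : normc (V a tau) = normc (v a tau).
  by rewrite normcM normc_line_wave mul1r.
have IE t : 0 < t -> I t = cintegral setT (fun a => cintegral `[0, t[
    (fun tau => cexp (- (w a * (t - tau)%:C)) * V a tau)).
  move=> t0; have [M M0 vMt] := vM t t0.
  apply: eq_cintegral => a _.
  have iv : cintegrable `[0, t] (fun tau => cexp (w a * tau%:C) * v a tau).
    apply: (@cintegrable_time _ _ _ _ M) => [|tau]; last exact: vMt.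
    apply: cmeasurableT; exact: (cmeasurable_comp (g := pair a) mv).
  have := duhamel_transform ('i%C * a%:C * x%:C) 1 0 iv iv.
  rewrite mul1r mul0r subr0 => ->; apply: eq_cintegral => tau _.
  by rewrite mul1r mul0r subr0.
have [MT MT0 vMT] := vM T T_gt0.
have [CM CM0 dec] := line_decay alpha_gt0 beta_gt0 MT0.
have [CK CK0 kern] := trace_kernel_le alpha_gt0 beta_gt0 x_gt0.
pose CW := 2 * \int[mu]_a W a.
have van := @duhamel_vanishing _ w V T cmeasurable_line_omega wge0 mV T_gt0 CM
  (fun tau => CW * (N tau + N2 tau + n1 tau) + CK * n0 tau).
apply: (near_eq_vanishing _ (van _ _ _ _ _)).
- near=> t; have t0 : 0 < t by near: t; apply: nbhs_pinfty_gt; exact: num_real.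
  by rewrite !IE // addr_gt0.
- move=> t t0; have [M M0 vMt] := vM t t0.
  exists (fun=> M); split => //.
    by move=> a tau taut; rewrite normV; exact: vMt.
  have iW : mu.-integrable setT (fun a => (M * (1 + alpha^-1) * W a)%:E).
    by apply: integrableZ_real => //; exact: integrable_lorentz.
  apply: (le_integrable_real _ _ iW) => //.
    apply: measurable_funM => //; apply: measurable_invr.
    by apply: measurable_funD => //; case: cmeasurable_line_omega.
  move=> a _; have wa := wge0 a.
  rewrite ger0_norm; last by rewrite divr_ge0 // addr_ge0.
  rewrite -mulrA; apply: ler_wpM2l => //.
  have a2 := sqr_ge0 a; have aV : 0 <= alpha^-1 by rewrite invr_ge0 ltW.
  rewrite ler_pdivlMr ?ltr_pwDl // mulrC ler_pdivrMr ?ltr_pwDl // wE.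
  apply: (@le_trans _ _ ((1 + alpha^-1) * (1 + alpha * a ^+ 2))).
    have -> : (1 + alpha^-1) * (1 + alpha * a ^+ 2) =
        1 + a ^+ 2 + alpha * a ^+ 2 + alpha^-1 by field; rewrite gt_eqF.
    by have := mulr_ge0 (ltW alpha_gt0) a2; lra.
  by apply: ler_wpM2l; [rewrite addr_ge0|rewrite lerD2l; exact: romega_ge].
- move=> s tau s1 tauT; have [|d _] := dec (V ^~ tau) (mVs tau); last exact: d.
  by move=> a; rewrite normV; exact: vMT.
- move=> s tau s0 tau0; have tauT : 0 <= tau + T by have := T_gt0; lra.
  have [Cs Cs0 Es] := decay_lorentz alpha_gt0 beta_gt0 s0.
  have mE : cmeasurable setT (E s) := cmeasurable_decay cmeasurable_line_omega s.
  have normE a : normc (E s a) <= Cs * W a.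
    by rewrite /E cexp_decay_line normcR gtr0_norm ?expR_gt0 //; exact: Es.
  have normE1 a : normc (E s a) <= 1.
    by apply: normc_decay_le1 => //; exact: ltW.
  have iEb (G : R -> R[i]) M : cmeasurable setT G -> 0 <= M ->
      (forall a, normc (G a) <= M) -> cintegrable setT (fun a => E s a * G a).
    move=> mG M0 GM; apply: (cintegrable_le (B := fun a => M * (Cs * W a))) => //.
    - exact: cmeasurableM.
    - by do 2!apply: integrableZ_real => //; exact: integrable_lorentz.
    - by move=> a _; rewrite normcM [leRHS]mulrC; apply: ler_pM; rewrite ?normc_ge0.
  have iEV tau' : 0 <= tau' -> cintegrable setT (fun a => E s a * V a tau').
    move=> tau'0; have tau'1 : 0 < tau' + 1 by lra.
    have [M M0 vMt] := vM _ tau'1; apply: (iEb _ M) => // a.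
    by rewrite normV; apply: vMt; lra.
  pose d a := v a (tau + T) - v a tau - (v2 a (tau + T) - v2 a tau)
              - (b1 (tau + T) - b1 tau).
  pose B := N tau + N2 tau + n1 tau.
  have dB a : normc (d a) <= B.
    apply: le_trans (normcB _ _) _; apply: lerD; last exact: b1n.
    apply: le_trans (normcB _ _) _; apply: lerD; first exact: vN.
    exact: v2N.
  have md : cmeasurable setT d.
    apply: cmeasurableB; last exact: cmeasurable_cst.
    apply: cmeasurableB; first by apply: cmeasurableB; exact: cmeasurable_section.
    by apply: cmeasurableB.
  have B0 : 0 <= B := le_trans (normc_ge0 _) (dB 0).
  have W0 a : 0 < W a := lorentz_gt0 a.
  have W1 a : W a <= 1 by rewrite invf_le1 ?lerDl ?ltr_pwDl ?sqr_ge0.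
  have mW : cmeasurable setT (fun a : R => (W a)%:C).
    by apply: cmeasurable_real; apply: continuous_measurable_fun; exact: continuous_lorentz.
  have normA a : normc (wave a * ((W a)%:C * d a)) <= B * W a.
    rewrite normcM normc_line_wave mul1r normcM normcR gtr0_norm // [leRHS]mulrC.
    by apply: ler_wpM2l; [exact: ltW|exact: dB].
  have mA : cmeasurable setT (fun a => wave a * ((W a)%:C * d a)).
    apply: cmeasurableM; first exact: cmeasurable_line_wave.
    exact: cmeasurableM.
  have mK : cmeasurable setT (fun a => wave a * (a * W a)%:C).
    apply: cmeasurableM; first exact: cmeasurable_line_wave.
    apply: cmeasurable_real; apply: measurable_funM => //.
    by apply: continuous_measurable_fun; exact: continuous_lorentz.
  have normK a : normc (wave a * (a * W a)%:C) <= 1.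
    rewrite normcM normc_line_wave mul1r normcR normrM (gtr0_norm (W0 a)).
    rewrite ler_pdivrMr ?mul1r ?ltr_pwDl ?sqr_ge0 //.
    by rewrite ler_norml; apply/andP; split; have := sqr_ge0 (a - 1);
      have := sqr_ge0 (a + 1); rewrite !expr2; lra.
  have iA : cintegrable setT (fun a => E s a * (wave a * ((W a)%:C * d a))).
    apply: (iEb _ B) => // a; apply: le_trans (normA a) _.
    by rewrite -[leRHS]mulr1; apply: ler_wpM2l.
  have iK : cintegrable setT (fun a => E s a * (wave a * (a * W a)%:C)).
    exact: (iEb _ 1).
  have split_int : cintegral setT (fun a => E s a * V a (tau + T)) -
      cintegral setT (fun a => E s a * V a tau) =
      cintegral setT (fun a => E s a * (wave a * ((W a)%:C * d a))) -
      ('i%C * (b0 (tau + T) - b0 tau)) *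
      cintegral setT (fun a => E s a * (wave a * (a * W a)%:C)).
    rewrite -cintegralB //; try exact: iEV.
    rewrite -cintegralZ // -cintegralB //; last exact: cintegrableZ.
    apply: eq_cintegral => a _.
    rewrite /V (v_id a _ tauT) (v_id a _ tau0) /d rmorphM /= -/(W a); ring.
  rewrite split_int; apply: le_trans (normcB _ _) _; apply: lerD.
    rewrite /CW -/B mulrAC -mulrA -RintegralZl //; last exact: integrable_lorentz.
    apply: normc_cintegral_le => //.
    - exact: cmeasurableM.
    - by apply: integrableZ_real => //; exact: integrable_lorentz.
    - move=> a _; rewrite normcM -[leRHS]mul1r; apply: ler_pM;
        by rewrite ?normc_ge0.
  rewrite normcM normcM normc_imag mul1r mulrC; apply: ler_pM;
    rewrite ?normc_ge0 //; first exact: kern.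
  exact: b0n.
- apply: integrableD_real => //.
    apply: integrableZ_real => //; apply: integrableD_real => //.
    exact: integrableD_real.
  exact: integrableZ_real.
- move=> tau tau0; have tau1 : 0 < tau + 1 by lra.
  have [M M0 vMt] := vM _ tau1.
  have [C C0 decM] := line_decay alpha_gt0 beta_gt0 M0.
  have [|_ d] := decM (V ^~ tau) (mVs tau); last exact: d.
  by move=> a; rewrite normV; apply: vMt; lra.
Unshelve. all: by end_near. Qed.

End LineTerm.

(** * The data of the problem *)

Section Data.
Context {R : realType}.
Notation mu := (@lebesgue_measure R).
Notation D0 := (`[0%R, +oo[%classic : set R).

Lemma time_transform_normr (g : R -> R[i]) (w : R[i]) (t : R) :
  time_transform (fun tau => g `|tau|) w t = time_transform g w t.
Proof.
apply: eq_cintegral => tau; rewrite /= in_itv /= => /andP[tau0 _].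
by rewrite (ger0_norm tau0).
Qed.

(** Smoothness supplies the measurability that turns the finiteness of the
    integral into integrability. *)
Lemma weakly_periodic_integrable (T : R) (g : R -> R[i]) : 0 < T ->
  (forall tau, 0 <= tau -> half_derivable g tau) -> weakly_periodic T g ->
  mu.-integrable D0 (fun tau => (normc (g (tau + T) - g tau))%:E).
Proof.
move=> T0 dg wg; apply/integrableP; split.
  have mg := cmeasurable_half dg.
  apply/measurable_EFinP; apply: measurable_normc.
  apply: (@eq_cmeasurable _ _ R D0 (fun tau : R => g `|tau + T| - g `|tau|)).
    move=> tau; rewrite /= in_itv /= andbT => tau0.
    by rewrite (ger0_norm tau0) ger0_norm // addr_ge0 // ltW.
  apply: cmeasurableB; last exact: cmeasurableT.
  apply: cmeasurableT; apply: (cmeasurable_comp (g := fun tau : R => tau + T) mg).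
  exact: measurable_funD.
move: wg; rewrite /weakly_periodic; under eq_integral => tau _.
  rewrite -[X in X%:E]ger0_norm ?normc_ge0 //; over.
exact.
Qed.

Lemma lorentz_bound (I : Type) (A : set I) (x n : I -> R) :
  (forall i, 0 <= n i) ->
  has_ubound [set x i ^+ 0 * n i | i in A] ->
  has_ubound [set x i ^+ 2 * n i | i in A] ->
  exists2 C, 0 <= C & forall i, A i -> n i <= C * (1 + x i ^+ 2)^-1.
Proof.
move=> n0 [C1 C1n] [C2 C2n]; exists (`|C1| + `|C2|) => [|i Ai].
  by rewrite addr_ge0.
rewrite ler_pdivlMr ?ltr_pwDl ?sqr_ge0 // mulrDr mulr1 [n i * _]mulrC.
apply: lerD; apply: le_trans (ler_norm _).
  by rewrite -[leLHS]mul1r; apply: C1n; exists i.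
by apply: C2n; exists i.
Qed.

Lemma schwartz_tame (u : R -> R[i]) : half_schwartz u -> tame (fun y _ => u y).
Proof.
move=> [su bu]; split.
  have du : forall y, 0 <= y -> half_derivable u y by exact: (su 0%N).
  exact: (cmeasurable_comp (g := fst) (cmeasurable_half du)).
have [C C0 uC] := lorentz_bound (fun y => normc_ge0 (u y)) (bu 0%N 0%N) (bu 2%N 0%N).
move=> t _; exists C => // y tau y0 _; apply: uC.
by rewrite /= in_itv /= y0.
Qed.

Section Forcing.
Variable f : R -> R -> R[i].
Hypothesis f_smooth : quadrant_smooth f.
Hypothesis f_schwartz : loc_unif_schwartz f.

Lemma forcing_derivable (n : nat) (y tau : R) : 0 <= y -> 0 <= tau ->
  half_derivable (fun y => iter n partial_x f y tau) y /\
  half_derivable (iter n partial_x f y) tau.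
Proof.
move=> y0 tau0; have [+ _] := f_smooth (nseq n false).
have -> : mixed_partial (nseq n false) f = iter n partial_x f.
  by elim: n => //= n ->.
exact.
Qed.

Lemma forcing_bound (n : nat) (t : R) : 0 < t -> exists2 C, 0 <= C &
  forall y tau, 0 <= y -> 0 <= tau <= t ->
    normc (iter n partial_x f y tau) <= C * (1 + y ^+ 2)^-1.
Proof.
move=> t0; have [C C0 fC] := lorentz_bound
  (fun p : R * R => normc_ge0 (iter n partial_x f p.1 p.2))
  (f_schwartz 0%N n t0) (f_schwartz 2%N n t0).
exists C => // y tau y0 taut; apply: (fC (y, tau)).
by split; rewrite /= in_itv /= ?y0.
Qed.

Lemma forcing_tame (n : nat) : tame (iter n partial_x f).
Proof.
split; last exact: forcing_bound.
by apply: cmeasurable_quadrant => y tau; exact: forcing_derivable.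
Qed.

Lemma forcing_fourier_by_parts (l tau : R) : 0 <= tau ->
  half_fourier (fun y => f y tau) l%:C = ((1 + l ^+ 2)^-1)%:C *
    (half_fourier (fun y => f y tau) l%:C
     - half_fourier (fun y => partial_x (partial_x f) y tau) l%:C
     - partial_x f 0 tau - 'i%C * l%:C * f 0 tau).
Proof.
move=> tau0; have tau1 : 0 < tau + 1 by lra.
have [C0 C00 f0] := forcing_bound 0 tau1.
have [C1 C10 f1] := forcing_bound 1 tau1.
have [C2 C20 f2] := forcing_bound 2 tau1.
have taut : 0 <= tau <= tau + 1 by lra.
apply: (@half_fourier_by_parts _ (fun y => f y tau) l (C0 + C1 + C2)) => y y0.
- exact: (forcing_derivable 0 y0 tau0).1.
- exact: (forcing_derivable 1 y0 tau0).1.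
- exact: (forcing_derivable 2 y0 tau0).1.
have W0 : 0 <= (1 + y ^+ 2)^-1 by exact/ltW/lorentz_gt0.
split.
- by apply: le_trans (f0 y tau y0 taut) _; apply: ler_wpM2r => //; lra.
- by apply: le_trans (f1 y tau y0 taut) _; apply: ler_wpM2r => //; lra.
- by apply: le_trans (f2 y tau y0 taut) _; apply: ler_wpM2r => //; lra.
Qed.

End Forcing.
End Data.

(** * The five terms of the solution *)

Section BoundaryTerms.
Context {R : realType} (alpha beta sigma x T : R).
Hypothesis alpha_gt0 : 0 < alpha.
Hypothesis beta_gt0 : 0 < beta.
Hypothesis sigma2 : sigma ^+ 2 = 1.
Hypothesis x_gt0 : 0 < x.
Hypothesis T_gt0 : 0 < T.

Let h := height alpha beta sigma.
Let z := branch alpha beta sigma.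
Let r a := rho alpha beta (z a).
Let dz := dbranch alpha beta sigma.
Let c1 a := ('i%C * z a + r a) / ('i%C * z a - r a) * dz a.
Let c2 a := 2 * 'i%C * z a / ('i%C * z a - r a) * dz a.
Let K t := evolution_kernel alpha beta x t.

Let pz : poly_bounded z := poly_bounded_branch alpha_gt0 beta_gt0 sigma2.
Let pr : poly_bounded r := poly_bounded_rho alpha_gt0 beta_gt0 sigma2.
Let pdz : poly_bounded dz := poly_bounded_dbranch alpha_gt0 beta_gt0 sigma2.
Let pq : poly_bounded (fun a => ('i%C * z a - r a)^-1) :=
  poly_bounded_inv_diff alpha_gt0 beta_gt0 sigma2.
Let mz : cmeasurable setT z := cmeasurable_branch alpha beta sigma.
Let mr : cmeasurable setT r := cmeasurable_rho_branch alpha beta sigma.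
Let mdz : cmeasurable setT dz.
Proof. exact: cmeasurable_dbranch. Qed.

Let piz : poly_bounded (fun a => 'i%C * z a).
Proof. by apply: poly_boundedM => //; exact: poly_bounded_cst. Qed.

Let miz : cmeasurable setT (fun a => 'i%C * z a).
Proof. by apply: cmeasurableM => //; exact: cmeasurable_cst. Qed.

Let mq : cmeasurable setT (fun a => ('i%C * z a - r a)^-1).
Proof. by apply: cmeasurableV; exact: cmeasurableB. Qed.

Let pc1 : poly_bounded c1.
Proof. by do 2!apply: poly_boundedM => //; exact: poly_boundedD. Qed.

Let pc2 : poly_bounded c2.
Proof.
by do 3!apply: poly_boundedM => //; exact: poly_bounded_cst.
Qed.

Let mc1 : cmeasurable setT c1.
Proof. by do 2!apply: cmeasurableM => //; exact: cmeasurableD. Qed.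

Let mc2 : cmeasurable setT c2.
Proof. by do 3!apply: cmeasurableM => //; exact: cmeasurable_cst. Qed.

Let Im_oppz a : Im (- z a) <= 0.
Proof. by rewrite ImN oppr_le0; exact: height_ge0. Qed.

Let Im_irho a : Im ('i%C * r a) <= 0.
Proof.
have := Re_rho_le0 alpha beta (z a); rewrite -/(r a).
by case: (r a) => p s /=; rewrite mul0r mul1r add0r.
Qed.

Let moppz : cmeasurable setT (fun a => - z a) := cmeasurableN mz.

Let mirho : cmeasurable setT (fun a => 'i%C * r a).
Proof. by apply: cmeasurableM => //; exact: cmeasurable_cst. Qed.

(** The arguments - l and i rho of the transforms have nonpositive imaginary
    parts on the curve: the transforms are bounded there. *)
Lemma boundary_initial_vanishing (u : R -> R[i]) : half_schwartz u ->
  vanishing (fun t => graph_integral h (fun l =>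
    K t l * reflected alpha beta (half_fourier u) l)).
Proof.
move=> /schwartz_tame tu; have [M M0 uM] := tame_fourier_le tu ltr01.
have mu' (l : R -> R[i]) : cmeasurable setT l ->
    cmeasurable setT (fun a => half_fourier u (l a)).
  move=> ml; have := tame_fourier_measurable tu ml => mf.
  by apply: (cmeasurable_comp (g := fun a : R => (a, 0 : R)) mf).
have uM' l : Im l <= 0 -> normc (half_fourier u l) <= M.
  by move=> l0; apply: (uM l 0) => //; rewrite lexx ler01.
have := boundary_data_vanishing alpha_gt0 beta_gt0 sigma2 x_gt0 pc1 pc2 mc1 mc2
  (mu' _ moppz) (mu' _ mirho) (fun a => uM' _ (Im_oppz a)) (fun a => uM' _ (Im_irho a)).
apply: near_eq_vanishing; near=> t; apply: eq_cintegral => a _.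
rewrite /K /evolution_kernel /reflected -[a +i* _]/(z a) -/(r a) -[1 +i* _]/(dz a).
by rewrite -mulrA; congr (_ * _); rewrite /c1 /c2; ring.
Unshelve. all: by end_near. Qed.

Lemma boundary_trace_vanishing (g0 g1 : R -> R[i]) :
  (forall tau, 0 <= tau -> half_derivable g0 tau) ->
  (forall tau, 0 <= tau -> half_derivable g1 tau) ->
  weakly_periodic T g0 -> weakly_periodic T g1 ->
  let I t := graph_integral h (fun l => K t l * l * ('i%C * l + rho alpha beta l) *
    (rho alpha beta l * time_transform g0 (omega alpha beta l) t
     - time_transform g1 (omega alpha beta l) t)) in
  vanishing (fun t => I (t + T) - I t).
Proof.
move=> dg0 dg1 pg0 pg1 I.
pose b1 a := z a * ('i%C * z a + r a) * r a * dz a.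
pose b2 a := z a * ('i%C * z a + r a) * dz a.
have pb : poly_bounded (fun a => z a * ('i%C * z a + r a)).
  by apply: poly_boundedM => //; exact: poly_boundedD.
have mb : cmeasurable setT (fun a => z a * ('i%C * z a + r a)).
  by apply: cmeasurableM => //; exact: cmeasurableD.
have pb1 : poly_bounded b1 by do 2!apply: poly_boundedM => //.
have pb2 : poly_bounded b2 by apply: poly_boundedM.
have mb1 : cmeasurable setT b1 by do 2!apply: cmeasurableM => //.
have mb2 : cmeasurable setT b2 by apply: cmeasurableM.
have mg (g : R -> R[i]) : (forall tau, 0 <= tau -> half_derivable g tau) ->
    cmeasurable setT (fun p : R * R => g `|p.2|).
  by move=> dg; exact: (cmeasurable_comp (g := snd) (cmeasurable_half dg)).
have gM (g : R -> R[i]) : (forall tau, 0 <= tau -> half_derivable g tau) ->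
    forall t, 0 < t -> exists2 M, 0 <= M &
      forall a tau : R, 0 <= tau <= t -> normc (g `|tau|) <= M.
  move=> dg t _; have [M M0 gM] := half_bounded t dg; exists M => // a tau taut.
  by rewrite ger0_norm; [exact: gM|case/andP: taut].
have gN (g : R -> R[i]) (a tau : R) : 0 <= tau ->
    normc (g `|tau + T| - g `|tau|) <= normc (g (tau + T) - g tau).
  by move=> tau0; rewrite (ger0_norm tau0) ger0_norm // addr_ge0 // ltW.
have := boundary_duhamel_vanishing alpha_gt0 beta_gt0 sigma2 x_gt0 T_gt0 pb1 pb2 mb1 mb2
  (mg _ dg0) (mg _ dg1) (gM _ dg0) (gM _ dg1) (gN g0) (gN g1)
  (weakly_periodic_integrable T_gt0 dg0 pg0) (weakly_periodic_integrable T_gt0 dg1 pg1).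
apply: near_eq_vanishing; near=> t.
congr (_ - _); apply: eq_cintegral => a _;
  rewrite /K /evolution_kernel -[a +i* _]/(z a) -/(r a) -[1 +i* _]/(dz a) !time_transform_normr;
  by rewrite -!mulrA; congr (_ * _); rewrite /b1 /b2; ring.
Unshelve. all: by end_near. Qed.

Lemma boundary_forcing_vanishing (f : R -> R -> R[i]) : tame f ->
  weakly_periodic2 T f ->
  let I t := graph_integral h (fun l => K t l *
    reflected alpha beta (fun m => half_fourier_time f m (omega alpha beta l) t) l) in
  vanishing (fun t => I (t + T) - I t).
Proof.
move=> tf pf I.
pose v (l : R -> R[i]) (a tau : R) := half_fourier (fun y => f y `|tau|) (l a).
have mv (l : R -> R[i]) : cmeasurable setT l ->
    cmeasurable setT (fun p : R * R => v l p.1 p.2).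
  by move=> ml; exact: tame_fourier_measurable.
have vM (l : R -> R[i]) : (forall a, Im (l a) <= 0) ->
    forall t, 0 < t -> exists2 M, 0 <= M &
      forall a tau, 0 <= tau <= t -> normc (v l a tau) <= M.
  move=> l0 t t0; have [M M0 fM] := tame_fourier_le tf t0; exists M => // a tau taut.
  by rewrite /v ger0_norm; [exact: fM|case/andP: taut].
have [N iN fN] := tame_fourier_increment tf T_gt0 pf.
have vN (l : R -> R[i]) : (forall a, Im (l a) <= 0) -> forall a tau, 0 <= tau ->
    normc (v l a (tau + T) - v l a tau) <= N tau.
  move=> l0 a tau tau0; have tauT : 0 <= tau + T by rewrite addr_ge0 // ltW.
  by rewrite /v (ger0_norm tau0) (ger0_norm tauT); exact: fN.
have := boundary_duhamel_vanishing alpha_gt0 beta_gt0 sigma2 x_gt0 T_gt0 pc1 pc2 mc1 mc2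
  (mv _ moppz) (mv _ mirho) (vM _ Im_oppz) (vM _ Im_irho) (vN _ Im_oppz) (vN _ Im_irho)
  iN iN.
apply: near_eq_vanishing; near=> t.
have vE (l : R -> R[i]) a s : time_transform (v l a) (omega alpha beta (z a)) s =
    half_fourier_time f (l a) (omega alpha beta (z a)) s := time_transform_normr _ _ _.
have KE a s : K s (z a) * reflected alpha beta
      (fun m => half_fourier_time f m (omega alpha beta (z a)) s) (z a) * dz a =
    cexp ('i%C * z a * x%:C - omega alpha beta (z a) * s%:C) *
    (c1 a * time_transform (v (fun a => - z a) a) (omega alpha beta (z a)) s
     - c2 a * time_transform (v (fun a => 'i%C * r a) a) (omega alpha beta (z a)) s).
  rewrite vE vE /K /evolution_kernel /reflected -/(r a) -mulrA; congr (_ * _).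
  move: (half_fourier_time f _ _ _) (half_fourier_time f _ _ _) => A B.
  by rewrite /c1 /c2; ring.
by congr (_ - _); apply: eq_cintegral => a _; exact: KE.
Unshelve. all: by end_near. Qed.

End BoundaryTerms.

Section LineTerms.
Context {R : realType} (alpha beta x T : R).
Hypothesis alpha_gt0 : 0 < alpha.
Hypothesis beta_gt0 : 0 < beta.
Hypothesis x_gt0 : 0 < x.
Hypothesis T_gt0 : 0 < T.

Let K t := evolution_kernel alpha beta x t.

Let mreal : cmeasurable setT (fun a : R => a%:C).
Proof. by apply: cmeasurable_real; exact: measurable_id. Qed.

Lemma line_initial_vanishing (u : R -> R[i]) : half_schwartz u ->
  vanishing (fun t => line_integral (fun l => K t l * half_fourier u l)).
Proof.
move=> /schwartz_tame tu; have [M M0 uM] := tame_fourier_le tu ltr01.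
apply: (@line_data_vanishing _ alpha beta x alpha_gt0 beta_gt0 (fun a => half_fourier u a%:C) M).
  have mf := tame_fourier_measurable tu mreal.
  by apply: (cmeasurable_comp (g := fun a : R => (a, 0 : R)) mf).
by move=> a; apply: (uM a%:C 0); rewrite ?lexx ?ler01.
Qed.

Lemma line_forcing_vanishing (f : R -> R -> R[i]) :
  quadrant_smooth f -> loc_unif_schwartz f ->
  weakly_periodic T (f 0) -> weakly_periodic T (partial_x f 0) ->
  weakly_periodic2 T f -> weakly_periodic2 T (partial_x (partial_x f)) ->
  let I t := line_integral (fun l =>
    K t l * half_fourier_time f l (omega alpha beta l) t) in
  vanishing (fun t => I (t + T) - I t).
Proof.
move=> sf bf pf0 pfx0 pf pfxx I.
have tf : tame f by exact: (forcing_tame sf bf 0).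
have tfxx : tame (partial_x (partial_x f)) by exact: (forcing_tame sf bf 2).
have df0 tau : 0 <= tau -> half_derivable (f 0) tau.
  by move=> tau0; exact: (forcing_derivable sf 0 (lexx 0) tau0).2.
have dfx0 tau : 0 <= tau -> half_derivable (partial_x f 0) tau.
  by move=> tau0; exact: (forcing_derivable sf 1 (lexx 0) tau0).2.
pose v (p : R -> R -> R[i]) (a tau : R) := half_fourier (fun y => p y `|tau|) a%:C.
have mv p : tame p -> cmeasurable setT (fun q : R * R => v p q.1 q.2).
  by move=> tp; exact: (tame_fourier_measurable tp mreal).
have [N iN fN] := tame_fourier_increment tf T_gt0 pf.
have [N2 iN2 fxxN] := tame_fourier_increment tfxx T_gt0 pfxx.
have tauT tau : 0 <= tau -> 0 <= tau + T by move=> tau0; rewrite addr_ge0 // ltW.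
have vM t : 0 < t -> exists2 M, 0 <= M &
    forall a tau, 0 <= tau <= t -> normc (v f a tau) <= M.
  move=> t0; have [M M0 fM] := tame_fourier_le tf t0; exists M => // a tau taut.
  by rewrite /v ger0_norm; [exact: fM|case/andP: taut].
have v_id a tau : 0 <= tau -> v f a tau = ((1 + a ^+ 2)^-1)%:C *
    (v f a tau - v (partial_x (partial_x f)) a tau - partial_x f 0 tau
     - 'i%C * a%:C * f 0 tau).
  by move=> tau0; rewrite /v (ger0_norm tau0); exact: forcing_fourier_by_parts.
have vN a tau : 0 <= tau -> normc (v f a (tau + T) - v f a tau) <= N tau.
  by move=> tau0; rewrite /v (ger0_norm tau0) (ger0_norm (tauT _ tau0)); exact: fN.
have v2N a tau : 0 <= tau -> normc (v (partial_x (partial_x f)) a (tau + T)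
    - v (partial_x (partial_x f)) a tau) <= N2 tau.
  by move=> tau0; rewrite /v (ger0_norm tau0) (ger0_norm (tauT _ tau0)); exact: fxxN.
have IE s : I s = cintegral setT (fun a => cexp ('i%C * a%:C * x%:C
    - omega alpha beta a%:C * s%:C) *
    time_transform (v f a) (omega alpha beta a%:C) s).
  have vE a : time_transform (v f a) (omega alpha beta a%:C) s =
    half_fourier_time f a%:C (omega alpha beta a%:C) s := time_transform_normr _ _ _.
  by apply: eq_cintegral => a _; rewrite vE; move: (half_fourier_time _ _ _ _).
have := line_duhamel_vanishing alpha_gt0 beta_gt0 x_gt0 T_gt0
  (mv _ tf) (fun tau => cmeasurable_section (mv _ tfxx) tau) vM v_id vN v2N
  (fun tau _ => lexx _) (fun tau _ => lexx _) iN iN2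
  (weakly_periodic_integrable T_gt0 df0 pf0)
  (weakly_periodic_integrable T_gt0 dfx0 pfx0).
by apply: near_eq_vanishing; near=> t; rewrite !IE.
Unshelve. all: by end_near. Qed.

End LineTerms.

(** * Eventual periodicity *)

Lemma vanishing_cvg (R : realType) (F : R -> R[i]) : vanishing F ->
  (F t : R[i]^o) @[t --> +oo] --> (0 : R[i]^o).
Proof.
move=> F0; apply/cvgrPdist_lt => e e0.
have -> : e = (Re e)%:C by apply: complexP => //=; case: e e0 => p q; rewrite ltcE /= => /andP[/eqP].
have Re0 : 0 < Re e by case: e e0 => p q; rewrite ltcE /= => /andP[].
near=> t; rewrite sub0r normrN.
rewrite (_ : `|F t| = (normc (F t))%:C) // ltcR.
rewrite -[ltLHS]ger0_norm ?normc_ge0 // -normrN -sub0r.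
by near: t; move/cvgrPdist_lt: F0; exact.
Unshelve. all: by end_near. Qed.

Section EventuallyPeriodic.
Context {R : realType} (T : R).
Implicit Types F G : R -> R[i].

Definition eventually_periodic F := vanishing (fun t => F (t + T) - F t).

Lemma vanishing_eventually_periodic F : vanishing F -> eventually_periodic F.
Proof. by move=> F0; exact: vanishingB (vanishing_shift T F0) F0. Qed.

Lemma eventually_periodicZ F (c : R[i]) :
  eventually_periodic F -> eventually_periodic (fun t => c * F t).
Proof.
move=> /(vanishingZ c); rewrite /eventually_periodic.
by under eq_fun do rewrite mulrBr.
Qed.

Lemma eventually_periodicD F G : eventually_periodic F -> eventually_periodic G ->
  eventually_periodic (fun t => F t + G t).
Proof.
move=> pF /(vanishingD pF); rewrite /eventually_periodic.
by under eq_fun do rewrite addrACA -opprD.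
Qed.

Lemma eventually_periodicB F G : eventually_periodic F -> eventually_periodic G ->
  eventually_periodic (fun t => F t - G t).
Proof.
move=> pF /(eventually_periodicZ (-1)) /(eventually_periodicD pF).
by rewrite /eventually_periodic; under eq_fun do rewrite !mulN1r.
Qed.

End EventuallyPeriodic.

Theorem theorem10 (R : realType) (alpha beta T : R)
    (u0 g0 g1 : R -> R[i]) (f : R -> R -> R[i])
    (alpha_gt0 : 0 < alpha) (beta_gt0 : 0 < beta) (T_gt0 : 0 < T)
    (u0_schwartz : half_schwartz u0)
    (g0_smooth : half_smooth g0) (g1_smooth : half_smooth g1)
    (f_smooth : quadrant_smooth f) (f_schwartz : loc_unif_schwartz f)
    (g0_per : weakly_periodic T g0) (g1_per : weakly_periodic T g1)
    (f0_per : weakly_periodic T (f 0))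
    (fx0_per : weakly_periodic T (partial_x f 0))
    (f_per : weakly_periodic2 T f)
    (fxx_per : weakly_periodic2 T (partial_x (partial_x f))) :
  forall x0 : R, 0 < x0 ->
    (solution alpha beta u0 g0 g1 f x0 (t + T)
     - solution alpha beta u0 g0 g1 f x0 t : R[i]^o)
      @[t --> +oo] --> (0 : R[i]^o).
Proof.
move=> x0 x0_gt0; apply: vanishing_cvg.
have lower2 : (-1) ^+ 2 = 1 :> R by rewrite sqrrN expr1n.
have upper2 : 1 ^+ 2 = 1 :> R by rewrite expr1n.
have tf : tame f := forcing_tame f_smooth f_schwartz 0.
have dg0 := g0_smooth 0%N; have dg1 := g1_smooth 0%N.
have V1 := vanishing_eventually_periodic T (line_initial_vanishing x0 alpha_gt0 beta_gt0 u0_schwartz).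
have V2 sigma (s2 : sigma ^+ 2 = 1) := vanishing_eventually_periodic T
  (boundary_initial_vanishing alpha_gt0 beta_gt0 s2 x0_gt0 u0_schwartz).
have V3 sigma (s2 : sigma ^+ 2 = 1) := boundary_trace_vanishing
  alpha_gt0 beta_gt0 s2 x0_gt0 T_gt0 dg0 dg1 g0_per g1_per.
have V4 := line_forcing_vanishing alpha_gt0 beta_gt0 x0_gt0 T_gt0
  f_smooth f_schwartz f0_per fx0_per f_per fxx_per.
have V5 sigma (s2 : sigma ^+ 2 = 1) := boundary_forcing_vanishing
  alpha_gt0 beta_gt0 s2 x0_gt0 T_gt0 tf f_per.
pose k : R[i] := ((2 * pi)^-1)%:C.
have := eventually_periodicD (eventually_periodicD (eventually_periodicB
  (eventually_periodicD
    (eventually_periodicZ k V1)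
    (eventually_periodicZ k (eventually_periodicB (V2 _ lower2) (V2 _ upper2))))
    (eventually_periodicZ (beta%:C * 'i%C / pi%:C)
      (eventually_periodicB (V3 _ lower2) (V3 _ upper2))))
    (eventually_periodicZ k V4))
    (eventually_periodicZ k (eventually_periodicB (V5 _ lower2) (V5 _ upper2))).
rewrite /eventually_periodic /solution /boundary_integral.
rewrite lower_heightE upper_heightE; exact.
Qed.
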